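(* Let $S$ be a monoid. In each of the following eight cases, if every word in the set $W$ is an isoterm for $S$ and $S$ satisfies the identity $\mathbf U_n\approx\mathbf V_n$ for every $n>1$, then $S$ is non-finitely based. (All letters denote distinct variables; $[Xn]=x_1x_2\cdots x_n$, $[nX]=x_nx_{n-1}\cdots x_1$, and similarly for other letters.) 1. $W=\{xyyx\}$; $\ xx[Yn][nY]\approx[Yn][nY]xx$. 2. $W=\{yxxty,\ ytxxy\}$; $\ z_1t_1z_2t_2\cdots z_nt_n\,yxx\,[Zn]\,y\approx z_1t_1z_2t_2\cdots z_nt_n\,xxy\,[Zn]\,y$. 3. $W=\{xt_1xyt_2y\}$; $\ \mathbf A\,x\,\mathbf B\,xy\,\mathbf C\,y\,\mathbf D\approx\mathbf A\,x\,\mathbf B\,yx\,\mathbf C\,y\,\mathbf D$, where $\mathbf A=z_1tp_1tz_2tp_2t\cdots z_ntp_nt$, $\mathbf B=z_1q_1z_2q_2\cdots z_nq_n$, $\mathbf C=p_1r_1p_2r_2\cdots p_nr_n$, $\mathbf D=tq_1tr_1tq_2tr_2\cdots tq_ntr_n$, and each displayed occurrence of $t$ is a different linear variable. 4. $W=\{xxyy,\ xyt_1yt_2x\}$; $\ xyty\,z_1^2z_2^2\cdots z_n^2\,x\approx yxty\,z_1^2z_2^2\cdots z_n^2\,x$. 5. $W=\{xt_1yxt_2y,\ xytxy,\ xytyx\}$; $\ xy[Zn]yxt[nZ]\approx yx[Zn]xyt[nZ]$. 6. $W=\{xt_1yxt_2y,\ xytxy,\ xytyx\}$; $\ xy[Zn]xyt[nZ]\approx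 yx[Zn]yxt[nZ]$. 7. $W=\{xt_1xyt_2y,\ xyyx\}$; $\ [Xn][nX][Yn][nY]\approx[Yn][nY][Xn][nX]$. 8. For a fixed integer $m>2$: $W=\{xxyy\}\cup\{yt_1yx^dt_2x^{m-d},\ x^{m-d}t_1x^dyt_2y: 0<d<m\}$; $\ yt_1x^{m-1}y\,p_1^2\cdots p_n^2\,zxt_2z\approx yt_1x^my\,p_1^2\cdots p_n^2\,zt_2z$.
   Context: Words are elements of the free semigroup over a countably infinite alphabet of variables. A monoid $S$ satisfies an identity $\mathbf u\approx\mathbf v$ if both sides are equal under every evaluation of the variables in $S$. A word $\mathbf w$ is an isoterm for $S$ if $S$ satisfies no identity $\mathbf w\approx\mathbf w'$ with $\mathbf w'\ne\mathbf w$. $S$ is finitely based if all identities of $S$ are derivable from a finite subset of them; otherwise non-finitely based. A variable is linear in a word if it occurs exactly once. *)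

(* Defs.v *)
From mathcomp Require Import all_boot.
Set Implicit Arguments. Unset Strict Implicit. Unset Printing Implicit Defensive.

Record monoid := Monoid {
  carrier :> Type;
  mmul : carrier -> carrier -> carrier;
  mone : carrier;
  mmulA : forall a b c, mmul a (mmul b c) = mmul (mmul a b) c;
  mmul1 : forall a, mmul mone a = a;
  mmul1r : forall a, mmul a mone = a }.

(* Variables are natural numbers; a word is a sequence of variables.
   Words of the free semigroup are the NONEMPTY sequences. *)
Definition word := seq nat.
Definition is_word (w : word) : bool := w != [::].

Definition eval (S : monoid) (phi : nat -> S) (w : word) : S :=
  foldr (fun x acc => mmul (phi x) acc) (mone S) w.

Definition satisfies (S : monoid) (u v : word) : Prop :=
  forall phi : nat -> S, eval phi u = eval phi v.

Definition isoterm (S : monoid) (w : word) : Prop :=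
  forall w' : word, is_word w' -> satisfies S w w' -> w' = w.

(* Equational deduction for monoid identities: replace a substitution
   instance theta(s) of a side of an identity (s,t) of Sigma inside a word
   by theta(t); substitutions map variables to possibly empty words
   (monoid setting), contexts a, b are possibly empty. *)
Definition subst (theta : nat -> word) (w : word) : word :=
  flatten (map theta w).

Inductive derivable (Sigma : seq (word * word)) : word -> word -> Prop :=
| der_step : forall s t a b theta, (s, t) \in Sigma ->
    derivable Sigma (a ++ subst theta s ++ b) (a ++ subst theta t ++ b)
| der_refl : forall u, derivable Sigma u u
| der_sym : forall u v, derivable Sigma u v -> derivable Sigma v u
| der_trans : forall u v w, derivable Sigma u v -> derivable Sigma v w ->
    derivable Sigma u w.

Definition finitely_based (S : monoid) : Prop :=
  exists Sigma : seq (word * word),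
    (forall s t, (s, t) \in Sigma -> [/\ is_word s, is_word t & satisfies S s t]) /\
    (forall u v, is_word u -> is_word v -> satisfies S u v -> derivable Sigma u v).

Definition nfb_criterion (S : monoid) (W : seq word) (U V : nat -> word) : Prop :=
  (forall w, w \in W -> isoterm S w) ->
  (forall n, 1 < n -> satisfies S (U n) (V n)) ->
  ~ finitely_based S.

(* Variable with letter code a (< 16) and index i; index 0 = unindexed. *)
Definition vr (a i : nat) : nat := i * 16 + a.
Definition x := vr 0 0.  Definition y := vr 1 0.  Definition z := vr 2 0.
Definition t := vr 3 0.  Definition t1 := vr 4 0. Definition t2 := vr 5 0.
Definition xs i := vr 0 i. Definition ys i := vr 1 i. Definition zs i := vr 2 i.
Definition ts i := vr 3 i. Definition ps i := vr 6 i. Definition qs i := vr 7 i.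
Definition rs i := vr 8 i.

Definition up (f : nat -> nat) (n : nat) : word := [seq f i | i <- iota 1 n].
Definition down (f : nat -> nat) (n : nat) : word := rev (up f n).
Definition blocks (g : nat -> word) (n : nat) : word :=
  flatten [seq g i | i <- iota 1 n].

Definition W1 : seq word := [:: [:: x; y; y; x]].
Definition U1 n : word := [:: x; x] ++ up ys n ++ down ys n.
Definition V1 n : word := up ys n ++ down ys n ++ [:: x; x].

Definition W2 : seq word := [:: [:: y; x; x; t; y]; [:: y; t; x; x; y]].
Definition U2 n : word :=
  blocks (fun i => [:: zs i; ts i]) n ++ [:: y; x; x] ++ up zs n ++ [:: y].
Definition V2 n : word :=
  blocks (fun i => [:: zs i; ts i]) n ++ [:: x; x; y] ++ up zs n ++ [:: y].

(* the 4n occurrences of t are the distinct linear variables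
   ts 1, ..., ts (4n) *)
Definition W3 : seq word := [:: [:: x; t1; x; y; t2; y]].
Definition A3 n : word :=
  blocks (fun i => [:: zs i; ts (2 * i - 1); ps i; ts (2 * i)]) n.
Definition B3 n : word := blocks (fun i => [:: zs i; qs i]) n.
Definition C3 n : word := blocks (fun i => [:: ps i; rs i]) n.
Definition D3 n : word :=
  blocks (fun i => [:: ts (2 * n + 2 * i - 1); qs i; ts (2 * n + 2 * i); rs i]) n.
Definition U3 n : word :=
  A3 n ++ [:: x] ++ B3 n ++ [:: x; y] ++ C3 n ++ [:: y] ++ D3 n.
Definition V3 n : word :=
  A3 n ++ [:: x] ++ B3 n ++ [:: y; x] ++ C3 n ++ [:: y] ++ D3 n.

Definition W4 : seq word := [:: [:: x; x; y; y]; [:: x; y; t1; y; t2; x]].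
Definition U4 n : word :=
  [:: x; y; t; y] ++ blocks (fun i => [:: zs i; zs i]) n ++ [:: x].
Definition V4 n : word :=
  [:: y; x; t; y] ++ blocks (fun i => [:: zs i; zs i]) n ++ [:: x].

Definition W56 : seq word :=
  [:: [:: x; t1; y; x; t2; y]; [:: x; y; t; x; y]; [:: x; y; t; y; x]].
Definition U5 n : word := [:: x; y] ++ up zs n ++ [:: y; x; t] ++ down zs n.
Definition V5 n : word := [:: y; x] ++ up zs n ++ [:: x; y; t] ++ down zs n.
Definition U6 n : word := [:: x; y] ++ up zs n ++ [:: x; y; t] ++ down zs n.
Definition V6 n : word := [:: y; x] ++ up zs n ++ [:: y; x; t] ++ down zs n.

Definition W7 : seq word := [:: [:: x; t1; x; y; t2; y]; [:: x; y; y; x]].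
Definition U7 n : word := up xs n ++ down xs n ++ up ys n ++ down ys n.
Definition V7 n : word := up ys n ++ down ys n ++ up xs n ++ down xs n.

Definition W8 (m : nat) : seq word :=
  [:: [:: x; x; y; y]] ++
  [seq [:: y; t1; y] ++ nseq d x ++ [:: t2] ++ nseq (m - d) x | d <- iota 1 (m - 1)] ++
  [seq nseq (m - d) x ++ [:: t1] ++ nseq d x ++ [:: y; t2; y] | d <- iota 1 (m - 1)].
Definition U8 (m n : nat) : word :=
  [:: y; t1] ++ nseq (m - 1) x ++ [:: y] ++ blocks (fun i => [:: ps i; ps i]) n
  ++ [:: z; x; t2; z].
Definition V8 (m n : nat) : word :=
  [:: y; t1] ++ nseq m x ++ [:: y] ++ blocks (fun i => [:: ps i; ps i]) n
  ++ [:: z; t2; z].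

(* Main.v *)
Require Import Defs.
From mathcomp Require Import all_boot zify.
Set Implicit Arguments. Unset Strict Implicit. Unset Printing Implicit Defensive.

(** Fix a finite set of identities of S involving at most k letters each, and
    let n be larger than k. A step a θ(s) b -> a θ(t) b on a word equivalent
    to U_n is contracted: a variable repeated in s is replaced by its value
    under θ, while a linear variable of s stays a letter. As S satisfies the
    contracted identity, the isoterms tell which pairs of letters may be
    exchanged; a linear letter never takes part in an exchange. A repeated
    variable covers at most one of the n indexed letters of U_n, so for some
    index i the occurrences of that letter are covered by linear variables.
    Such a linear variable separates the occurrences of the few letters on
    which U_n and V_n differ and completes them to one of the given isoterms,
    so that no step can change their relative order. In cases 3, 5 and 6 no
    step changes U_n at all; case 7 is a consequence of case 1. *)

(** * Restrictions of words *)

(** The value of a linear variable may contain many letters, yet as a letter of the contracted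
    identity it occurs once, so it can play the part of a t in an isoterm. Every case has to show
    first that no letter moves across a linear one. This is direct when xxt, xtx and txx are
    isoterms; in cases 3, 5 and 6, and for the m-th power of x in case 8, the repeated letter is
    first shown to be split by some other linear letter. Case 1 is different, as its isoterm has no
    linear letter: there the letters y_i have pairwise nested occurrences, so x cannot change its
    order with one y_j without changing it with every y_i in the same step, and this would require
    all of them in the contracted identity. In case 8 and in half of case 3 the source of a step
    need not restrict to an isoterm. There the forbidden order is excluded because the target would
    restrict to one, and the source would then have to agree with it. *)

Section Restriction.
Variable T : eqType.
Implicit Types (E F d u v w p q : seq T) (a b c e h : T).

Definition only E w := [seq c <- w | c \in E].
Arguments only : simpl never.

Lemma only_cat E u v : only E (u ++ v) = only E u ++ only E v.
Proof. exact: filter_cat. Qed.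

Lemma only_cons E a u : only E (a :: u) = if a \in E then a :: only E u else only E u.
Proof. by []. Qed.

Lemma only_rev E w : only E (rev w) = rev (only E w).
Proof. exact: filter_rev. Qed.

Lemma only_sub E F w : {subset E <= F} -> only E (only F w) = only E w.
Proof.
move=> sEF; rewrite /only -filter_predI; apply: eq_filter => c /=.
by case cE: (c \in E) => //=; rewrite sEF.
Qed.

Lemma eq_only E F w : E =i F -> only E w = only F w.
Proof. by move=> eqEF; apply: eq_filter => c; rewrite eqEF. Qed.

Lemma onlyC a b w : only [:: a; b] w = only [:: b; a] w.
Proof. by apply: eq_only => c; rewrite !inE orbC. Qed.

Lemma count_only E c w : c \in E -> count_mem c (only E w) = count_mem c w.
Proof.
move=> cE; rewrite count_filter; apply: eq_count => e /=.
by case: eqP => // ->; rewrite cE.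
Qed.

Lemma mem_only E c w : (c \in only E w) = (c \in E) && (c \in w).
Proof. exact: mem_filter. Qed.

Lemma only0 E w : (only E w = [::]) <-> {in E, forall c, c \notin w}.
Proof.
split=> [w0 c cE|w0].
  by apply/negP => cw; have := mem_only E c w; rewrite w0 cE cw.
apply/eqP; rewrite -size_eq0 -leqn0 leqNgt size_filter -has_count.
by apply/hasPn => c cw; apply/negP => /w0; rewrite cw.
Qed.

Lemma only_split E w r1 e r2 : only E w = r1 ++ e :: r2 ->
  exists p q, [/\ w = p ++ e :: q, only E p = r1 & only E q = r2].
Proof.
elim: w r1 => [|a w IHw] r1 /=; first by case: r1.
rewrite only_cons; case: ifP => [aE|aE].
  case: r1 => [|b r1] /= [ea eqw]; first by exists [::], w; rewrite ea.
  have [p [q [-> eqp eqq]]] := IHw _ eqw; rewrite -ea.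
  by exists (a :: p), q; rewrite only_cons aE eqp.
move=> /IHw[p [q [-> eqp eqq]]].
by exists (a :: p), q; rewrite only_cons aE.
Qed.

(** The pair formed by the two first letters forces them to agree, and cancelling them preserves the
    hypothesis. Comparing words is thereby reduced to two letters at a time. *)
Lemma eq_from_pairs u v :
  (forall a b, a \in u ++ v -> b \in u ++ v -> only [:: a; b] u = only [:: a; b] v) ->
  u = v.
Proof.
elim: u v => [|a u IHu] [|b v] //= H.
- by have := H b b (mem_head _ _) (mem_head _ _); rewrite !only_cons inE eqxx.
- by have := H a a (mem_head _ _) (mem_head _ _); rewrite !only_cons inE eqxx.
have bin : b \in a :: u ++ b :: v by rewrite inE mem_cat mem_head !orbT.
have := H a b (mem_head _ _) bin; rewrite !only_cons !inE !eqxx orbT => -[eqab _].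
rewrite -eqab in H *; congr (_ :: _); apply: IHu => c e cin ein.
have sub f : f \in u ++ v -> f \in a :: u ++ a :: v.
  by rewrite inE !mem_cat inE => /orP[->|->]; rewrite ?orbT.
have := H c e (sub _ cin) (sub _ ein); rewrite !only_cons.
by case: ifP => // _ [].
Qed.

Lemma eq_filter_from_pairs (P : pred T) u v :
  (forall a b, P a -> P b -> only [:: a; b] u = only [:: a; b] v) ->
  filter P u = filter P v.
Proof.
move=> H; apply: eq_from_pairs => a b.
rewrite -filter_cat !mem_filter => /andP[Pa _] /andP[Pb _].
suff E w : only [:: a; b] (filter P w) = only [:: a; b] w by rewrite !E; exact: H.
rewrite /only -filter_predI; apply: eq_filter => c /=; rewrite !inE.
by case: eqP => [->|_] //=; case: eqP => [->|_] //=.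
Qed.

(** Assembles a restriction to several letters from two-letter ones. [pairwise] visits each
    unordered pair once; since [1 < size F], the multiplicity of a single letter can be read off a
    pair that contains it. *)
Lemma only_from_pairs F w r : 1 < size F -> uniq F -> all (mem F) r ->
  pairwise (fun a b => only [:: a; b] w == only [:: a; b] r) F -> only F w = r.
Proof.
move=> sF uF /all_filterP er pF; rewrite -er {er}; apply: eq_filter_from_pairs => a b aF bF.
have {pF} H : forall c (d : T), c \in F -> d \in F -> c != d ->
    only [:: c; d] w = only [:: c; d] r.
  elim: F {sF uF aF bF} pF => //= e F IHF /andP[/allP eF /IHF{}IHF] c d.
  rewrite !inE => /orP[/eqP->|cF] /orP[/eqP->|dF] ncd; first by rewrite eqxx in ncd.
  - exact/eqP/eF.
  - by rewrite onlyC [RHS]onlyC; apply/eqP/eF.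
  - exact: IHF.
case: (eqVneq a b) => [<-|]; last exact: H.
have [c cF nac] : exists2 c, c \in F & a != c.
  case: F sF uF {aF bF H} => [|c [|d F]] //= _ /andP[ncd _].
  have [->|nac] := eqVneq a c; last by exists c; rewrite ?mem_head.
  exists d; first by rewrite !inE eqxx orbT.
  by move: ncd; rewrite inE negb_or => /andP[].
have sub : {subset [:: a; a] <= [:: a; c]} by move=> e; rewrite !inE orbb => ->.
by rewrite -(only_sub w sub) H // only_sub.
Qed.

Lemma only_run e h d : h \notin d -> only [:: e; h] d = nseq (count_mem e d) e.
Proof.
elim: d => // a d IHd; rewrite inE negb_or only_cons !inE => /andP[nha /IHd ->] /=.
by rewrite [a == h]eq_sym (negPf nha) orbF; case: eqP => [->|].
Qed.

Lemma only1 e u : only [:: e] u = nseq (count_mem e u) e.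
Proof. by elim: u => // c u IHu; rewrite only_cons inE IHu /=; case: eqP => [->|]. Qed.

Lemma split_first h u : h \in u -> exists d v, u = d ++ h :: v /\ h \notin d.
Proof.
elim: u => //= a u IHu; rewrite inE; have [-> _|nha /= /IHu] := eqVneq h a.
  by exists [::], u.
by move=> [d [v [-> hd]]]; exists (a :: d), v; rewrite inE negb_or nha.
Qed.

(* At the first difference, the letter h that comes too early in v has, in u,
   an immediate predecessor e with which it has been exchanged. *)
Lemma eq_from_adjacent u v : perm_eq u v ->
  (forall p e h q, u = p ++ e :: h :: q -> e != h ->
     only [:: e; h] u = only [:: e; h] v) ->
  u = v.
Proof.
move=> puv H.
suff: forall (c u' v' : seq T), u = c ++ u' -> v = c ++ v' -> u' = v' by move/(_ [::] u v); apply.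
move=> c u'; elim: u' c => [|g u' IHu] c v' eu ev.
  by move: puv; rewrite eu ev perm_cat2l perm_sym => /perm_nilP ->.
have puv' : perm_eq (g :: u') v' by move: puv; rewrite eu ev perm_cat2l.
case: v' => [|h v'] in ev puv' *; first by move/perm_nilP: (puv').
have [egh|ngh] := eqVneq g h.
  by rewrite -egh; congr (_ :: _); apply: (IHu (rcons c g)); rewrite cat_rcons ?eu // ev egh.
have : h \in g :: u' by rewrite (perm_mem puv') mem_head.
rewrite inE eq_sym (negPf ngh) /= => /split_first[d [u2 [eu' hd]]].
have hgd : h \notin g :: d by rewrite inE eq_sym negb_or ngh.
have neh : last g d != h by apply: contraNneq hgd => <-; exact: mem_last.
have eu2 : u = (c ++ belast g d) ++ last g d :: h :: u2.
  by rewrite eu eu' -cat_cons lastI cat_rcons catA.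
have := H _ _ _ _ eu2 neh; rewrite eu ev eu' -cat_cons !only_cat (only_run _ hgd).
have : 0 < count_mem (last g d) (g :: d) by rewrite -has_count has_pred1 mem_last.
case: (count_mem _ _) => // k _ /eqP; rewrite eqseq_cat // eqxx => /= /eqP.
by rewrite [only _ (h :: v')]only_cons !inE eqxx orbT => -[eh]; rewrite eh eqxx in neh.
Qed.
End Restriction.
Arguments only : simpl never.

(** * Identities and isoterms over an arbitrary alphabet *)

Definition expand (T T' : Type) (rho : T -> seq T') (u : seq T) : seq T' :=
  flatten (map rho u).

Arguments expand : simpl never.

Lemma expand_cons (T T' : Type) (rho : T -> seq T') c u :
  expand rho (c :: u) = rho c ++ expand rho u.
Proof. by []. Qed.

Lemma expand_cat (T T' : Type) (rho : T -> seq T') u v :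
  expand rho (u ++ v) = expand rho u ++ expand rho v.
Proof. by rewrite /expand map_cat flatten_cat. Qed.

Lemma expand_comp (T T' T'' : Type) (sigma : T' -> seq T'') (rho : T -> seq T') u :
  expand sigma (expand rho u) = expand (fun c => expand sigma (rho c)) u.
Proof. by elim: u => // c u IHu; rewrite !expand_cons expand_cat IHu. Qed.

Lemma expand_single (T T' : Type) (f : T -> T') u : expand (fun c => [:: f c]) u = map f u.
Proof. by elim: u => // c u IHu; rewrite expand_cons IHu. Qed.

Lemma expand_filter (T : eqType) T' (rho : T -> seq T') (P : pred T) u :
  expand rho (filter P u) = expand (fun c => if P c then rho c else [::]) u.
Proof. by elim: u => // c u IHu; rewrite expand_cons -IHu /=; case: (P c). Qed.

Lemma filter_expand T (T' : eqType) (rho : T -> seq T') (P : pred T') u :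
  filter P (expand rho u) = expand (fun c => filter P (rho c)) u.
Proof. by elim: u => // c u IHu; rewrite !expand_cons filter_cat IHu. Qed.

Lemma mem_expand T (T' : eqType) (rho : T -> seq T') d (u : seq T) :
  d \in expand rho u -> exists p e q, u = p ++ e :: q /\ d \in rho e.
Proof.
elim: u => // e u IHu; rewrite expand_cons mem_cat => /orP[de|/IHu[p [e' [q [-> de]]]]].
  by exists [::], e, u.
by exists (e :: p), e', q.
Qed.

Section Identities.
Variable S : monoid.

Lemma eval_cat (phi : nat -> S) u v : eval phi (u ++ v) = mmul (eval phi u) (eval phi v).
Proof. by elim: u => [|c u /= ->]; rewrite ?mmul1 ?mmulA. Qed.

Lemma eval_subst (phi : nat -> S) theta w :
  eval phi (subst theta w) = eval (fun c => eval phi (theta c)) w.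
Proof. by elim: w => //= c w <-; rewrite eval_cat. Qed.

Lemma satisfies_subst theta u v : satisfies S u v -> satisfies S (subst theta u) (subst theta v).
Proof. by move=> uv phi; rewrite !eval_subst uv. Qed.

Lemma satisfies_context a b u v : satisfies S u v -> satisfies S (a ++ u ++ b) (a ++ v ++ b).
Proof. by move=> uv phi; rewrite !eval_cat uv. Qed.

Lemma satisfies_sym u v : satisfies S u v -> satisfies S v u.
Proof. by move=> uv phi. Qed.

Lemma satisfies_trans u v w : satisfies S u v -> satisfies S v w -> satisfies S u w.
Proof. by move=> uv vw phi; rewrite uv. Qed.

(* An identity over the alphabet T holds when all its translations into words do. *)
Definition eqsat (T : eqType) (u v : seq T) : Prop :=
  forall rho : T -> word, satisfies S (expand rho u) (expand rho v).

Definition isoT (T : eqType) (u : seq T) : Prop := forall v, eqsat u v -> v = u.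

Lemma eqsat_word (u v : word) : satisfies S u v <-> eqsat u v.
Proof.
split=> [uv rho|/(_ (fun c => [:: c]))]; first exact: satisfies_subst.
by rewrite !expand_single !map_id.
Qed.

Lemma eqsat_sym (T : eqType) (u v : seq T) : eqsat u v -> eqsat v u.
Proof. by move=> uv rho; apply: satisfies_sym. Qed.

Lemma eqsat_expand (T T' : eqType) (rho : T -> seq T') u v :
  eqsat u v -> eqsat (expand rho u) (expand rho v).
Proof. by move=> uv sigma; rewrite !expand_comp; apply: uv. Qed.

Lemma eqsat_filter (T : eqType) (P : pred T) u v :
  eqsat u v -> eqsat (filter P u) (filter P v).
Proof. by move=> uv rho; rewrite !expand_filter; apply: uv. Qed.

Lemma eqsat_context (T : eqType) (a b u v : seq T) :
  eqsat u v -> eqsat (a ++ u ++ b) (a ++ v ++ b).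
Proof. by move=> uv rho; rewrite !expand_cat; apply: satisfies_context. Qed.

Lemma isoT_only (T : eqType) (E u v : seq T) :
  eqsat u v -> isoT (only E u) -> only E v = only E u.
Proof. by move=> uv; apply; apply: eqsat_filter. Qed.

(** An identity for the factor extends to the whole word, where the common context can be
    cancelled. *)
Lemma isoT_factor (T : eqType) (a b u : seq T) : isoT (a ++ u ++ b) -> isoT u.
Proof.
move=> iso v /(eqsat_context a b)/iso /eqP.
by rewrite eqseq_cat // eqxx /= -(inj_eq (can_inj revK)) !rev_cat eqseq_cat // eqxx => /eqP/(can_inj revK).
Qed.

(* The images c :: r c form a prefix code, hence the substitution is injective. *)
Lemma isoT_expand (T : eqType) (r : T -> seq T) (u : seq T) :
  isoT (expand (fun c => c :: r c) u) -> isoT u.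
Proof.
move=> iso v uv; move/(eqsat_expand (fun c => c :: r c))/iso: uv.
elim: v u {iso} => [|c v IHv] [|d u] //; rewrite !expand_cons => -[<-] /eqP.
by rewrite eqseq_cat // eqxx => /eqP/IHv ->.
Qed.

(** If w had the same values as the empty word, it would also have those of w w, a longer non-empty
    word, contrary to [isoterm]. *)
Lemma isoterm_isoT (w : word) : is_word w -> isoterm S w -> isoT w.
Proof.
move=> w0 iso v /eqsat_word wv; case: v => [|c v] in wv *; last exact: iso.
have /iso e2 : is_word (w ++ w) by case: (w) w0.
have /e2/(congr1 size) : satisfies S w (w ++ w).
  by move=> phi; rewrite eval_cat !wv mmul1.
by rewrite size_cat; case: (w) w0 => //= ? ?; lia.
Qed.

Lemma isoT_rename (T : eqType) (ls : seq nat) (E : seq T) e0 (w : word) :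
  size E = size ls -> uniq ls -> uniq E -> all (mem ls) w -> isoT w ->
  isoT (map (fun n => nth e0 E (index n ls)) w).
Proof.
move=> sE uls uE wls iso v wv.
(* N does not occur in w. Every letter outside [E] is sent to N, so a foreign letter of v would make
   N occur in w. *)
set N := (foldr maxn 0 w).+1.
have Nw : N \notin w.
  rewrite /N; apply/negP => /(nthP 0)[i lti]; elim: (w) i lti => //= c w' IHw [|i] /= lti.
    by lia.
  have : nth 0 w' i <= foldr maxn 0 w'.
    elim: (w') (i) (lti : i < size w') => //= d w'' IH [|j] /= ltj; first by lia.
    by have := IH j ltj; lia.
  lia.
have := wv (fun e => [:: nth N ls (index e E)]); rewrite !expand_single => /eqsat_word.
have -> : map (fun e => nth N ls (index e E)) (map (fun n => nth e0 E (index n ls)) w) = w.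
  rewrite -map_comp -[RHS]map_id; apply/eq_in_map => c /(allP wls)/= cls.
  by rewrite index_uniq ?nth_index ?sE ?index_mem.
move=> /iso ew; rewrite -[in RHS]ew -map_comp -[LHS]map_id; apply/eq_in_map => e ev /=.
have eE : e \in E.
  apply: contraR Nw => eE; rewrite -ew; apply/mapP; exists e => //.
  by rewrite nth_default // memNindex // sE.
by rewrite index_uniq ?nth_index // -sE index_mem.
Qed.
End Identities.

(** * Contracting a deduction step *)

(* inl c is a letter c of the rewritten word, inr h a linear variable h of the
   identity applied. *)
Notation symb := (nat + nat)%type.

Definition spell (theta : nat -> word) (e : symb) : word :=
  match e with inl c => [:: c] | inr h => theta h end.

(** No factor containing both letters occurs twice without overlap. Hence no variable repeated in an
    identity can have a value containing both. *)
Definition nonrep (w : word) (c d : nat) : Prop :=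
  forall p r q s, w = p ++ r ++ q ++ r ++ s -> c \in r -> d \in r -> False.

(** The length of the identity enters only through [ctr_few], a pigeonhole principle: more than k
    letters, no two of which share a repeated factor, cannot all come from the values of at most k
    repeated variables. *)
Record contracted (S : monoid) (k : nat) (w w' a b : word) (theta : nat -> word)
    (u v : seq symb) : Prop := Contracted {
  ctr_src : w = a ++ expand (spell theta) u ++ b;
  ctr_tgt : w' = a ++ expand (spell theta) v ++ b;
  ctr_eqsat : eqsat S u v;
  ctr_linear : forall h, count_mem (inr h) u <= 1;
  ctr_repeated : forall c, inl c \in u -> 1 < count_mem (inl c) u;
  ctr_few : forall Z : seq nat, uniq Z -> k < size Z ->
    {in Z &, forall c d, c != d -> nonrep w c d} ->
    exists2 z, z \in Z & inl z \notin u }.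

Lemma count_gt1_split (T : eqType) (h : T) s : 1 < count_mem h s ->
  exists p q r, s = p ++ h :: q ++ h :: r.
Proof.
move=> ch; have hs : h \in s by rewrite -has_pred1 has_count; lia.
have [p [s' [es hp]]] := split_first hs; move: ch; rewrite es count_cat /= eqxx.
rewrite (count_memPn hp) => ch.
have /split_first[q [r [-> _]]] : h \in s' by rewrite -has_pred1 has_count; lia.
by exists p, q, r.
Qed.

Lemma contraction S k s t a b theta : satisfies S s t -> size s <= k ->
  exists u v, contracted S k (a ++ subst theta s ++ b) (a ++ subst theta t ++ b) a b theta u v.
Proof.
move=> st sk.
(* Multiplicities are taken in s alone: a variable linear in s stays a letter even if t repeats
   it. *)
pose sigma h : seq symb :=
  if count_mem h s == 1 then [:: inr h] else map inl (theta h).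
have spellE r : subst theta r = expand (spell theta) (expand sigma r).
  rewrite expand_comp; congr flatten; apply: eq_map => h; rewrite /sigma.
  case: ifP => _; first by rewrite expand_cons cats0.
  by elim: (theta h) => // c w IHw; rewrite /= expand_cons -IHw.
have cr h : count_mem (inr h) (expand sigma s) <= count_mem h s.
  suff H r : (forall g, g \in r -> g \in s) ->
      count_mem (inr h) (expand sigma r) <= count_mem h r by exact: H.
  elim: r => // g r IHr sr; rewrite expand_cons count_cat /=; apply: leq_add; last first.
    by apply: IHr => g' gr; apply: sr; rewrite inE gr orbT.
  rewrite /sigma; case: ifP => _ /=; first by rewrite addn0; case: eqP => [[->]|]; rewrite ?eqxx.
  by rewrite (count_memPn _) //; apply/mapP => -[].
have cl c : inl c \in expand sigma s -> exists2 h, 1 < count_mem h s & c \in theta h.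
  move=> /mem_expand[p [h [q [es]]]]; rewrite /sigma; case: ifP => [|/eqP ch].
    by rewrite inE.
  move=> /mapP[d dh [->]]; exists h => //.
  have : 0 < count_mem h s by rewrite -has_count has_pred1 es mem_cat mem_head orbT.
  lia.
exists (expand sigma s), (expand sigma t); split; rewrite ?spellE //.
- by apply: eqsat_expand; apply/eqsat_word.
- move=> h; case: (posnP (count_mem (inr h) (expand sigma s))) => [->//|].
  rewrite -has_count has_pred1 => /mem_expand[p [g [q [es]]]]; rewrite /sigma.
  case: ifP => [/eqP cg|_ /mapP[] //]; rewrite inE => /eqP[->]; rewrite -[X in _ <= X]cg.
  exact: cr.
- move=> c /cl[h ch ct]; have [p [q [r es]]] := count_gt1_split ch.
  have sh : sigma h = map inl (theta h) by rewrite /sigma gtn_eqF.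
  rewrite es !(expand_cat, expand_cons) sh !count_cat.
  set m := count _ (map _ _); suff : 0 < m by lia.
  by rewrite -has_count has_pred1; apply/mapP; exists c.
- move=> Z uZ kZ nrZ; apply/hasP; apply: contraLR kZ => /hasPn allZ; rewrite -leqNgt.
  (* [f z] is a repeated variable of s whose value contains z; such a variable exists for each z in
     Z, so the default 0 is never taken. Two letters with the same [f] would lie in a repeated
     factor of the word, so [f] is injective on Z. *)
  pose f z := head 0 [seq h <- s | (1 < count_mem h s) && (z \in theta h)].
  have fP z : z \in Z -> [/\ f z \in s, 1 < count_mem (f z) s & z \in theta (f z)].
    move=> /allZ; rewrite negbK => /cl[h ch zh].
    have hs : h \in [seq h <- s | (1 < count_mem h s) && (z \in theta h)].
      by rewrite mem_filter ch zh /= -has_pred1 has_count ltnW.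
    have := mem_filter (fun h => (1 < count_mem h s) && (z \in theta h)) (f z) s.
    rewrite {1}/f; case: filter hs => //= g r _; rewrite mem_head => /esym.
    by case/andP=> /andP[-> ->] ->.
  rewrite -(size_map f); apply: leq_trans sk; apply: uniq_leq_size.
    rewrite map_inj_in_uniq // => z z' zZ z'Z eqf; apply: contraTeq isT => nzz'.
    have [_ /count_gt1_split[p [q [r es]]] zf] := fP _ zZ.
    have [_ _ z'f] := fP _ z'Z; rewrite -eqf in z'f.
    exfalso; apply: (nrZ z z' zZ z'Z nzz' (a ++ subst theta p) _ (subst theta q)
              (subst theta r ++ b) _ zf z'f).
    rewrite -spellE [in LHS]es /subst !(map_cat, map_cons, flatten_cat) /= flatten_cat /=.
    by rewrite -!catA.
  by move=> h /mapP[z /fP[]] + + + ->.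
Qed.

Lemma derivable_satisfies S Sigma u v :
  (forall s t, (s, t) \in Sigma -> satisfies S s t) -> derivable Sigma u v -> satisfies S u v.
Proof.
move=> SSigma; elim=> {u v} [s t a b theta /SSigma st|u|u v _|u v w _ uv _ vw].
- exact/satisfies_context/satisfies_subst.
- by move.
- exact: satisfies_sym.
- exact: satisfies_trans uv vw.
Qed.

(** P has to be preserved in one direction only: the reversed identity gives the other. P is then
    constant along any derivation from U n, in particular along one that leads to V n. *)
Lemma nfb_of_invariant S (U V : nat -> word) :
  (forall n, 1 < n -> satisfies S (U n) (V n)) ->
  (forall n, is_word (U n) && is_word (V n)) ->
  (forall k, exists n (P : word -> Prop), [/\ 1 < n, P (U n), ~ P (V n) &
     forall w w' a b theta u v, satisfies S (U n) w -> satisfies S (U n) w' ->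
       contracted S k w w' a b theta u v -> P w -> P w']) ->
  ~ finitely_based S.
Proof.
move=> UV Uword inv [Sigma [Sigma_sat Sigma_basis]].
(* Both sides are bounded, since an identity may be applied from right to left. *)
pose k := \max_(st <- Sigma) (size st.1 + size st.2).
have [n [P [n1 PU nPV Pstep]]] := inv k.
have /andP[wU wV] := Uword n.
have SSigma s t : (s, t) \in Sigma -> satisfies S s t by case/Sigma_sat.
have ksz s t : (s, t) \in Sigma -> size s <= k /\ size t <= k.
  move=> st; have : size s + size t <= k.
    by rewrite /k (big_rem _ st) /= leq_maxl.
  lia.
have step w w' : derivable Sigma w w' -> satisfies S (U n) w -> (P w <-> P w').
  elim=> {w w'} [s t a b theta st|//|u v uv IH|u v w uv IHuv vw IHvw].
  - have sat := SSigma _ _ st; have [sk tk] := ksz _ _ st.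
    move=> Uw; have Uw' := satisfies_trans Uw (satisfies_context a b (satisfies_subst theta sat)).
    have [u [v ctr]] := contraction a b theta sat sk.
    have [u' [v' ctr']] := contraction a b theta (satisfies_sym sat) tk.
    by split; [apply: Pstep ctr | apply: Pstep ctr'].
  - move=> Uv; have vu := satisfies_sym (derivable_satisfies SSigma uv).
    by have := IH (satisfies_trans Uv vu); tauto.
  - move=> Uu; have := IHuv Uu.
    by have := IHvw (satisfies_trans Uu (derivable_satisfies SSigma uv)); tauto.
have := step _ _ (Sigma_basis _ _ wU wV (UV n n1)); have UU : satisfies S (U n) (U n) by [].
by move/(_ UU) => [/(_ PU)].
Qed.

(** * Isoterm patterns and words with few occurrences *)

Ltac slia := simpl in *; lia.

(** Isoterms are recorded as words over 0, 1, 2, ...; the number n stands for the n-th letter of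
    [E], and as these letters are distinct this is a renaming. *)
Lemma isoT_pattern S (T : eqType) (pat : word) (E : seq T) e0 :
  isoT S pat -> uniq E -> all (gtn (size E)) pat -> isoT S (map (nth e0 E) pat).
Proof.
move=> iso uE /allP patE.
have -> : map (nth e0 E) pat = map (fun n => nth e0 E (index n (iota 0 (size E)))) pat.
  apply/eq_in_map => n /patE /= ltn.
  have en : n = nth 0 (iota 0 (size E)) n by rewrite nth_iota.
  by rewrite {2}en index_uniq ?size_iota ?iota_uniq.
apply: isoT_rename => //; rewrite ?size_iota ?iota_uniq //.
by apply/allP => n /patE; rewrite /= mem_iota.
Qed.

Lemma words_count11 (T : eqType) (a b : T) r : a != b -> all (mem [:: a; b]) r ->
  count_mem a r <= 1 -> count_mem b r <= 1 ->
  r \in [:: [::]; [:: a]; [:: b]; [:: a; b]; [:: b; a]].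
Proof.
move=> nab; have nba : b != a by rewrite eq_sym.
case: r => [|c [|d [|e r]]] //=; rewrite !inE ?andbT.
- by case/orP=> /eqP-> _ _; rewrite eqxx ?orbT.
- case/andP=> /orP[] /eqP-> /orP[] /eqP->; rewrite ?eqxx ?(negPf nab) ?(negPf nba) //=;
  by rewrite ?orbT //; slia.
- by case/and4P=> /orP[] /eqP-> /orP[] /eqP-> /orP[] /eqP-> _;
  rewrite ?eqxx ?(negPf nab) ?(negPf nba) //=; slia.
Qed.

Lemma words_count21 (T : eqType) (a b : T) r : a != b -> all (mem [:: a; b]) r ->
  count_mem a r = 2 -> count_mem b r <= 1 ->
  r \in [:: [:: a; a]; [:: a; a; b]; [:: a; b; a]; [:: b; a; a]].
Proof.
move=> nab; have nba : b != a by rewrite eq_sym.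
case: r => [|c [|d [|e [|f r]]]] //=; rewrite !inE ?andbT.
- by slia.
- by case/andP=> /orP[] /eqP-> /orP[] /eqP->; rewrite ?eqxx ?(negPf nab) ?(negPf nba) //=; slia.
- by case/and3P=> /orP[] /eqP-> /orP[] /eqP-> /orP[] /eqP->;
  rewrite ?eqxx ?(negPf nab) ?(negPf nba) ?orbT //=; slia.
- by case/and5P=> /orP[] /eqP-> /orP[] /eqP-> /orP[] /eqP-> /orP[] /eqP-> _;
  rewrite ?eqxx ?(negPf nab) ?(negPf nba) ?orbT //=; slia.
Qed.

Lemma all_only (T : eqType) (E w : seq T) : all (mem E) (only E w).
Proof. by apply/allP => c; rewrite mem_filter => /andP[]. Qed.

Lemma cat_overlap (T : Type) (u v p q : seq T) : u ++ v = p ++ q -> size u <= size p ->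
  exists r, p = u ++ r /\ v = r ++ q.
Proof.
elim: u p => [|a u IHu] [|b p] //=; first by exists [::].
  by exists (b :: p).
by move=> [-> /IHu H] /H[r [-> ->]]; exists r.
Qed.

(** Finds the symbol e of s whose value covers the displayed occurrence of d. *)
Lemma cut_expand (T : Type) (rho : T -> word) s b p d q :
  expand rho s ++ b = p ++ d :: q -> size p < size (expand rho s) ->
  exists s1 e s2 q1 q2, [/\ s = s1 ++ e :: s2, rho e = q1 ++ d :: q2,
    p = expand rho s1 ++ q1 & q = q2 ++ expand rho s2 ++ b].
Proof.
elim: s p => [|e s IHs] p //; rewrite expand_cons -catA => eqw ps.
case: (ltnP (size p) (size (rho e))) => [pe|ep].
  have [[|d' q2] [ee eq2]] := cat_overlap (esym eqw) (ltnW pe).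
    by rewrite ee cats0 ltnn in pe.
  by case: eq2 => ed ->; exists [::], e, s, p, q2; rewrite ee ed.
have [r [ep' er]] := cat_overlap eqw ep.
have rs : size r < size (expand rho s) by move: ps; rewrite ep' !size_cat; slia.
have [s1 [e' [s2 [q1 [q2 [-> ee' er' ->]]]]]] := IHs _ er rs.
by exists (e :: s1), e', s2, q1, q2; rewrite ep' er' expand_cons -catA.
Qed.

Lemma isoT_nil S (T : eqType) (pat : word) (e0 : T) : isoT S pat -> isoT S ([::] : seq T).
Proof.
move=> iso; have iso0 : isoT S ([::] : word) by apply: (@isoT_factor _ _ [::] pat [::]).
exact: (@isoT_pattern _ _ _ [::] e0 iso0).
Qed.

(** * Letters and linear markers in one contracted step *)

Section Step.
Variables (S : monoid) (k : nat) (w w' a b : word) (theta : nat -> word) (u v : seq symb).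
Hypothesis ctr : contracted S k w w' a b theta u v.

(** As e is arbitrary, this also fixes the multiplicity of every symbol. It is the first thing
    established in each case. *)
Definition exchange_linear := forall e l, only [:: e; inr l] v = only [:: e; inr l] u.

(** The converse inequality always holds. So each occurrence of c in w comes from a letter [inl c]
    of u, and none lies in the contexts a, b or in the value of a linear variable of u. *)
Definition full (E : seq nat) := {in E, forall c, count_mem c w <= count_mem (inl c) u}.

Lemma count_spell c s : count_mem (inl c) s <= count_mem c (expand (spell theta) s).
Proof.
elim: s => // e s IHs; rewrite expand_cons count_cat /=; apply: leq_add => //.
by case: e => [d|h] //=; rewrite addn0.
Qed.

Lemma full_linear E c l : full E -> c \in E -> inr l \in u -> c \notin theta l.
Proof.
move=> fE cE lu; have := fE c cE; rewrite (ctr_src ctr).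
have [s1 [s2 [-> _]]] := split_first lu.
rewrite !(expand_cat, expand_cons) !count_cat /=.
have := count_spell c s1; have := count_spell c s2 => ? ?.
by move=> ?; apply/count_memPn; slia.
Qed.

Lemma full_left E : full E -> only E a = [::].
Proof.
move=> fE; apply/only0 => c cE; have := fE c cE; rewrite (ctr_src ctr) !count_cat.
by have := count_spell c u => ? ?; apply/count_memPn; slia.
Qed.

Lemma full_right E : full E -> only E b = [::].
Proof.
move=> fE; apply/only0 => c cE; have := fE c cE; rewrite (ctr_src ctr) !count_cat.
by have := count_spell c u => ? ?; apply/count_memPn; slia.
Qed.

Lemma full_expand E s : full E -> {subset s <= u} ->
  map inl (only E (expand (spell theta) s)) = only (map inl E) s.
Proof.
move=> fE; elim: s => // e s IHs su; rewrite expand_cons only_cat map_cat IHs; last first.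
  by move=> f fs; apply: su; rewrite inE fs orbT.
have eu : e \in u by apply: su; rewrite mem_head.
rewrite only_cons; case: e eu {su} => [c|l] eu.
  rewrite /spell only_cons (mem_map (@inl_inj _ _)).
  by case: ifP.
have -> : only E (spell theta (inr l)) = [::] by apply/only0 => c /(full_linear fE)/(_ eu).
by rewrite ifF //; apply/negbTE/mapP => -[].
Qed.

Lemma full_word E : full E -> only (map inl E) u = map inl (only E w).
Proof.
by move=> fE; rewrite (ctr_src ctr) !only_cat full_left // full_right // cats0 full_expand.
Qed.

(** An occurrence of d between letters of E lies neither in a' nor in b. As [inl d] is not in u, it
    is covered by a linear variable, whose value is free of letters of E. The prefix a' is general
    so that the argument can be repeated on what follows d. *)
Lemma full_cut E d a' s p q : full E -> inl d \notin u -> {subset s <= u} ->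
  only E a' = [::] -> a' ++ expand (spell theta) s ++ b = p ++ d :: q ->
  only E p <> [::] -> only E q <> [::] ->
  exists l s1 s2 q2, [/\ s = s1 ++ inr l :: s2, only (map inl E) s1 = map inl (only E p),
    only (map inl E) s2 = map inl (only E q) , only E q2 = [::] & 
    q = q2 ++ expand (spell theta) s2 ++ b].
Proof.
move=> fE du su a0 eqw p0 q0.
have ap : size a' <= size p.
  rewrite leqNgt; apply/negP => pa.
  have [r [er _]] := cat_overlap (esym eqw) (ltnW pa).
  by apply: p0; move: a0; rewrite er only_cat; case: only.
have [r [ep er]] := cat_overlap eqw ap.
have rs : size r < size (expand (spell theta) s).
  rewrite ltnNge; apply/negP => sr; have [r' [_ eb]] := cat_overlap er sr.
  have := full_right fE; rewrite eb only_cat only_cons.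
  by case: (only E r') => //; case: ifP.
have [s1 [e [s2 [q1 [q2 [es ee er' eq]]]]]] := cut_expand er rs.
have eu : e \in u by apply: su; rewrite es mem_cat mem_head orbT.
case: e => [c|l] in es ee eu *.
  by case: q1 ee {er'} => [|? []] // [ecd _]; rewrite -ecd eu in du.
have l0 : only E (theta l) = [::] by apply/only0 => c /(full_linear fE)/(_ eu).
move: l0; rewrite -[theta l]/(spell theta (inr l)) ee only_cat only_cons.
case q10: (only E q1) => //; case: ifP => // _ /= q20.
exists l, s1, s2, q2; split=> //.
- rewrite ep er' !only_cat a0 q10 cats0 full_expand // => f fs.
  by apply: su; rewrite es mem_cat fs.
- rewrite eq !only_cat q20 full_right // cats0 full_expand // => f fs.
  by apply: su; rewrite es mem_cat inE fs !orbT.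
Qed.

Lemma only_linear l E s1 s2 : u = s1 ++ inr l :: s2 ->
  only (inr l :: map inl E) u = only (map inl E) s1 ++ inr l :: only (map inl E) s2.
Proof.
move=> eu; have := ctr_linear ctr l; rewrite eu only_cat only_cons mem_head count_cat /= eqxx.
move=> cl; have [n1 n2] : inr l \notin s1 /\ inr l \notin s2.
  by split; apply/count_memPn; slia.
by congr (_ ++ _ :: _); apply: eq_in_filter => e es; rewrite inE; case: eqP es => [->|//];
  rewrite ?(negPf n1) ?(negPf n2).
Qed.

(** The linear variable covering d takes the place of d among the letters of E. This is how the
    linear letter of an isoterm is obtained. *)
Lemma marker_at E d p q : full E -> inl d \notin u -> w = p ++ d :: q ->
  only E p <> [::] -> only E q <> [::] ->
  exists l, only (inr l :: map inl E) u =
    map inl (only E p) ++ inr l :: map inl (only E q).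
Proof.
move=> fE du + p0 q0; rewrite (ctr_src ctr) => ew.
have [l [s1 [s2 [q2 [eu <- <- _ _]]]]] := full_cut fE du (fun _ => id) (full_left fE) ew p0 q0.
by exists l; apply: only_linear.
Qed.

Lemma marker E d r1 r2 : full E -> inl d \notin u -> only (d :: E) w = r1 ++ d :: r2 ->
  only E r1 <> [::] -> only E r2 <> [::] ->
  exists l, only (inr l :: map inl E) u =
    map inl (only E r1) ++ inr l :: map inl (only E r2).
Proof.
move=> fE du /only_split[p [q [ew ep eq]]].
have sE : {subset E <= d :: E} by move=> c cE; rewrite inE cE orbT.
by rewrite -ep -eq !only_sub // => p0 q0; apply: marker_at ew p0 q0.
Qed.

(** The letters of E between d and d' put d' beyond the value of the variable that covers d, so a
    second linear variable covers d'. *)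
Lemma marker2 E d d' r1 r2 r3 : full E -> inl d \notin u -> inl d' \notin u ->
  only [:: d, d' & E] w = r1 ++ d :: r2 ++ d' :: r3 ->
  only E r1 <> [::] -> only E r2 <> [::] -> only E r3 <> [::] ->
  exists l l', l != l' /\ only [:: inr l, inr l' & map inl E] u =
    map inl (only E r1) ++ inr l :: map inl (only E r2) ++ inr l' :: map inl (only E r3).
Proof.
move=> fE du d'u /only_split[p [q [ew ep /only_split[p' [q' [eq ep' eq']]]]]].
have sE : {subset E <= [:: d, d' & E]} by move=> c cE; rewrite !inE cE !orbT.
rewrite -ep -ep' -eq' !only_sub // => p0 p'0 q'0; move: ew; rewrite (ctr_src ctr) => ew.
have q0 : only E q <> [::] by rewrite eq only_cat; case: only p'0.
have [l [s1 [s2 [q2 [eu es1 es2 q20 eq2]]]]] :=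
  full_cut fE du (fun _ => id) (full_left fE) ew p0 q0.
rewrite eq in eq2; have su : {subset s2 <= u}.
  by move=> f fs; rewrite eu mem_cat inE fs !orbT.
have [l' [s3 [s4 [q4 [es2' es3 es4 _ _]]]]] := full_cut fE d'u su q20 (esym eq2) p'0 q'0.
have nll' : l != l'.
  apply/eqP => ell'; have := ctr_linear ctr l.
  by rewrite eu es2' -ell' count_cat /= count_cat /= eqxx; slia.
exists l, l'; split=> //; rewrite -es1 -es3 -es4.
have eu' : u = (s1 ++ inr l :: s3) ++ inr l' :: s4 by rewrite eu es2' -catA.
have [cl cl'] := (ctr_linear ctr l, ctr_linear ctr l').
rewrite eu' !only_cat !only_cons !inE !eqxx orbT -catA /=.
have nofresh s : inr l \notin s -> inr l' \notin s ->
    only [:: inr l, inr l' & map inl E] s = only (map inl E) s.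
  move=> ls l's; apply: eq_in_filter => e es; rewrite !inE.
  by case: eqP es => [->|_]; [rewrite (negPf ls)|case: eqP => // ->; rewrite (negPf l's)].
move: cl cl'; rewrite eu' !count_cat /= !eqxx => cl cl'.
by rewrite !nofresh //; apply/count_memPn; slia.
Qed.

Hypothesis lin : exchange_linear.

Lemma exchange_count e : count_mem e v = count_mem e u.
Proof.
have := congr1 (count_mem e) (lin e 0).
by rewrite !count_only ?mem_head.
Qed.

Lemma exchange_perm : perm_eq u v.
Proof. by apply/allP => e _ /=; rewrite exchange_count. Qed.

Lemma exchange_mem : v =i u.
Proof. by move=> e; rewrite (perm_mem exchange_perm). Qed.

Lemma exchange_transfer c d : 
  only [:: c; d] w' <> only [:: c; d] w -> 
  [/\ inl c \in u, inl d \in u & only [:: inl c; inl d] v <> only [:: inl c; inl d] u].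
Proof.
move=> neww'.
have unst : only [:: inl c; inl d] v <> only [:: inl c; inl d] u.
  move=> st; apply: neww'.
  (* Only the symbols in P can contribute c or d to the word. If c and d kept their order, the
     filtered words would agree on all pairs, the pairs with a linear letter being fixed by
     [lin]. *)
  pose P (e : symb) := if e is inl f then (f == c) || (f == d) else true.
  have eqP' : filter P v = filter P u.
    apply: eq_filter_from_pairs => -[f|l] [g|l'] //=; last first.
      by move=> *; rewrite onlyC [RHS]onlyC; apply: lin.
    move=> fcd gcd; set F := [:: inl f; inl g]; set G := [:: inl c; inl d] in st.
    have sFG : {subset F <= G}.
      move=> e; rewrite !inE => /orP[]/eqP->; first by case/orP: fcd => /eqP->; rewrite eqxx ?orbT.
      by case/orP: gcd => /eqP->; rewrite eqxx ?orbT.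
    by rewrite -(only_sub v sFG) -(only_sub u sFG) st.
  have key s : only [:: c; d] (expand (spell theta) s) =
      only [:: c; d] (expand (spell theta) (filter P s)).
    rewrite /only expand_filter !filter_expand; congr flatten; apply: eq_map => -[f|l] //=.
    by rewrite !inE; case E: ((f == c) || (f == d)); rewrite //= !inE E.
  by rewrite (ctr_src ctr) (ctr_tgt ctr) !only_cat key eqP' -key.
have absent (e f : symb) : e \notin u -> only [:: e; f] v = only [:: e; f] u.
  move=> eu; rewrite !(onlyC e) !only_run //; last by rewrite exchange_mem.
  by rewrite exchange_count.
split=> //; apply/negP => /negP h; apply: unst; first exact: absent.
by rewrite onlyC [RHS]onlyC; apply: absent.
Qed.

End Step.

(** * Exchanges in one deduction step *)

Lemma mem_second (T : eqType) (a b : T) s : b \in [:: a, b & s].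
Proof. by rewrite !inE eqxx orbT. Qed.

Lemma only_fresh (T : eqType) (E : seq T) l w : l \notin w -> only (l :: E) w = only E w.
Proof.
move=> lw; apply: eq_in_filter => c cw; rewrite inE; case: eqP => // cl.
by rewrite cl (negPf lw) in cw.
Qed.

(** l precedes every c, while m comes only after the first c, so the relative order of l and m is
    known as well. *)
Lemma only_before (T : eqType) (c l m : T) u k r : uniq [:: c; l; m] ->
  only [:: c; l] u = l :: nseq k c -> only [:: c; m] u = c :: r ->
  only [:: l; c; m] u = [:: l, c & r].
Proof.
rewrite /= !inE negb_or andbT => /andP[/andP[ncl ncm] nlm].
move=> /(only_split (r1 := [::]))[p [q [-> ep eq]]].
have [cp lp] : c \notin p /\ l \notin p by split; apply: ((only0 _ _).1 ep); rewrite ?mem_head ?mem_second.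
have lq : l \notin q.
  apply/count_memPn; rewrite -(@count_only _ [:: c; l]) ?mem_second // eq.
  by elim: (k) => //= k' ->; rewrite (negPf ncl).
rewrite !only_cat !only_cons mem_head !inE (eq_sym l c) (negPf ncl) (negPf nlm) /=.
rewrite !(only_fresh _ lp) !(only_fresh _ lq) [only _ p]onlyC (only_run m cp).
case: (count_mem m p) => [|n]; first by move=> /= ->.
by case=> ecm; rewrite ecm eqxx in ncm.
Qed.

Lemma only_after (T : eqType) (c l m : T) u k r : uniq [:: c; l; m] ->
  only [:: c; l] u = rcons (nseq k c) l -> only [:: c; m] u = rcons r c ->
  only [:: l; c; m] u = rcons (rcons r c) l.
Proof.
move=> uE ecl ecm; rewrite -[u]revK only_rev (@only_before _ c l m _ k (rev r)) //.
- by rewrite !rev_cons revK.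
- by rewrite only_rev ecl rev_rcons rev_nseq.
- by rewrite only_rev ecm rev_rcons.
Qed.

Section Exchange.
Variables (S : monoid) (k : nat) (w w' a b : word) (theta : nat -> word) (u v : seq symb).
Hypothesis ctr : contracted S k w w' a b theta u v.

Lemma count_inl c : count_mem (inl c) u <= count_mem c w.
Proof.
rewrite (ctr_src ctr) !count_cat; have := count_spell theta c u.
by rewrite addnCA; move=> h; apply: leq_trans h _; rewrite leq_addr.
Qed.

Lemma mem_inl c : inl c \in u -> c \in w.
Proof.
by rewrite -!has_pred1 !has_count => /leq_trans -> //; exact: count_inl.
Qed.

(** Contraction leaves every letter [inl c] of u at least twice in u, which exhausts two occurrences
    in w. *)
Lemma full_pairs E : {in E, forall c, inl c \in u /\ count_mem c w <= 2} -> full w u E.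
Proof. by move=> H c /H[/(ctr_repeated ctr)] cu cw; apply: leq_trans cw _. Qed.

Lemma linear_notin d : count_mem d w <= 1 -> inl d \notin u.
Proof.
move=> d1; apply/negP => /(ctr_repeated ctr) d2; have := count_inl d; slia.
Qed.

(** Two symbols that occur at most once each are fixed by the isoterm 01; what remains is a repeated
    letter against a linear one. *)
Lemma exchange_linear_intro : isoT S [:: 0; 1] ->
  (forall c l, inl c \in u -> only [:: inl c; inr l] v = only [:: inl c; inr l] u) ->
  exchange_linear u v.
Proof.
move=> iso H.
have iso0 : isoT S ([::] : seq symb) := isoT_nil (inl 0) iso.
have iso1 (e : symb) : isoT S [:: e].
  apply: (@isoT_pattern _ _ [:: 0] [:: e] e _ isT isT).
  exact: (@isoT_factor _ _ [::] [:: 1] [:: 0]).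
have iso11 (e f : symb) : e != f -> isoT S [:: e; f].
  by move=> nef; apply: (@isoT_pattern _ _ _ [:: e; f] e iso) => //=; rewrite inE nef.
have main e l : e != inr l -> only [:: e; inr l] v = only [:: e; inr l] u.
  move=> nel; have [[c [ec cu]]|e1] : (exists c, e = inl c /\ inl c \in u) \/ count_mem e u <= 1.
  - case: e {nel} => [c|h]; last by right; apply: (ctr_linear ctr).
    have [cu|cu] := boolP (inl c \in u); first by left; exists c.
    by right; rewrite (count_memPn cu).
  - by rewrite ec; apply: H.
  apply: (isoT_only (ctr_eqsat ctr)).
  have := words_count11 nel (all_only [:: e; inr l] u).
  rewrite !count_only ?mem_head ?mem_second // => /(_ e1 (ctr_linear ctr l)).
  rewrite !inE => /or4P[/eqP->|/eqP->|/eqP->|/orP[]/eqP->] //; first exact: iso11.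
  by apply: iso11; rewrite eq_sym.
move=> e l; have [->|] := eqVneq e (inr l); last exact: main.
(* The pair of l with itself is embedded in a pair of distinct symbols; the index l + 1 is just one
   other than l. *)
have sub : {subset [:: inr l; inr l] <= [:: inr l.+1; inr l] :> seq symb}.
  by move=> f; rewrite !inE orbb => ->; rewrite orbT.
rewrite -(only_sub v sub) -(only_sub u sub) main //.
by apply/eqP => -[]; lia.
Qed.

Lemma exchange_double c l :
  isoT S [:: 0; 0; 1] -> isoT S [:: 0; 1; 0] -> isoT S [:: 1; 0; 0] ->
  inl c \in u -> count_mem c w <= 2 -> only [:: inl c; inr l] v = only [:: inl c; inr l] u.
Proof.
move=> i001 i010 i100 cu cw; apply: (isoT_only (ctr_eqsat ctr)).
have ncl : (inl c : symb) != inr l by [].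
have cu2 : count_mem (inl c) u = 2.
  by apply/eqP; rewrite eqn_leq (ctr_repeated ctr) // andbT (leq_trans (count_inl c)) ?cw.
have := words_count21 ncl (all_only [:: inl c; inr l] u).
rewrite !count_only ?mem_head ?mem_second // => /(_ cu2 (ctr_linear ctr l)).
have pat p : isoT S p -> all (gtn 2) p -> isoT S (map (nth (inl c) [:: inl c; inr l]) p).
  by move=> ip ap; apply: isoT_pattern.
rewrite !inE => /or4P[] /eqP->; [|exact: (pat _ i001)|exact: (pat _ i010)|exact: (pat _ i100)].
by apply: (pat [:: 0; 0]) => //; apply: (@isoT_factor _ _ [::] [:: 1] [:: 0; 0]).
Qed.

Lemma exchange_linear_double :
  isoT S [:: 0; 1] -> isoT S [:: 0; 0; 1] -> isoT S [:: 0; 1; 0] -> isoT S [:: 1; 0; 0] ->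
  (forall c, inl c \in u -> count_mem c w <= 2) -> exchange_linear u v.
Proof.
move=> iso i001 i010 i100 cw; apply: exchange_linear_intro => // c l cu.
by apply: exchange_double => //; apply: cw.
Qed.

(** Made for the cases in which xxt and txx are not among the isoterms. If l lies outside the two
    occurrences of c, the letter l0 between them completes the word to 0201 or 1020. *)
Lemma exchange_linear_split :
  isoT S [:: 0; 1] -> isoT S [:: 0; 1; 0] -> isoT S [:: 1; 0; 2; 0] -> isoT S [:: 0; 2; 0; 1] ->
  (forall c, inl c \in u ->
     count_mem c w <= 2 /\ exists l, only [:: inr l; inl c] u = [:: inl c; inr l; inl c]) ->
  exchange_linear u v.
Proof.
move=> iso i010 i1020 i0201 H; apply: exchange_linear_intro => // c l cu.
have [cw [l0 split_c]] := H c cu.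
have ncl : (inl c : symb) != inr l by [].
have cu2 : count_mem (inl c) u = 2.
  by apply/eqP; rewrite eqn_leq (ctr_repeated ctr) // andbT (leq_trans (count_inl c)).
have := words_count21 ncl (all_only [:: inl c; inr l] u).
rewrite !count_only ?mem_head ?mem_second // => /(_ cu2 (ctr_linear ctr l)).
have st (E : seq symb) : {subset [:: inl c; inr l] <= E} -> isoT S (only E u) ->
    only [:: inl c; inr l] v = only [:: inl c; inr l] u.
  move=> sE iE; rewrite -(only_sub v sE) -(only_sub u sE).
  by rewrite (isoT_only (ctr_eqsat ctr) iE).
have [ell0|nll0] := eqVneq l l0.
  move=> _; apply: (st [:: inr l0; inl c]).
    by move=> f; rewrite ell0 !inE orbC.
  by rewrite split_c; apply: (@isoT_pattern _ _ _ [:: inl c; inr l0] (inl c) i010).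
have u3 : uniq [:: inl c; inr l; inr l0 : symb].
  by rewrite /= !inE /= andbT; apply: contra nll0 => /eqP[->].
have s3 : {subset [:: inl c; inr l] <= [:: inl c; inr l; inr l0] :> seq symb}.
  by move=> f; rewrite !inE => /orP[]->; rewrite ?orbT.
have c0 : only [:: inl c; inr l0] u = [:: inl c; inr l0; inl c] by rewrite onlyC.
have l0u : count_mem (inr l0) u = 1.
  have := congr1 (count_mem (inr l0)) c0.
  by rewrite count_only ?mem_second //= eqxx.
rewrite !inE => /or4P[] /eqP ecl.
- have lu : inr l \notin u.
    by apply/count_memPn; rewrite -(@count_only _ [:: inl c; inr l]) ?mem_second // ecl.
  apply: (st [:: inl c; inr l; inr l0]) => //.
  have -> : only [:: inl c; inr l; inr l0] u = only [:: inl c; inr l0] u.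
    apply: eq_in_filter => f fu; rewrite !inE; case: (f =P inr l) => // fl.
    by rewrite fl (negPf lu) in fu.
  by rewrite c0; apply: (@isoT_pattern _ _ _ [:: inl c; inr l0] (inl c) i010).
- apply: (st [:: inr l; inl c; inr l0]); first by move=> f; rewrite !inE => /orP[]->; rewrite ?orbT.
  rewrite (only_after (k := 2) (r := [:: inl c; inr l0]) u3 ecl c0).
  exact: (@isoT_pattern _ _ _ [:: inl c; inr l; inr l0] (inl c) i0201).
- by apply: (st [:: inl c; inr l]) => //; rewrite ecl; apply: (@isoT_pattern _ _ _ [:: inl c; inr l] (inl c) i010).
- apply: (st [:: inr l; inl c; inr l0]); first by move=> f; rewrite !inE => /orP[]->; rewrite ?orbT.
  rewrite (only_before (k := 2) u3 ecl c0).
  exact: (@isoT_pattern _ _ _ [:: inl c; inr l; inr l0] (inl c) i1020).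
Qed.

Lemma exchange_eq : exchange_linear u v ->
  (forall c d, inl c \in u -> inl d \in u -> c != d ->
     only [:: inl c; inl d] v = only [:: inl c; inl d] u) -> w' = w.
Proof.
move=> lin H; suff evu : v = u by rewrite (ctr_src ctr) (ctr_tgt ctr) evu.
apply: eq_from_pairs => e f; rewrite !mem_cat !(exchange_mem lin) !orbb.
case: f => [d|l]; last by move=> *; apply: lin.
case: e => [c|l]; last by move=> *; rewrite onlyC [RHS]onlyC; apply: lin.
move=> cu du; have [->|] := eqVneq c d; last exact: H.
have sub : {subset [:: inl d; inl d] <= [:: inl d; inr 0] :> seq symb}.
  by move=> f; rewrite !inE orbb => ->.
by rewrite -(only_sub v sub) -(only_sub u sub) lin.
Qed.
End Exchange.

(** * Words built from indexed blocks *)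

Lemma vr_eq a i b j : a < 16 -> b < 16 -> (vr a i == vr b j) = (a == b) && (i == j).
Proof. by rewrite /vr => ? ?; lia. Qed.

Lemma only_blocks E g n : only E (blocks g n) = blocks (fun i => only E (g i)) n.
Proof. by rewrite /only /blocks filter_flatten -map_comp. Qed.

Lemma flatten_nil (T : eqType) (U : Type) (g : T -> seq U) s :
  {in s, forall i, g i = [::]} -> flatten (map g s) = [::].
Proof.
elim: s => //= i s IHs H; rewrite H ?mem_head // IHs // => j js.
by apply: H; rewrite inE js orbT.
Qed.

Lemma only_blocks0 E g n : (forall i, 0 < i <= n -> only E (g i) = [::]) ->
  only E (blocks g n) = [::].
Proof.
by move=> H; rewrite only_blocks; apply: flatten_nil => i; rewrite mem_iota => ?; apply: H; lia.
Qed.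

Lemma only_blocks1 E g n i : 0 < i <= n ->
  (forall j, 0 < j <= n -> j != i -> only E (g j) = [::]) -> only E (blocks g n) = only E (g i).
Proof.
move=> /andP[i0 ilen] H; rewrite only_blocks /blocks.
have -> : iota 1 n = iota 1 i.-1 ++ i :: iota i.+1 (n - i).
  rewrite -[i :: _]/(iota i (n - i).+1); have {2}-> : i = 1 + i.-1 by lia.
  by rewrite -iotaD; congr iota; lia.
rewrite map_cat flatten_cat /= !flatten_nil /= ?cats0 // => j; rewrite mem_iota => ?; apply: H; lia.
Qed.

Lemma only_blocks2 E g n i j : 0 < i -> i < j <= n ->
  (forall k, 0 < k <= n -> k != i -> k != j -> only E (g k) = [::]) ->
  only E (blocks g n) = only E (g i) ++ only E (g j).
Proof.
move=> i0 /andP[ij jn] H; rewrite only_blocks /blocks.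
have -> : iota 1 n = iota 1 i.-1 ++ i :: iota i.+1 (j - i.+1) ++ j :: iota j.+1 (n - j).
  rewrite -[j :: _]/(iota j (n - j).+1).
  have -> : iota i.+1 (j - i.+1) ++ iota j (n - j).+1 = iota i.+1 (n - i).
    have {2}-> : j = i.+1 + (j - i.+1) by lia.
    by rewrite -iotaD; congr iota; lia.
  rewrite -[i :: _]/(iota i (n - i).+1).
  have {2}-> : i = 1 + i.-1 by lia.
  by rewrite -iotaD; congr iota; lia.
rewrite map_cat flatten_cat /= map_cat flatten_cat /= !flatten_nil /= ?cats0 // => k;
  rewrite mem_iota => ?; apply: H; lia.
Qed.

Lemma up_blocks f n : up f n = blocks (fun i => [:: f i]) n.
Proof. by rewrite /up /blocks; elim: (iota 1 n) => //= i s ->. Qed.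

Lemma mem_blocks c g n : c \in blocks g n -> exists2 i, 0 < i <= n & c \in g i.
Proof. by move=> /flatten_mapP[i]; rewrite mem_iota => ? ?; exists i => //; lia. Qed.

Lemma mem_up c f n : c \in up f n -> exists2 i, 0 < i <= n & c = f i.
Proof. by rewrite up_blocks => /mem_blocks[i ?]; rewrite inE => /eqP ->; exists i. Qed.

Lemma satisfies_only S U w E : satisfies S U w -> isoT S (only E U) -> only E w = only E U.
Proof. by move=> /eqsat_word Uw; apply: isoT_only. Qed.

(** The empty word is a factor of an isoterm, hence an isoterm, so a letter missing on one side of
    an identity is missing on the other. *)
Lemma satisfies_mem S U w (pat : word) : isoT S pat -> satisfies S U w -> w =i U.
Proof.
move=> iso Uw c; have iso0 : isoT S ([::] : word) := isoT_nil 0 iso.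
have H U' w' : satisfies S U' w' -> c \notin U' -> c \notin w'.
  move=> U'w' cU; have e0 : only [:: c] U' = [::] by apply/only0 => d; rewrite inE => /eqP->.
  by apply: ((only0 [:: c] w').1 _); rewrite ?mem_head // (satisfies_only U'w') e0.
by apply/idP/idP; apply: contraTT; apply: H => //; apply: satisfies_sym.
Qed.

Lemma few_indexed S k w w' a b theta u v f n : contracted S k w w' a b theta u v ->
  k < n -> injective f ->
  (forall i j, 0 < i -> i < j <= n -> nonrep w (f i) (f j)) ->
  exists2 i, 0 < i <= n & inl (f i) \notin u.
Proof.
move=> ctr kn injf H; have [||c d|c] := ctr_few ctr (Z := up f n).
- by rewrite map_inj_uniq ?iota_uniq.
- by rewrite size_map size_iota.
- move=> /mem_up[i hi ->] /mem_up[j hj ->]; rewrite (inj_eq injf) neq_ltn.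
  case/orP=> ?; first by apply: H; lia.
  by move=> p r q s ew ir jr; have := H j i _ _ p r q s ew jr ir; apply; lia.
- by move=> /mem_up[i hi ->]; exists i.
Qed.

Lemma vr_inj a : a < 16 -> injective (vr a).
Proof. by rewrite /vr => ? i j; lia. Qed.

Lemma exchange_stable S k w w' a b theta u v (E F : seq symb) :
  contracted S k w w' a b theta u v -> {subset F <= E} -> isoT S (only E u) ->
  only F v = only F u.
Proof.
move=> ctr sFE iE.
by rewrite -(only_sub u sFE) -(only_sub v sFE) (isoT_only (ctr_eqsat ctr) iE).
Qed.

(** * Case 1 *)

Local Opaque vr.

Lemma isoterm_pattern S w ls pat : isoterm S w ->
  [&& is_word w, uniq ls, all (mem ls) w & map (index^~ ls) w == pat] -> isoT S pat.
Proof.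
move=> iso /and4P[w0 uls wls /eqP<-].
have := @isoT_rename S _ ls (iota 0 (size ls)) 0 w (size_iota _ _) uls (iota_uniq _ _) wls.
move/(_ (isoterm_isoT w0 iso)); congr isoT; apply/eq_in_map => c /(allP wls)/= cls.
by rewrite nth_iota // index_mem.
Qed.

Lemma words_count22 (T : eqType) (a b : T) r : a != b -> all (mem [:: a; b]) r ->
  count_mem a r = 2 -> count_mem b r = 2 ->
  r \in [:: [:: a; a; b; b]; [:: a; b; a; b]; [:: a; b; b; a];
            [:: b; a; a; b]; [:: b; a; b; a]; [:: b; b; a; a]].
Proof.
move=> nab; have nba : b != a by rewrite eq_sym.
case: r => [|c [|d [|e [|f [|g r]]]]] //=; rewrite !inE ?andbT.
- by lia.
- by case/andP=> /orP[] /eqP-> /orP[] /eqP->; rewrite ?eqxx ?(negPf nab) ?(negPf nba) //=; lia.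
- by case/and3P=> /orP[] /eqP-> /orP[] /eqP-> /orP[] /eqP->;
  rewrite ?eqxx ?(negPf nab) ?(negPf nba) ?orbT //=; lia.
- by case/and4P=> /orP[] /eqP-> /orP[] /eqP-> /orP[] /eqP-> /orP[] /eqP->;
  rewrite ?eqxx ?(negPf nab) ?(negPf nba) ?orbT //=; lia.
- by case/andP=> /orP[] /eqP-> /and5P[] /orP[] /eqP-> /orP[] /eqP-> /orP[] /eqP-> /orP[] /eqP-> _;
  rewrite ?eqxx ?(negPf nab) ?(negPf nba) ?orbT //=; lia.
Qed.

Lemma size_only2 (w : word) c d : c != d -> c \in w -> d \in w -> 1 < size (only [:: c; d] w).
Proof.
move=> ncd cw dw; apply: (@uniq_leq_size _ [:: c; d]); first by rewrite /= inE ncd.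
by move=> e; rewrite mem_only => eE; rewrite eE /=; move: eE; rewrite !inE => /orP[]/eqP->.
Qed.

(** Each copy of a repeated factor with both letters contributes at least two of the four letters,
    so the restriction would be a square. *)
Lemma nonrep_nonsquare w c d e1 e2 e3 e4 : c != d -> only [:: c; d] w = [:: e1; e2; e3; e4] ->
  ~~ ((e1 == e3) && (e2 == e4)) -> nonrep w c d.
Proof.
move=> ncd + nsq p r q s ew cr dr; rewrite ew !only_cat => eR.
have := size_only2 ncd cr dr; have := congr1 size eR; rewrite !size_cat.
move: eR nsq; case: (only _ p) => [|? p']; case: (only _ r) => [|f1 [|f2 [|f3 r']]]; 
  case: (only _ q) => [|? q'] //=; try by slia.
by move=> -[-> -> -> -> _]; rewrite !eqxx.
Qed.

(** The head of a two-letter restriction tells whose first occurrence is earlier, which is a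
    transitive relation. *)
Lemma head_only_trans (T : eqType) (a b c e : T) w : a != b -> b != c -> a \in w -> b \in w ->
  head e (only [:: a; b] w) = a -> head e (only [:: b; c] w) = b ->
  head e (only [:: a; c] w) = a.
Proof.
move=> nab nbc; elim: w => // f w IHw; rewrite !inE !only_cons !inE.
have [->|nfa] := eqVneq f a; first by rewrite orTb.
have [->|nfb] /= := eqVneq f b; first by move=> _ _ /= eba; rewrite eba eqxx in nab.
have [->|nfc] /= := eqVneq f c; first by move=> _ _ _ /= ecb; rewrite ecb eqxx in nbc.
exact: IHw.
Qed.

Lemma last_only_trans (T : eqType) (a b c e : T) w : a != b -> b != c -> a \in w -> b \in w ->
  last e (only [:: a; b] w) = a -> last e (only [:: b; c] w) = b ->
  last e (only [:: a; c] w) = a.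
Proof.
have lastE s : last e s = head e (rev s) by case/lastP: s => // s f; rewrite last_rcons rev_rcons.
move=> nab nbc aw bw; rewrite !lastE -!only_rev.
by apply: head_only_trans; rewrite ?mem_rev.
Qed.

Lemma isoT_relabel S (p : word) (q : word) E : isoT S p -> uniq E -> all (gtn (size E)) p ->
  map (nth 0 E) p = q -> isoT S q.
Proof. by move=> ip uE aE <-; apply: isoT_pattern. Qed.

Section Case1.
Variable S : monoid.
Hypothesis iso : isoT S [:: 0; 1; 1; 0].

Lemma linear_patterns1 : [/\ isoT S [:: 0; 1], isoT S [:: 0; 0; 1], isoT S [:: 0; 1; 0] &
  isoT S [:: 1; 0; 0]].
Proof.
split.
- exact: (@isoT_factor _ _ [::] [:: 1; 0] [:: 0; 1]).
- apply: (@isoT_relabel _ [:: 1; 1; 0] _ [:: 1; 0]) => //.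
  exact: (@isoT_factor _ _ [:: 0] [::] [:: 1; 1; 0]).
(* The square 11 serves as a single letter: the image of 010 is 0110. *)
- exact: (@isoT_expand _ _ (fun c => if c == 1 then [:: 1] else [::]) [:: 0; 1; 0]).
- apply: (@isoT_relabel _ [:: 0; 1; 1] _ [:: 1; 0]) => //.
  exact: (@isoT_factor _ _ [::] [:: 0] [:: 0; 1; 1]).
Qed.

Lemma only_U1_x n i : 0 < i <= n -> only [:: x; ys i] (U1 n) = [:: x; x; ys i; ys i].
Proof.
move=> hi; rewrite /U1 /down up_blocks !only_cat only_rev (only_blocks1 hi).
  by rewrite !only_cons !inE !vr_eq //= eqxx.
by move=> j _ nj; rewrite only_cons !inE !vr_eq //= (negPf nj).
Qed.

Lemma only_V1_x n i : 0 < i <= n -> only [:: x; ys i] (V1 n) = [:: ys i; ys i; x; x].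
Proof.
move=> hi; rewrite /V1 /down up_blocks !only_cat only_rev (only_blocks1 hi).
  by rewrite !only_cons !inE !vr_eq //= eqxx.
by move=> j _ nj; rewrite only_cons !inE !vr_eq //= (negPf nj).
Qed.

Lemma only_U1_yy n i j : 0 < i -> i < j <= n ->
  only [:: ys i; ys j] (U1 n) = [:: ys i; ys j; ys j; ys i].
Proof.
move=> i0 hj; rewrite /U1 /down up_blocks !only_cat only_rev (only_blocks2 i0 hj).
  by rewrite !only_cons !inE !vr_eq //= !eqxx orbT.
by move=> l _ nli nlj; rewrite only_cons !inE !vr_eq //= (negPf nli) (negPf nlj).
Qed.

Lemma mem_U1 n c : c \in U1 n -> c = x \/ exists2 i, 0 < i <= n & c = ys i.
Proof.
rewrite /U1 /down !mem_cat mem_rev => /or3P[|/mem_up|/mem_up]; try by right.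
by rewrite !inE => /orP[]/eqP->; left.
Qed.

Lemma case1 : (forall n, 1 < n -> satisfies S (U1 n) (V1 n)) -> ~ finitely_based S.
Proof.
have [iso01 iso001 iso010 iso100] := linear_patterns1.
have nested (a b : nat) : a != b -> isoT S [:: a; b; b; a].
  by move=> nab; apply: (@isoT_relabel _ _ _ [:: a; b] iso) => //=; rewrite inE nab.
move=> UV; apply: (nfb_of_invariant UV) => [n|k].
  by rewrite /V1; case: n => // n; rewrite /up /=.
have nxy i : x != ys i by rewrite vr_eq.
(* The first x precedes all the y_i. The number k + 2 exceeds both 1 and k. *)
exists k.+2, (fun w => forall i, 0 < i <= k.+2 -> head 0 (only [:: x; ys i] w) = x).
set n := k.+2; split=> [//|i hi|H|].
- by rewrite only_U1_x.
- by move: (H 1 isT); rewrite only_V1_x //= => /eqP; rewrite vr_eq.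
move=> w w' a b theta u v Uw Uw' ctr Pw.
have iso22 (i : nat) z : satisfies S (U1 n) z -> 0 < i <= n ->
    count_mem x z = 2 /\ count_mem (ys i) z = 2.
  move=> Uz hi; have hx := only_U1_x hi.
  have c2 c : c \in [:: x; ys i] -> count_mem c z = 2.
    move=> cE; have e1 : only [:: c] (U1 n) = [:: c; c].
      rewrite -(@only_sub _ [:: c] [:: x; ys i]) ?hx.
        move: cE; rewrite !inE => /orP[]/eqP->; rewrite !only_cons !inE !vr_eq //= ?eqxx //.
      by move=> d; rewrite inE => /eqP->.
    rewrite -(@count_only _ [:: c]) ?mem_head // (satisfies_only Uz) e1 /= ?eqxx //.
    apply: (@isoT_relabel _ [:: 0; 0] _ [:: c]) => //.
    exact: (@isoT_factor _ _ [::] [:: 1] [:: 0; 0]).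
  by split; apply: c2; rewrite ?mem_head ?mem_second.
have yy (i j : nat) z : satisfies S (U1 n) z -> 0 < i -> i < j <= n ->
    only [:: ys i; ys j] z = [:: ys i; ys j; ys j; ys i].
  move=> Uz i0 hj; rewrite (satisfies_only Uz) only_U1_yy //; apply: nested.
  by rewrite vr_eq //=; lia.
have lin : exchange_linear u v.
  apply: (exchange_linear_double ctr) => // c cu.
  have : c \in w.
    have := count_inl ctr c; have := ctr_repeated ctr cu.
    by case: (boolP (c \in w)) => // /count_memPn ->; slia.
  rewrite (satisfies_mem iso01 Uw) => /mem_U1[->|[i hi ->]].
    by have [-> _] := iso22 1 w Uw isT.
  by have [_ ->] := iso22 i w Uw hi.
suff Pw' j : 0 < j <= n -> head 0 (only [:: x; ys j] w') = x by [].
move=> hj; apply/eqP/negPn/negP => /eqP Nj.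
have xyw i : 0 < i <= n -> x \in w' /\ ys i \in w'.
  by move=> hi; have [cx cy] := iso22 i w' Uw' hi; rewrite -!has_pred1 !has_count cx cy.
(* The two nested orders are isoterms, so a word equal to U_n in S can show one of them only if U_n
   itself does. *)
have six i : 0 < i <= n -> only [:: x; ys i] w' \in
    [:: [:: x; x; ys i; ys i]; [:: x; ys i; x; ys i]; [:: ys i; x; ys i; x]; [:: ys i; ys i; x; x]].
  move=> hi; have [cx cy] := iso22 i w' Uw' hi.
  have := words_count22 (nxy i) (all_only [:: x; ys i] w').
  rewrite !count_only ?mem_head ?mem_second // => /(_ cx cy).
  have out q : isoT S q -> q != only [:: x; ys i] (U1 n) -> only [:: x; ys i] w' != q.
    move=> iq; apply: contra => /eqP ew'.
    by rewrite (satisfies_only (satisfies_sym Uw')) ew'.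
  rewrite !inE => /or4P[->|->|/eqP e3|/or3P[/eqP e4|->|->]]; rewrite ?orbT //.
  - suff : only [:: x; ys i] w' != only [:: x; ys i] w' by rewrite eqxx.
    rewrite [X in _ != X]e3; apply: out; first exact: nested.
    by rewrite only_U1_x // !eqseq_cons eqxx /= [ys i == x]eq_sym (negPf (nxy i)).
  - have nyx : ys i != x by rewrite eq_sym.
    suff : only [:: x; ys i] w' != only [:: x; ys i] w' by rewrite eqxx.
    rewrite [X in _ != X]e4; apply: out; first exact: nested.
    by rewrite only_U1_x // !eqseq_cons (negPf nyx).
(* In the four remaining orders, the letter that begins first also ends first. *)
have ends i : 0 < i <= n -> 
    last 0 (only [:: x; ys i] w') = if head 0 (only [:: x; ys i] w') == x then ys i else x.
  move=> hi; have := six i hi; have nyx : (ys i == x) = false by rewrite eq_sym (negPf (nxy i)).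
  by rewrite !inE => /or4P[] /eqP-> /=; rewrite ?eqxx ?nyx.
have heads i : 0 < i <= n -> head 0 (only [:: x; ys i] w') = ys i \/ head 0 (only [:: x; ys i] w') = x.
  by move=> hi; have := six i hi; rewrite !inE => /or4P[] /eqP-> /=; tauto.
(* If x and y_i kept their order, y_j would begin before x and x before y_i, and they would end in
   the same order. The occurrences of y_j and y_i would then not be nested, contrary to the isoterm
   they form. So a violation at j alters the order of x with every y_i. *)
have Ni i : 0 < i <= n -> only [:: x; ys i] w' <> only [:: x; ys i] w.
  move=> hi eqw; have xi : head 0 (only [:: x; ys i] w') = x by rewrite eqw Pw.
  have [[xw yiw] [_ yjw]] := (xyw i hi, xyw j hj).
  have [Hj|//] := heads j hj.
  have [li lj] := (ends i hi, ends j hj).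
  rewrite xi eqxx in li; rewrite (introF eqP Nj) in lj.
  have [nyjx nij] : ys j != x /\ ys j != ys i.
    split; first by rewrite eq_sym.
    by apply/eqP => eji; rewrite eji in Nj.
  have h1 : head 0 (only [:: ys j; ys i] w') = ys j.
    by apply: (head_only_trans nyjx (nxy i) yjw xw) => //; rewrite onlyC.
  have l1 : last 0 (only [:: ys i; ys j] w') = ys i.
    by apply: (last_only_trans _ (nxy j) yiw xw) => //; rewrite 1?eq_sym // onlyC.
  have [ij|ji|eij] := ltngtP i j; last by rewrite eij eqxx in nij.
  - move: h1; rewrite onlyC (yy i j _ Uw') ?ij ?(andP hj).2 ?(andP hi).1 //= => eij.
    by rewrite eij eqxx in nij.
  - move: l1; rewrite onlyC (yy j i _ Uw') ?ji ?(andP hi).2 ?(andP hj).1 //= => eij.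
    by rewrite eij eqxx in nij.
have [i j' i0 hj'|i hi] := few_indexed ctr (ltnW (ltnSn _)) (vr_inj (a := 1) isT).
- have e4 := yy i j' w Uw i0 hj'; apply: (nonrep_nonsquare _ e4); rewrite vr_eq //=; lia.
- by have [_ -> _] := exchange_transfer ctr lin (Ni i hi).
Qed.
End Case1.

(** * Case 2 *)

Lemma satisfies_count S U w c n : satisfies S U w -> count_mem c U = n ->
  isoT S (nseq n 0) -> count_mem c w = n.
Proof.
move=> Uw cU iso; have e1 : only [:: c] U = nseq n c by rewrite only1 cU.
rewrite -(@count_only _ [:: c]) ?mem_head // (satisfies_only Uw) e1.
  by elim: (n) => //= m ->; rewrite eqxx.
apply: (@isoT_relabel _ _ _ [:: c] iso) => //; first by elim: (n).
by elim: (n) => //= m ->.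
Qed.

Lemma count_only2 (T : eqType) (E w r : seq T) c : c \in E -> only E w = r ->
  count_mem c w = count_mem c r.
Proof. by move=> cE <-; rewrite count_only. Qed.

Lemma class_count S U w E r c : isoT S [:: 0; 0] -> satisfies S U w -> c \in E ->
  only E U = r -> 0 < count_mem c r <= 2 -> count_mem c w = count_mem c r.
Proof.
move=> iso00 Uw cE er; have := satisfies_count Uw (count_only2 cE er).
case: (count_mem c r) => [|[|[|?]]] // H _; apply: H => //.
exact: (@isoT_factor _ _ [::] [:: 0] [:: 0]).
Qed.

Lemma class_only S U w p q r E F : satisfies S U w -> isoT S p -> only E U = r ->
  all (mem E) F -> uniq F -> all (gtn (size F)) p -> map (nth 0 F) p = q -> only F r = q ->
  only F w = q.
Proof.
move=> Uw ip er /allP sFE uF ap ep eq; have eF : only F U = q by rewrite -(only_sub _ sFE) er.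
by rewrite (satisfies_only Uw) eF // -ep; apply: isoT_pattern.
Qed.

Lemma isoT_words S U w E (q : word) : satisfies S U w -> isoT S q ->
  only E U <> q -> only E w <> q.
Proof. by move=> Uw iq + ew; rewrite (satisfies_only (satisfies_sym Uw)) ew. Qed.

Lemma split_last (T : eqType) (c : T) w : c \in w -> exists p q, w = p ++ c :: q /\ c \notin q.
Proof.
rewrite -mem_rev => /split_first[p [q [ew cp]]]; exists (rev q), (rev p).
by rewrite mem_rev cp -[w]revK ew rev_cat rev_cons cat_rcons.
Qed.

Lemma last_after (T : eqType) (c d e : T) p q : c != d -> c \notin q ->
  last e (only [:: c; d] (p ++ c :: q)) = if d \in q then d else c.
Proof.
move=> ncd cq; rewrite only_cat only_cons mem_head last_cat /= onlyC (only_run d cq).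
rewrite -has_pred1 has_count; case: (count_mem d q) => [|n] //=.
by elim: n.
Qed.

(** Each copy of a repeated factor with z and z' would contain exactly one z and one z'. As t lies
    outside the copies and between the two z, the z' of the first copy would precede t. *)
Lemma nonrep_separated w z t z' : count_mem t w <= 1 -> t != z -> t != z' ->
  only [:: z; t] w = [:: z; t; z] -> only [:: t; z'] w = [:: t; z'; z'] -> nonrep w z z'.
Proof.
move=> ct ntz ntz' e1 e2 p r q s ew zr z'r; have nzt : z != t by rewrite eq_sym.
have cz : count_mem z w = 2 by rewrite (count_only2 _ e1) ?mem_head //= eqxx (negPf ntz).
have cz' : count_mem z' w = 2 by rewrite (count_only2 _ e2) ?mem_second //= eqxx (negPf ntz').
move: ct cz cz' zr z'r; rewrite -!has_pred1 !has_count ew !count_cat => ct cz cz' zr z'r.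
have tr : t \notin r by apply/count_memPn; slia.
have zp : z \notin p by apply/count_memPn; slia.
have z'p : z' \notin p by apply/count_memPn; slia.
have z'q : z' \notin q by apply/count_memPn; slia.
have cr : count_mem z r = 1 by slia.
have cr' : count_mem z' r = 1 by slia.
move: e1 e2; rewrite ew !only_cat ![only [:: t; z'] _]onlyC.
rewrite (only_run z tr) (only_run z' tr) cr cr' [only [:: z; t] p]onlyC (only_run t zp).
rewrite [only [:: z'; t] p]onlyC (only_run t z'p).
case: (count_mem t p) => [|n] /=; last by case=> tz; rewrite tz eqxx in ntz.
by move=> _ [z't]; rewrite z't eqxx in ntz'.
Qed.

Section Case2.
Variable S : monoid.
Hypothesis iso1 : isoT S [:: 0; 1; 1; 2; 0].
Hypothesis iso2 : isoT S [:: 0; 2; 1; 1; 0].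

Lemma linear_patterns2 : [/\ isoT S [:: 0; 1], isoT S [:: 0; 0; 1], isoT S [:: 0; 1; 0] &
  isoT S [:: 1; 0; 0]].
Proof.
split.
- exact: (@isoT_factor _ _ [::] [:: 1; 2; 0] [:: 0; 1]).
- apply: (@isoT_relabel _ [:: 1; 1; 2] _ [:: 2; 0; 1]) => //.
  exact: (@isoT_factor _ _ [:: 0] [:: 0] [:: 1; 1; 2]).
- exact: (@isoT_expand _ _ (fun c => if c == 1 then [:: 1; 2] else [::]) [:: 0; 1; 0]).
- apply: (@isoT_relabel _ [:: 2; 1; 1] _ [:: 2; 0; 1]) => //.
  exact: (@isoT_factor _ _ [:: 0] [:: 0] [:: 2; 1; 1]).
Qed.

Lemma only_U2_xy n : only [:: x; y] (U2 n) = [:: y; x; x; y].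
Proof.
rewrite /U2 up_blocks !only_cat !only_blocks0; first by rewrite !only_cons !inE !vr_eq.
  by move=> i _; rewrite !only_cons !inE !vr_eq.
by move=> i _; rewrite !only_cons !inE !vr_eq.
Qed.

Lemma only_V2_xy n : only [:: x; y] (V2 n) = [:: x; x; y; y].
Proof.
rewrite /V2 up_blocks !only_cat !only_blocks0; first by rewrite !only_cons !inE !vr_eq.
  by move=> i _; rewrite !only_cons !inE !vr_eq.
by move=> i _; rewrite !only_cons !inE !vr_eq.
Qed.

Lemma only_U2_zxt n i : 0 < i <= n ->
  only [:: zs i; x; ts i] (U2 n) = [:: zs i; ts i; x; x; zs i].
Proof.
move=> hi; rewrite /U2 up_blocks !only_cat !(only_blocks1 hi).
- by rewrite !only_cons !inE !vr_eq //= !eqxx.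
- by move=> j _ nj; rewrite !only_cons !inE !vr_eq //= (negPf nj).
- by move=> j _ nj; rewrite !only_cons !inE !vr_eq //= (negPf nj).
Qed.

Lemma only_U2_zyt n i : 0 < i <= n ->
  only [:: zs i; y; ts i] (U2 n) = [:: zs i; ts i; y; zs i; y].
Proof.
move=> hi; rewrite /U2 up_blocks !only_cat !(only_blocks1 hi).
- by rewrite !only_cons !inE !vr_eq //= !eqxx.
- by move=> j _ nj; rewrite !only_cons !inE !vr_eq //= (negPf nj).
- by move=> j _ nj; rewrite !only_cons !inE !vr_eq //= (negPf nj).
Qed.

Lemma only_U2_tz n i j : 0 < i -> i < j <= n ->
  only [:: ts i; zs j] (U2 n) = [:: ts i; zs j; zs j].
Proof.
move=> i0 hj; rewrite /U2 up_blocks !only_cat !(only_blocks2 i0 hj).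
- have [nij nji] : i != j /\ j != i by lia.
  by rewrite !only_cons !inE !vr_eq //= !eqxx (negPf nij) (negPf nji).
- by move=> l _ nli nlj; rewrite !only_cons !inE !vr_eq //= ?(negPf nli) ?(negPf nlj).
- by move=> l _ nli nlj; rewrite !only_cons !inE !vr_eq //= ?(negPf nli) ?(negPf nlj).
Qed.

Lemma mem_U2 n c : c \in U2 n ->
  [\/ c = x, c = y, exists2 i, 0 < i <= n & c = zs i | exists2 i, 0 < i <= n & c = ts i].
Proof.
rewrite /U2 !mem_cat => /or4P[/mem_blocks[i hi]||/mem_up[i hi ->]|].
- by rewrite !inE => /orP[]/eqP->; [constructor 3|constructor 4]; exists i.
- by rewrite !inE => /or3P[]/eqP->; [constructor 2|constructor 1|constructor 1].
- by constructor 3; exists i.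
- by rewrite !inE => /eqP->; constructor 2.
Qed.

Lemma case2 : (forall n, 1 < n -> satisfies S (U2 n) (V2 n)) -> ~ finitely_based S.
Proof.
have [iso01 iso001 iso010 iso100] := linear_patterns2.
have iso00 : isoT S (nseq 2 0) by apply: (@isoT_factor _ _ [::] [:: 1] [:: 0; 0]).
have iso0 : isoT S (nseq 1 0) by apply: (@isoT_factor _ _ [::] [:: 1] [:: 0]).
move=> UV; apply: (nfb_of_invariant UV) => [n|k].
  by rewrite /U2 /V2 /is_word -!size_eq0 !size_cat /=; lia.
exists k.+2, (fun w => only [:: x; y] w = [:: y; x; x; y]).
set n := k.+2; split=> [//||/eqP|]; first exact: only_U2_xy.
  by rewrite only_V2_xy !eqseq_cons vr_eq.
move=> w w' a b theta u v Uw Uw' ctr Pw.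
have count2 c E r : c \in E -> only E (U2 n) = r -> 0 < count_mem c r <= 2 ->
    count_mem c w = count_mem c r by apply: (class_count iso00 Uw).
have cx : count_mem x w = 2.
  by rewrite (count2 _ _ _ _ (only_U2_xy n)) ?mem_head //= !vr_eq.
have cy : count_mem y w = 2.
  by rewrite (count2 _ _ _ _ (only_U2_xy n)) ?mem_second //= !vr_eq.
have cz i : 0 < i <= n -> count_mem (zs i) w = 2.
  by move=> hi; rewrite (count2 _ _ _ _ (only_U2_zxt hi)) ?mem_head //= !vr_eq //= !eqxx.
have ct i : 0 < i <= n -> count_mem (ts i) w = 1.
  by move=> hi; rewrite (count2 _ _ _ _ (only_U2_zxt hi)) //= ?inE !vr_eq //= ?eqxx ?orbT.
have lin : exchange_linear u v.
  apply: (exchange_linear_double ctr) => // c /(mem_inl ctr).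
  by rewrite (satisfies_mem iso01 Uw) => /mem_U2[->|->|[i hi ->]|[i hi ->]];
     rewrite ?cx ?cy ?cz ?ct.
have zxt i : 0 < i <= n -> only [:: zs i; x; ts i] w = [:: zs i; ts i; x; x; zs i].
  move=> hi; rewrite (satisfies_only Uw) only_U2_zxt //.
  by apply: (isoT_relabel (E := [:: zs i; x; ts i]) iso2); rewrite //= !inE !vr_eq.
have ty i : 0 < i <= n -> only [:: ts i; y] w = [:: ts i; y; y].
  have sE : {subset [:: ts i; y] <= [:: zs i; y; ts i]}.
    by move=> c; rewrite !inE => /orP[]->; rewrite ?orbT.
  move=> hi; have e : only [:: ts i; y] (U2 n) = [:: ts i; y; y].
    by rewrite -(only_sub _ sE) only_U2_zyt // !only_cons !inE !vr_eq //= !eqxx.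
  rewrite (satisfies_only Uw) e //.
  by apply: (isoT_relabel (E := [:: y; ts i]) iso100); rewrite //= !inE !vr_eq.
have tz i j : 0 < i -> i < j <= n -> only [:: ts i; zs j] w = [:: ts i; zs j; zs j].
  move=> i0 hj; rewrite (satisfies_only Uw) only_U2_tz //.
  by apply: (isoT_relabel (E := [:: zs j; ts i]) iso100); rewrite //= !inE !vr_eq.
have zt i : 0 < i <= n -> only [:: zs i; ts i] w = [:: zs i; ts i; zs i].
  have sE : {subset [:: zs i; ts i] <= [:: zs i; x; ts i]}.
    by move=> c; rewrite !inE => /orP[]->; rewrite ?orbT.
  by move=> hi; rewrite -(only_sub _ sE) zxt // !only_cons !inE !vr_eq //= !eqxx.
have [i j i0 hj|i hi zu] := few_indexed ctr (ltnW (ltnSn _)) (vr_inj (a := 2) isT).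
  by apply: (@nonrep_separated _ _ (ts i)); rewrite ?vr_eq ?ct ?zt ?tz //; lia.
apply/eqP/negPn/negP => /eqP Nw'.
have [|xu yu unst] := exchange_transfer ctr lin (c := x) (d := y); first by rewrite Pw.
have fE : full w u [:: y; x].
  by apply: (full_pairs ctr) => e; rewrite !inE => /orP[]/eqP->; rewrite ?cx ?cy.
have zw : zs i \in w by rewrite -has_pred1 has_count cz.
(* The last z_i will turn out to lie after both x and before the last y, so the linear variable l
   covering it gives the isoterm y x x l y. *)
have [p [q [ew zq]]] := split_last zw.
have nzx : zs i != x by rewrite vr_eq.
have nzy : zs i != y by rewrite vr_eq.
have xq : x \notin q.
  have sE : {subset [:: zs i; x] <= [:: zs i; x; ts i]}.
    by move=> e; rewrite !inE => /orP[]->; rewrite ?orbT.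
  have := last_after 0 p nzx zq; rewrite -ew -(only_sub _ sE) zxt //.
  by rewrite !only_cons !inE !vr_eq //= !eqxx; case: ifP => // _ /eqP; rewrite vr_eq.
(* Otherwise both y lie between t_i and the last z_i, and w would restrict to the isoterm z_i t_i y
   y z_i, which U_n does not. *)
have yq : y \in q.
  have := last_after 0 p nzy zq; rewrite -ew; case: ifP => // _ lz.
  have hz : head 0 (only [:: zs i; y] w) = zs i.
    by apply: (@head_only_trans _ _ (ts i)); rewrite ?zt ?ty ?vr_eq // -has_pred1 has_count ct.
  have zyyz : only [:: zs i; y] w = [:: zs i; y; y; zs i].
    have := words_count22 nzy (all_only [:: zs i; y] w).
    rewrite !count_only ?mem_head ?mem_second // cz // => /(_ erefl cy).
    rewrite !inE => /or4P[|||/or3P[]] /eqP E; rewrite E //= in lz hz *;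
    by move/eqP: lz; move/eqP: hz; rewrite ?vr_eq.
  have e3 : only [:: zs i; y; ts i] w = [:: zs i; ts i; y; y; zs i].
    apply: only_from_pairs => //; rewrite /= ?inE ?vr_eq ?eqxx ?orbT //=.
    rewrite zyyz zt // [only [:: y; _] _]onlyC ty //.
    by rewrite !only_cons !inE !vr_eq //= !eqxx.
  have : only [:: zs i; y; ts i] (U2 n) = [:: zs i; ts i; y; y; zs i].
    rewrite (satisfies_only (satisfies_sym Uw)) e3 //.
    by apply: (isoT_relabel (E := [:: zs i; y; ts i]) iso2); rewrite //= !inE !vr_eq.
  by rewrite only_U2_zyt // => -[/eqP]; rewrite vr_eq.
have [ep eq] : only [:: y; x] p = [:: y; x; x] /\ only [:: y; x] q = [:: y].
  have := Pw; rewrite onlyC ew only_cat only_cons !inE !vr_eq //= (only_run y xq).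
  move: yq; rewrite -has_pred1 has_count; case: (count_mem y q) => [|[|m]] // _.
    by rewrite cats1 -[RHS]/(rcons [:: y; x; x] y) => /rcons_inj[].
  move/(congr1 rev); rewrite rev_cat rev_nseq /= => -[/eqP].
  by rewrite vr_eq.
have [||l] := marker_at ctr fE zu ew; rewrite ?ep ?eq // => el.
have il : isoT S (only (inr l :: map inl [:: y; x]) u).
  by rewrite el; apply: (@isoT_pattern _ _ _ [:: inl y; inl x; inr l] (inl y) iso1).
apply: unst; apply: (exchange_stable ctr _ il).
by move=> e; rewrite !inE => /orP[]->; rewrite ?orbT.
Qed.
End Case2.

(** * Case 4 *)

Ltac letters := rewrite ?only_cons /= ?inE ?vr_eq //= ?eqxx ?orbT //=.

Section Case4.
Variable S : monoid.
Hypothesis iso1 : isoT S [:: 0; 0; 1; 1].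
Hypothesis iso2 : isoT S [:: 0; 1; 2; 1; 3; 0].

Lemma linear_patterns4 : [/\ isoT S [:: 0; 1], isoT S [:: 0; 0; 1], isoT S [:: 0; 1; 0] &
  isoT S [:: 1; 0; 0]].
Proof.
split.
- exact: (@isoT_factor _ _ [::] [:: 2; 1; 3; 0] [:: 0; 1]).
- exact: (@isoT_factor _ _ [::] [:: 1] [:: 0; 0; 1]).
(* The block 1213 serves as a single letter: the image of 010 is 012130. *)
- exact: (@isoT_expand _ _ (fun c => if c == 1 then [:: 2; 1; 3] else [::]) [:: 0; 1; 0]).
- apply: (@isoT_relabel _ [:: 0; 1; 1] _ [:: 1; 0]) => //.
  exact: (@isoT_factor _ _ [:: 0] [::] [:: 0; 1; 1]).
Qed.

Lemma only_blocks4 n : only [:: x; y; t] (blocks (fun i => [:: zs i; zs i]) n) = [::].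
Proof. by rewrite only_blocks0 // => i _; rewrite !only_cons !inE !vr_eq. Qed.

Lemma only_U4_xyt n : only [:: x; y; t] (U4 n) = [:: x; y; t; y; x].
Proof. by rewrite /U4 !only_cat only_blocks4 /= !only_cons !inE !vr_eq. Qed.

Lemma only_V4_xyt n : only [:: x; y; t] (V4 n) = [:: y; x; t; y; x].
Proof. by rewrite /V4 !only_cat only_blocks4 /= !only_cons !inE !vr_eq. Qed.

Lemma only_U4_z n i : 0 < i <= n ->
  only [:: x; y; t; zs i] (U4 n) = [:: x; y; t; y; zs i; zs i; x].
Proof.
move=> hi; rewrite /U4 !only_cat !(only_blocks1 hi).
- by rewrite !only_cons !inE !vr_eq //= !eqxx.
- by move=> j _ nj; rewrite !only_cons !inE !vr_eq //= (negPf nj).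
Qed.

Lemma only_U4_zz n i j : 0 < i -> i < j <= n ->
  only [:: zs i; zs j] (U4 n) = [:: zs i; zs i; zs j; zs j].
Proof.
move=> i0 hj; rewrite /U4 !only_cat !(only_blocks2 i0 hj).
- have [nij nji] : i != j /\ j != i by lia.
  by rewrite !only_cons !inE !vr_eq //= !eqxx (negPf nji) orbT.
- by move=> l _ nli nlj; rewrite !only_cons !inE !vr_eq //= ?(negPf nli) ?(negPf nlj).
Qed.

Lemma mem_U4 n c : c \in U4 n ->
  [\/ c = x, c = y, c = t | exists2 i, 0 < i <= n & c = zs i].
Proof.
rewrite /U4 !mem_cat => /or3P[|/mem_blocks[i hi]|].
- by rewrite !inE => /or4P[]/eqP->; [constructor 1|constructor 2|constructor 3|constructor 2].
- by rewrite !inE orbb => /eqP->; constructor 4; exists i.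
- by rewrite !inE => /eqP->; constructor 1.
Qed.

Lemma case4 : (forall n, 1 < n -> satisfies S (U4 n) (V4 n)) -> ~ finitely_based S.
Proof.
have [iso01 iso001 iso010 iso100] := linear_patterns4.
have iso00 : isoT S [:: 0; 0] by apply: (@isoT_factor _ _ [::] [:: 1; 1] [:: 0; 0]).
move=> UV; apply: (nfb_of_invariant UV) => [//|k].
have sxy : {subset [:: x; y] <= [:: x; y; t]} by move=> c; rewrite !inE => /orP[]->; rewrite ?orbT.
exists k.+2, (fun w => only [:: x; y] w = [:: x; y; y; x]).
set n := k.+2; split=> [//||/eqP|].
- by rewrite -(only_sub _ sxy) only_U4_xyt !only_cons !inE !vr_eq.
- by rewrite -(only_sub _ sxy) only_V4_xyt !only_cons !inE !vr_eq //= !eqseq_cons vr_eq.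
move=> w w' a b theta u v Uw Uw' ctr Pw.
have count2 c E r : c \in E -> only E (U4 n) = r -> 0 < count_mem c r <= 2 ->
    count_mem c w = count_mem c r by apply: (class_count iso00 Uw).
have cx : count_mem x w = 2 by rewrite (count2 _ _ _ _ (only_U4_xyt n)) //= !vr_eq.
have cy : count_mem y w = 2 by rewrite (count2 _ _ _ _ (only_U4_xyt n)) //= ?inE !vr_eq.
have ct : count_mem t w = 1 by rewrite (count2 _ _ _ _ (only_U4_xyt n)) //= ?inE !vr_eq.
have cz i : 0 < i <= n -> count_mem (zs i) w = 2.
  by move=> hi; rewrite (count2 _ _ _ _ (only_U4_z hi)) //= ?inE !vr_eq //= ?eqxx.
have lin : exchange_linear u v.
  apply: (exchange_linear_double ctr) => // c /(mem_inl ctr).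
  by rewrite (satisfies_mem iso01 Uw) => /mem_U4[->|->|->|[i hi ->]]; rewrite ?cx ?cy ?cz ?ct.
have xt : only [:: x; t] w = [:: x; t; x].
  by apply: (class_only Uw iso010 (only_U4_xyt n)); letters.
have yt : only [:: y; t] w = [:: y; t; y].
  by apply: (class_only Uw iso010 (only_U4_xyt n)); letters.
have tz i : 0 < i <= n -> only [:: t; zs i] w = [:: t; zs i; zs i].
  by move=> hi; apply: (class_only Uw (isoT_relabel (E := [:: 1; 0]) iso100 _ _ erefl) (only_U4_z hi)); letters.
have yz i : 0 < i <= n -> only [:: y; zs i] w = [:: y; y; zs i; zs i].
  by move=> hi; apply: (class_only Uw iso1 (only_U4_z hi)); letters.
have zz i j : 0 < i -> i < j <= n -> only [:: zs i; zs j] w = [:: zs i; zs i; zs j; zs j].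
  move=> i0 hj; have [nij nji] : i != j /\ j != i by lia.
  by apply: (class_only Uw iso1 (only_U4_zz i0 hj)); letters; rewrite ?(negPf nij) ?(negPf nji).
have [i j i0 hj|i hi zu] := few_indexed ctr (ltnW (ltnSn _)) (vr_inj (a := 2) isT).
  by apply: (nonrep_nonsquare _ (zz i j i0 hj)); rewrite vr_eq //=; lia.
apply/eqP/negPn/negP => /eqP Nw'.
have [|xu yu unst] := exchange_transfer ctr lin (c := x) (d := y); first by rewrite Pw.
have fE : full w u [:: x; y].
  by apply: (full_pairs ctr) => e; rewrite !inE => /orP[]/eqP->; rewrite ?cx ?cy.
have tu : inl t \notin u by apply: (linear_notin ctr); rewrite ct.
have nxz : x != zs i by rewrite vr_eq.
(* The order of x and z_i in w is not determined. But the first z_i comes after both y and before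
   the last x, so together with t it yields the isoterm x y l y l' x. *)
have [r3 [r30 er]] : exists r3, only [:: x; y] r3 = [:: x] /\
    only [:: t; zs i; x; y] w = [:: x; y] ++ t :: [:: y] ++ zs i :: r3.
  have hx : head 0 (only [:: x; zs i] w) = x.
    by apply: (@head_only_trans _ _ t); rewrite ?xt ?tz ?vr_eq // -has_pred1 has_count ?cx ?ct.
  have nxxzz : only [:: x; zs i] w <> [:: x; x; zs i; zs i].
    apply: (isoT_words Uw); first by apply: (isoT_relabel (E := [:: x; zs i]) iso1); letters.
    have sE : {subset [:: x; zs i] <= [:: x; y; t; zs i]}.
      by move=> e; rewrite !inE => /orP[]->; rewrite ?orbT.
    by rewrite -(only_sub _ sE) only_U4_z //; letters => -[/eqP]; rewrite vr_eq.
  have := words_count22 nxz (all_only [:: x; zs i] w).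
  rewrite !count_only ?mem_head ?mem_second // cz // => /(_ cx erefl).
  rewrite !inE => /or4P[/eqP//|/eqP E|/eqP E|/or3P[] /eqP E]; last 3 first.
  - by move/eqP: hx; rewrite E /= eq_sym (negPf nxz).
  - by move/eqP: hx; rewrite E /= eq_sym (negPf nxz).
  - by move/eqP: hx; rewrite E /= eq_sym (negPf nxz).
  - exists [:: x; zs i]; split; first by letters.
    apply: only_from_pairs; letters.
    rewrite ![only [:: t; x] _]onlyC ![only [:: t; y] _]onlyC ![only [:: zs i; x] _]onlyC.
    rewrite ![only [:: zs i; y] _]onlyC xt yt tz // yz // E Pw; letters.
  - exists [:: zs i; x]; split; first by letters.
    apply: only_from_pairs; letters.
    rewrite ![only [:: t; x] _]onlyC ![only [:: t; y] _]onlyC ![only [:: zs i; x] _]onlyC.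
    rewrite ![only [:: zs i; y] _]onlyC xt yt tz // yz // E Pw; letters.
have exy : only [:: x; y] [:: x; y] = [:: x; y] by letters.
have ey : only [:: x; y] [:: y] = [:: y] by letters.
have [|||l [l' [nll']]] := marker2 ctr fE tu zu er; rewrite ?exy ?ey ?r30 // => el.
have il : isoT S (only [:: inr l, inr l' & map inl [:: x; y]] u).
  rewrite el; apply: (@isoT_pattern _ _ _ [:: inl x; inl y; inr l; inr l'] (inl y) iso2) => //.
  by rewrite /= !inE //= andbT; apply: contra nll' => /eqP[->].
apply: unst; apply: (exchange_stable ctr _ il).
by move=> e; rewrite !inE => /orP[]->; rewrite ?orbT.
Qed.
End Case4.

(** * Cases 5 and 6 *)

Section Case56.
Variable S : monoid.
Hypothesis iso1 : isoT S [:: 0; 1; 2; 0; 3; 2].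
Hypothesis iso2 : isoT S [:: 0; 1; 2; 0; 1].
Hypothesis iso3 : isoT S [:: 0; 1; 2; 1; 0].

Lemma linear_patterns56 : [/\ isoT S [:: 0; 1], isoT S [:: 0; 1; 0], isoT S [:: 1; 0; 2; 0] &
  isoT S [:: 0; 2; 0; 1]].
Proof.
split.
- exact: (@isoT_factor _ _ [::] [:: 2; 0; 1] [:: 0; 1]).
- apply: (@isoT_relabel _ [:: 0; 2; 0] _ [:: 0; 2; 1]) => //.
  exact: (@isoT_expand _ _ (fun c => if c == 0 then [:: 1] else [::]) [:: 0; 2; 0]).
- apply: (@isoT_relabel _ [:: 1; 2; 0; 2] _ [:: 2; 1; 0]) => //.
  apply: (@isoT_expand _ _ (fun c => if c == 0 then [:: 3] else [::])).
  exact: (@isoT_factor _ _ [:: 0] [::] [:: 1; 2; 0; 3; 2]).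
- apply: (@isoT_relabel _ [:: 0; 1; 0; 3] _ [:: 0; 2; 3; 1]) => //.
  apply: (@isoT_expand _ _ (fun c => if c == 1 then [:: 2] else [::])).
  exact: (@isoT_factor _ _ [::] [:: 2] [:: 0; 1; 2; 0; 3]).
Qed.

(** What the words U_n of cases 5 and 6 have in common. They differ only in the order of the second
    occurrences of x and y, whence the disjunction. *)
Definition xy_frame n w :=
  [/\ forall c i, c \in [:: x; y] -> 0 < i <= n ->
        only [:: c; zs i; t] w = [:: c; zs i; c; t; zs i],
      forall c i j, c \in [:: x; y] -> 0 < i -> i < j <= n ->
        only [:: c; zs i; zs j; t] w = [:: c; zs i; zs j; c; t; zs j; zs i],
      forall i, 0 < i <= n ->
        only [:: x; y; zs i] w = [:: x; y; zs i; y; x; zs i] \/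
        only [:: x; y; zs i] w = [:: x; y; zs i; x; y; zs i] &
      forall c, c \in w -> c \in [:: x; y; t] \/ exists2 i, 0 < i <= n & c = zs i].

(** With z_i absent from u, every pair of letters of u is completed to an isoterm: x and y by z_i,
    two letters z by t, and x or y against z_q by z_i, with or without t. *)
Lemma xy_frame_isolated k n w w' a b theta u v : k.+1 < n -> xy_frame n w ->
  contracted S k w w' a b theta u v -> w' = w.
Proof.
have [iso01 iso010 iso1020 iso0201] := linear_patterns56.
move=> kn [czt czzt xyz memw] ctr.
have yxy : y \in [:: x; y] by apply: mem_second.
have xxy : x \in [:: x; y] by apply: mem_head.
have only_perm (E F : word) : perm_eq E F -> only E w = only F w.
  by move=> /perm_mem/eq_only.
have sub (E F : word) q r : only E w = r -> all (mem E) F -> only F r = q -> only F w = q.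
  by move=> er /allP sFE; rewrite -(only_sub w sFE) er.
have nzz i j : i < j -> zs i != zs j /\ zs j != zs i by rewrite !vr_eq //=; lia.
have zzt i j : 0 < i -> i < j <= n -> only [:: zs i; zs j; t] w = [:: zs i; zs j; t; zs j; zs i].
  move=> i0 hj; have [nij nji] := nzz i j (andP hj).1.
  apply: (sub _ _ _ _ (czzt x i j xxy i0 hj)); first by rewrite /= !inE !eqxx !orbT.
  by rewrite !only_cons !inE !eqxx (negPf nij) (negPf nji) !vr_eq.
have ncz c i : c \in [:: x; y] -> [/\ c == zs i = false, c == t = false, zs i == c = false & t == c = false].
  by rewrite !inE => /orP[]/eqP->; rewrite !vr_eq.
have hn : 0 < n <= n by lia.
have ct : count_mem t w = 1 by rewrite (count_only2 _ (czt x n xxy hn)) //= ?inE !vr_eq.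
have cc c : c \in [:: x; y] -> count_mem c w = 2.
  move=> cxy; have [n1 n2 n3 n4] := ncz c n cxy.
  by rewrite (count_only2 _ (czt c n cxy hn)) ?mem_head //= !eqxx n3 n4.
have cz i : 0 < i <= n -> count_mem (zs i) w = 2.
  by move=> hi; rewrite (count_only2 _ (czt x i xxy hi)) ?mem_second //= !eqxx !vr_eq.
have count_le c : c \in w -> count_mem c w <= 2.
  case/memw=> [|[i hi ->]]; last by rewrite cz.
  by rewrite !inE => /or3P[]/eqP->; rewrite ?ct ?cc.
have fE E : {in E, forall c, inl c \in u} -> full w u E.
  by move=> Eu; apply: (full_pairs ctr) => c cE; rewrite Eu // count_le // (mem_inl ctr) ?Eu.
have full1 c : inl c \in u -> full w u [:: c] by move=> cu; apply: fE => d; rewrite inE => /eqP->.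
have full2 c d : inl c \in u -> inl d \in u -> full w u [:: c; d].
  by move=> cu du; apply: fE => e; rewrite !inE => /orP[]/eqP->.
have tu : inl t \notin u by apply: (linear_notin ctr); rewrite ct.
have tz i : 0 < i <= n -> only [:: t; zs i] w = [:: zs i; t; zs i].
  move=> hi; apply: (sub _ _ _ _ (czt x i xxy hi)); first by rewrite /= !inE !eqxx !orbT.
  by rewrite !only_cons !inE !eqxx !vr_eq.
have [i j i0 hj|i hi zu] := few_indexed ctr (ltnW kn) (vr_inj (a := 2) isT).
  have e4 : only [:: zs i; zs j] w = [:: zs i; zs j; zs j; zs i].
    have [nij nji] := nzz i j (andP hj).1.
    apply: (sub _ _ _ _ (zzt i j i0 hj)); first by rewrite /= !inE !eqxx !orbT.
    by rewrite !only_cons !inE !eqxx (negPf nij) (negPf nji) !vr_eq.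
  apply: (nonrep_nonsquare _ e4); rewrite vr_eq //=; lia.
(* The letters x and y are split by z_i, and each z_j by t; neither z_i nor t is a letter of u. *)
have lin : exchange_linear u v.
  apply: (exchange_linear_split ctr) => // c cu; have cw := mem_inl ctr cu.
  split; first exact: count_le.
  have : c \in [:: x; y] \/ exists2 j, 0 < j <= n & c = zs j.
    case/memw: cw => [|]; last by right.
    by rewrite !inE => /or3P[->|->|/eqP ct']; rewrite ?orbT; [left|left|rewrite ct' (negPf tu) in cu].
  case=> [cxy|[j hj ec]].
    have [n1 n2 n3 n4] := ncz c i cxy.
    have e : only [:: zs i; c] w = [:: c] ++ zs i :: [:: c; zs i].
      apply: (sub _ _ _ _ (czt c i cxy hi)); first by rewrite /= !inE !eqxx !orbT.
      by rewrite !only_cons !inE !eqxx !vr_eq //= n4 orbT.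
    have [||l el] := marker ctr (full1 c cu) zu e; rewrite ?only_cons ?inE ?eqxx //= ?n3 //.
    by exists l; move: el; rewrite !only_cons !inE !eqxx n3.
  have e : only [:: t; c] w = [:: c] ++ t :: [:: c] by rewrite ec tz.
  have [||l el] := marker ctr (full1 c cu) tu e; rewrite ?only_cons ?inE ?eqxx //=.
  by exists l; move: el; rewrite !only_cons !inE !eqxx.
have stable E c d : isoT S (only E u) -> inl c \in E -> inl d \in E ->
    only [:: inl c; inl d] v = only [:: inl c; inl d] u.
  by move=> iE cE dE; apply: (exchange_stable ctr _ iE) => e; rewrite !inE => /orP[]/eqP->.
have st_xy : inl x \in u -> inl y \in u -> only [:: inl x; inl y] v = only [:: inl x; inl y] u.
  move=> xu yu; have fxy := full2 x y xu yu.
  have e : exists r, [/\ only [:: zs i; x; y] w = [:: x; y] ++ zs i :: r,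
      r = [:: y; x; zs i] \/ r = [:: x; y; zs i] & only [:: x; y] r <> [::]].
    have -> : only [:: zs i; x; y] w = only [:: x; y; zs i] w.
      by apply: only_perm; rewrite -[[:: x; y; _]]/(rcons [:: x; y] _) perm_sym perm_rcons.
    have [->|->] := xyz i hi; [exists [:: y; x; zs i]|exists [:: x; y; zs i]]; split=> //;
      by rewrite ?only_cons ?inE ?eqxx ?orbT; auto.
  have [r [er hr r0]] := e; have [||l el] := marker ctr fxy zu er => //.
  apply: (stable (inr l :: map inl [:: x; y])); rewrite ?inE ?eqxx ?orbT //= el.
  have -> : only [:: x; y] [:: x; y] = [:: x; y] by letters.
  case: hr => ->; letters.
  - exact: (@isoT_pattern _ _ _ [:: inl x; inl y; inr l] (inl y) iso3).
  - exact: (@isoT_pattern _ _ _ [:: inl x; inl y; inr l] (inl y) iso2).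
have st_zz p q : 0 < p -> p < q <= n -> inl (zs p) \in u -> inl (zs q) \in u ->
    only [:: inl (zs p); inl (zs q)] v = only [:: inl (zs p); inl (zs q)] u.
  move=> p0 hq pu qu; have [npq nqp] := nzz p q (andP hq).1.
  have e : only [:: t; zs p; zs q] w = [:: zs p; zs q] ++ t :: [:: zs q; zs p].
    by rewrite -[RHS]zzt //; apply: only_perm; rewrite -(perm_rcons t [:: zs p; zs q]).
  have [||l el] := marker ctr (full2 _ _ pu qu) tu e.
  - by rewrite !only_cons !inE !eqxx.
  - by rewrite !only_cons !inE !eqxx orbT.
  apply: (stable (inr l :: map inl [:: zs p; zs q])); rewrite ?inE ?eqxx ?orbT //= el.
  rewrite !only_cons !inE !eqxx !orbT /=.
  apply: (@isoT_pattern _ _ _ [:: inl (zs p); inl (zs q); inr l] (inl y) iso3) => //.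
  by rewrite /= !inE //= orbF andbT; apply: contra npq => /eqP[->].
have st_cz c q : c \in [:: x; y] -> 0 < q <= n -> inl c \in u -> inl (zs q) \in u ->
    only [:: inl c; inl (zs q)] v = only [:: inl c; inl (zs q)] u.
  move=> cxy hq cu qu; have [n1 n2 n3 n4] := ncz c q cxy; have [m1 m2 m3 m4] := ncz c i cxy.
  (* For i < q the first z_i and t mark c l z_q c l' z_q; for q < i the first z_i alone marks c z_q
     l c z_q. *)
  have [iq|qi|eqq] := ltngtP i q; last by rewrite eqq qu in zu.
  - have [niq nqi] := nzz i q iq.
    have e : only [:: zs i, t & [:: c; zs q]] w = [:: c] ++ zs i :: [:: zs q; c] ++ t :: [:: zs q; zs i].
      have hq' : i < q <= n by rewrite iq (andP hq).2.
      rewrite -[RHS](czzt c i q cxy (andP hi).1 hq'); apply: eq_only => e; rewrite !inE.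
      by do !case: eqP.
    have [|||l [l' [nll' el]]] := marker2 ctr (full2 _ _ cu qu) zu tu e.
    + by rewrite !only_cons !inE !eqxx.
    + by rewrite !only_cons !inE !eqxx orbT.
    + by rewrite !only_cons !inE !eqxx orbT.
    apply: (stable [:: inr l, inr l' & map inl [:: c; zs q]]); rewrite ?inE ?eqxx ?orbT //= el.
    rewrite !only_cons !inE !eqxx !orbT m3 (negPf niq) /=.
    apply: (@isoT_pattern _ _ _ [:: inl c; inr l; inl (zs q); inr l'] (inl y) iso1) => //.
    by rewrite /= !inE //= orbF !andbT; apply/andP; split; [rewrite (inj_eq (@inl_inj _ _)) n1|apply: contra nll' => /eqP[->]].
  - have [nqi niq] := nzz q i qi.
    have e : only [:: zs i, c, zs q & [::]] w = [:: c; zs q] ++ zs i :: [:: c; zs i; zs q].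
      have hi' : q < i <= n by rewrite qi (andP hi).2.
      apply: (sub _ _ _ _ (czzt c q i cxy (andP hq).1 hi')).
        by rewrite /= !inE !eqxx !orbT.
      by rewrite !only_cons !inE !eqxx !orbT !vr_eq //= n4.
    have [||l el] := marker ctr (full2 _ _ cu qu) zu e.
    + by rewrite !only_cons !inE !eqxx.
    + by rewrite !only_cons !inE !eqxx.
    apply: (stable (inr l :: map inl [:: c; zs q])); rewrite ?inE ?eqxx ?orbT //= el.
    rewrite !only_cons !inE !eqxx !orbT m3 (negPf niq) /=.
    apply: (@isoT_pattern _ _ _ [:: inl c; inl (zs q); inr l] (inl y) iso2) => //.
    by rewrite /= !inE //= orbF andbT (inj_eq (@inl_inj _ _)) n1.
have letter c : inl c \in u -> [\/ c = x, c = y | exists2 j, 0 < j <= n & c = zs j].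
  move=> cu; have /memw[|] := mem_inl ctr cu; last by constructor 3.
  rewrite !inE => /or3P[]/eqP ec; [by constructor 1|by constructor 2|].
  by rewrite ec (negPf tu) in cu.
apply: (exchange_eq ctr lin) => c d cu du ncd.
have [Lc Ld] := (letter c cu, letter d du); case: Lc Ld cu du ncd => [->|->|[p hp ->]] [->|->|[q hq ->]] cu du ncd;
  rewrite ?eqxx // in ncd *; try by auto.
- by rewrite onlyC [RHS]onlyC st_xy.
- by rewrite onlyC [RHS]onlyC st_cz.
- by rewrite onlyC [RHS]onlyC st_cz.
- have [pq|qp|epq] := ltngtP p q; last by rewrite epq eqxx in ncd.
  + by apply: st_zz => //; lia.
  + by rewrite onlyC [RHS]onlyC; apply: st_zz => //; lia.
Qed.

Lemma xy_frame_word n c1 c2 :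
  [:: c1; c2] = [:: y; x] \/ [:: c1; c2] = [:: x; y] ->
  xy_frame n ([:: x; y] ++ up zs n ++ [:: c1; c2; t] ++ down zs n).
Proof.
move=> ec; rewrite /down up_blocks; split.
- move=> c i cxy hi; rewrite !only_cat only_rev (only_blocks1 hi).
    move: cxy; rewrite !inE => /orP[]/eqP->;
    by case: ec => -[-> ->]; rewrite !only_cons !inE !eqxx !vr_eq.
  by move=> j _ nj; move: cxy; rewrite !inE => /orP[]/eqP->;
    rewrite !only_cons !inE !vr_eq //= (negPf nj).
- move=> c i j cxy i0 hj; rewrite !only_cat only_rev (only_blocks2 i0 hj).
    move: cxy; rewrite !inE => /orP[]/eqP->;
    by case: ec => -[-> ->]; rewrite !only_cons !inE !eqxx !orbT !vr_eq.
  by move=> l _ nli nlj; move: cxy; rewrite !inE => /orP[]/eqP->;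
    rewrite !only_cons !inE !vr_eq //= (negPf nli) (negPf nlj).
- move=> i hi; rewrite !only_cat only_rev (only_blocks1 hi).
    by case: ec => -[-> ->]; [left|right]; rewrite !only_cons !inE !eqxx !vr_eq.
  by move=> j _ nj; rewrite !only_cons !inE !vr_eq //= (negPf nj).
- move=> c; rewrite -up_blocks !mem_cat mem_rev => /or4P[cxy|/mem_up|cxyt|/mem_up]; try by right.
    by left; move: cxy; rewrite !inE => /orP[]->; rewrite ?orbT.
  by left; move: cxyt; case: ec => -[-> ->]; rewrite !inE //; rewrite orbCA.
Qed.

Lemma case56 U V : (forall n, 1 < n -> xy_frame n (U n)) ->
  (forall n, is_word (U n) && is_word (V n)) -> (forall n, U n <> V n) ->
  (forall n, 1 < n -> satisfies S (U n) (V n)) -> ~ finitely_based S.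
Proof.
move=> UF UVw nUV UV; apply: (nfb_of_invariant UV UVw) => k.
exists k.+2, (eq (U k.+2)); split=> //.
move=> w w' a b theta u v _ _ ctr ew; rewrite -ew in ctr.
by rewrite (xy_frame_isolated (ltnSn k.+1) (UF k.+2 isT) ctr).
Qed.

Lemma case5 : (forall n, 1 < n -> satisfies S (U5 n) (V5 n)) -> ~ finitely_based S.
Proof.
apply: case56 => [n _|//|n /(congr1 (head 0))/= /eqP]; last by rewrite vr_eq.
by apply: (@xy_frame_word n y x); left.
Qed.

Lemma case6 : (forall n, 1 < n -> satisfies S (U6 n) (V6 n)) -> ~ finitely_based S.
Proof.
apply: case56 => [n _|//|n /(congr1 (head 0))/= /eqP]; last by rewrite vr_eq.
by apply: (@xy_frame_word n x y); right.
Qed.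

End Case56.

(** * Case 3 *)

Ltac decide_eq := repeat match goal with |- context [@eq_op _ ?a ?b] =>
  first [have -> : (a == b) = false by lia | have -> : (a == b) = true by lia] end.
Ltac absent := apply/only0; let c := fresh in move=> c; rewrite !inE;
  case/orP=> /eqP->; rewrite ?inE !vr_eq //=; lia.
Ltac in_block1 hi :=
  rewrite /U3 /A3 /B3 /C3 /D3 !only_cat !(only_blocks1 hi);
  try (let j := fresh in let nj := fresh in move=> j ? nj; absent);
  rewrite !only_cons ?inE !vr_eq //=; decide_eq.
Ltac in_block2 i0 hj :=
  rewrite /U3 /A3 /B3 /C3 /D3 !only_cat !(only_blocks2 i0 hj);
  try (let j := fresh in let nj := fresh in move=> j ? nj ?; absent);
  rewrite !only_cons ?inE !vr_eq //=; decide_eq.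

Lemma U3_zt n i : 0 < i <= n ->
  only [:: ts (2 * i - 1); zs i] (U3 n) = [:: zs i; ts (2 * i - 1); zs i].
Proof. by move=> hi; in_block1 hi. Qed.
Lemma U3_pt n i : 0 < i <= n -> only [:: ts (2 * i); ps i] (U3 n) = [:: ps i; ts (2 * i); ps i].
Proof. by move=> hi; in_block1 hi. Qed.
Lemma U3_qt n i : 0 < i <= n ->
  only [:: ts (2 * n + 2 * i - 1); qs i] (U3 n) = [:: qs i; ts (2 * n + 2 * i - 1); qs i].
Proof. by move=> hi; in_block1 hi. Qed.
Lemma U3_rt n i : 0 < i <= n ->
  only [:: ts (2 * n + 2 * i); rs i] (U3 n) = [:: rs i; ts (2 * n + 2 * i); rs i].
Proof. by move=> hi; in_block1 hi. Qed.
Lemma U3_zx n i : 0 < i <= n -> only [:: zs i; x] (U3 n) = [:: zs i; x; zs i; x].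
Proof. by move=> hi; in_block1 hi. Qed.
Lemma U3_py n i : 0 < i <= n -> only [:: ps i; y] (U3 n) = [:: ps i; y; ps i; y].
Proof. by move=> hi; in_block1 hi. Qed.
Lemma U3_qx n i : 0 < i <= n -> only [:: qs i; x] (U3 n) = [:: x; qs i; x; qs i].
Proof. by move=> hi; in_block1 hi. Qed.
Lemma U3_ry n i : 0 < i <= n -> only [:: rs i; y] (U3 n) = [:: y; rs i; y; rs i].
Proof. by move=> hi; in_block1 hi. Qed.
Lemma U3_zq n i : 0 < i <= n -> only [:: zs i; qs i] (U3 n) = [:: zs i; zs i; qs i; qs i].
Proof. by move=> hi; in_block1 hi. Qed.
Lemma U3_pr n i : 0 < i <= n -> only [:: ps i; rs i] (U3 n) = [:: ps i; ps i; rs i; rs i].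
Proof. by move=> hi; in_block1 hi. Qed.
Lemma U3_tz n i j : 0 < i -> i < j <= n ->
  only [:: ts (2 * i - 1); zs j] (U3 n) = [:: ts (2 * i - 1); zs j; zs j].
Proof. by move=> i0 hj; in_block2 i0 hj. Qed.
Lemma U3_tp n i j : 0 < i -> i < j <= n ->
  only [:: ts (2 * i); ps j] (U3 n) = [:: ts (2 * i); ps j; ps j].
Proof. by move=> i0 hj; in_block2 i0 hj. Qed.
Lemma U3_qz n i : 0 < i < n ->
  only [:: zs i.+1; qs i] (U3 n) = [:: zs i.+1; qs i; zs i.+1; qs i].
Proof. move=> /andP[i0 hi]; have hj : i < i.+1 <= n by (rewrite ltnSn).
  by in_block2 i0 hj. Qed.
Lemma U3_rp n i : 0 < i < n ->
  only [:: ps i.+1; rs i] (U3 n) = [:: ps i.+1; rs i; ps i.+1; rs i].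
Proof. move=> /andP[i0 hi]; have hj : i < i.+1 <= n by (rewrite ltnSn).
  by in_block2 i0 hj. Qed.
Lemma U3_xy n : only [:: x; y] (U3 n) = [:: x; x; y; y].
Proof.
rewrite /U3 /A3 /B3 /C3 /D3 !only_cat !only_blocks0;
  try (by move=> j ?; absent); by rewrite !only_cons !inE !vr_eq.
Qed.

(** [l i] is the letter preceding block i: the last letter of block i - 1 or, for i = 1, whatever
    stands before the blocks. *)
Lemma path_blocks (R : rel nat) (g : nat -> word) (l : nat -> nat) n :
  (forall i, 0 < i <= n -> path R (l i) (g i) && (last (l i) (g i) == l i.+1)) ->
  path R (l 1) (blocks g n) /\ last (l 1) (blocks g n) = l n.+1.
Proof.
elim: n => // n IHn H; have [|IHp IHl] := IHn; first by move=> i hi; apply: H; lia.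
have -> : blocks g n.+1 = blocks g n ++ g n.+1.
  have ei : iota 1 n.+1 = iota 1 n ++ [:: n.+1] by rewrite -[in LHS](addn1 n) iotaD add1n.
  by rewrite /blocks ei map_cat flatten_cat /= cats0.
have /andP[pg /eqP lg] := H n.+1 (ltac:(lia)).
by rewrite cat_path last_cat IHp IHl pg lg.
Qed.

Lemma path_adjacent (R : rel nat) e0 (w p q : word) e h : path R e0 w -> w = p ++ e :: h :: q -> R e h.
Proof. by move=> pw ew; move: pw; rewrite ew cat_path /= => /and4P[]. Qed.

(* Whenever e and h are adjacent in this order, either a first occurrence of h
   follows a second occurrence of e, or a second occurrence of h follows a first
   occurrence of e: the situations governed by x t1 x y t2 y. *)
Definition alternating w : rel nat := fun e h =>
  [|| count_mem e w <= 1, count_mem h w <= 1, only [:: e; h] w == [:: e; e; h; h] |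
      only [:: e; h] w == [:: h; e; h; e]].

Lemma U3_count n i : 0 < i <= n ->
  [/\ count_mem (ts (2 * i - 1)) (U3 n) <= 1, count_mem (ts (2 * i)) (U3 n) <= 1,
      count_mem (ts (2 * n + 2 * i - 1)) (U3 n) <= 1 &
      count_mem (ts (2 * n + 2 * i)) (U3 n) <= 1].
Proof.
move=> hi; split; [have e := U3_zt hi | have e := U3_pt hi | have e := U3_qt hi | have e := U3_rt hi];
  by rewrite (count_only2 (mem_head _ _) e) /= !vr_eq /= ?eqxx.
Qed.

(** The blocks B and C interleave second occurrences of z_i or p_i with first occurrences of q_i or
    r_i, while in A and D every other letter is linear. The starting point [ts (2 * n)] is linear
    and so puts no condition on the first letter. *)
Lemma U3_alternating n : 0 < n -> path (alternating (U3 n)) (ts (2 * n)) (U3 n).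
Proof.
move=> n0; set R := alternating (U3 n).
have linl e h : count_mem e (U3 n) <= 1 -> R e h by move=> le1; rewrite /R /alternating le1.
have linr e h : count_mem h (U3 n) <= 1 -> R e h by move=> le1; rewrite /R /alternating le1 orbT.
have alt1 e h : only [:: e; h] (U3 n) = [:: e; e; h; h] -> R e h.
  by move=> E; rewrite /R /alternating E eqxx !orbT.
have alt2 e h : only [:: h; e] (U3 n) = [:: h; e; h; e] -> R e h.
  by move=> E; rewrite /R /alternating onlyC E eqxx !orbT.
have hn : 0 < n <= n by lia.
have [] := @path_blocks R (fun i => [:: zs i; ts (2 * i - 1); ps i; ts (2 * i)])
   (fun i => ts (if i == 1 then 2 * n else 2 * i - 2)) n.
  move=> i hi; have [c1 c2 _ _] := U3_count hi; rewrite /= !(linl (ts _)) ?linr //=.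
    by apply/eqP; congr ts; rewrite ifF; lia.
  case: eqP => [_|ni]; first by have [] := U3_count hn.
  have hi' : 0 < i.-1 <= n by lia.
  by have [_ + _ _] := U3_count hi'; congr (count_mem (ts _) _ <= 1); lia.
rewrite /= => pA lA.
have [] := @path_blocks R (fun i => [:: zs i; qs i]) (fun i => if i == 1 then x else qs i.-1) n.
  move=> i hi; rewrite /= (alt1 (zs i)) ?U3_zq // eqSS !andbT.
  rewrite [i == 0]gtn_eqF ?eqxx ?andbT; last by lia.
  case: eqP => [->|ni]; first by rewrite alt2 ?U3_zx //; lia.
  by have := @U3_qz n i.-1; rewrite prednK; [move=> E; apply: alt2; apply: E; lia | lia].
rewrite /= => pB lB.
have [] := @path_blocks R (fun i => [:: ps i; rs i]) (fun i => if i == 1 then y else rs i.-1) n.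
  move=> i hi; rewrite /= (alt1 (ps i)) ?U3_pr // eqSS !andbT.
  rewrite [i == 0]gtn_eqF ?eqxx ?andbT; last by lia.
  case: eqP => [->|ni]; first by rewrite alt2 ?U3_py //; lia.
  by have := @U3_rp n i.-1; rewrite prednK; [move=> E; apply: alt2; apply: E; lia | lia].
rewrite /= => pC lC.
have [] := @path_blocks R
   (fun i => [:: ts (2 * n + 2 * i - 1); qs i; ts (2 * n + 2 * i); rs i])
   (fun i => if i == 1 then y else rs i.-1) n.
  move=> i hi; have [_ _ c1 c2] := U3_count hi; rewrite /= !(linl (ts _)) ?linr //= eqSS.
  by rewrite [i == 0]gtn_eqF ?eqxx //; lia.
rewrite /= => pD lD.
have n1 : (n.+1 == 1) = false by lia.
rewrite n1 /= in lA lB lC lD.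
rewrite /U3 /A3 /B3 /C3 /D3 cat_path pA lA /= cat_path pB lB /= cat_path pC lC /= pD.
have lt : R (ts (2 * n.+1 - 2)) x.
  by apply: linl; have [_ + _ _] := U3_count hn; congr (count_mem (ts _) _ <= 1); lia.
rewrite lt (alt1 _ _ (U3_xy n)) /=.
have [qx ry] : R (qs n) x /\ R (rs n) y.
  by split; rewrite /R /alternating ?U3_qx ?U3_ry ?eqxx ?orbT.
by rewrite qx ry.
Qed.

Lemma mem_U3 n c : c \in U3 n -> [\/ c = x, c = y, count_mem c (U3 n) <= 1 |
  exists2 i, 0 < i <= n & [\/ c = zs i, c = ps i, c = qs i | c = rs i]].
Proof.
rewrite /U3 !mem_cat => /or4P[/mem_blocks[i hi]||/mem_blocks[i hi]|].
- have [c1 c2 _ _] := U3_count hi.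
  rewrite !inE => /or4P[]/eqP->; [constructor 4|by constructor 3|constructor 4|by constructor 3];
    exists i => //; [by constructor 1|by constructor 2].
- by rewrite inE => /eqP->; constructor 1.
- by rewrite !inE => /orP[]/eqP->; constructor 4; exists i => //; [constructor 1|constructor 3].
case/or4P=> [|/mem_blocks[i hi]||/mem_blocks[i hi]].
- by rewrite !inE => /orP[]/eqP->; [constructor 1|constructor 2].
- by rewrite !inE => /orP[]/eqP->; constructor 4; exists i => //; [constructor 2|constructor 4].
- by rewrite inE => /eqP->; constructor 2.
have [_ _ c1 c2] := U3_count hi.
rewrite !inE => /or4P[]/eqP->; [by constructor 3|constructor 4|by constructor 3|constructor 4];
  exists i => //; [by constructor 3|by constructor 4].
Qed.

Section Case3.
Variable S : monoid.
Hypothesis iso : isoT S [:: 0; 2; 0; 1; 3; 1].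

Lemma linear_patterns3 : [/\ isoT S [:: 0; 1], isoT S [:: 0; 1; 0], isoT S [:: 1; 0; 2; 0] &
  isoT S [:: 0; 2; 0; 1]].
Proof.
split.
- exact: (@isoT_factor _ _ [:: 0; 2] [:: 3; 1] [:: 0; 1]).
- apply: (@isoT_relabel _ [:: 0; 2; 0] _ [:: 0; 2; 1]) => //.
  exact: (@isoT_factor _ _ [::] [:: 1; 3; 1] [:: 0; 2; 0]).
- apply: (@isoT_relabel _ [:: 0; 1; 3; 1] _ [:: 1; 0; 3; 2]) => //.
  exact: (@isoT_factor _ _ [:: 0; 2] [::] [:: 0; 1; 3; 1]).
- exact: (@isoT_factor _ _ [::] [:: 3; 1] [:: 0; 2; 0; 1]).
Qed.

(** The displayed e is the last one and h follows it immediately. A letter l that splits e therefore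
    lies in p, after the first e. *)
Lemma only_split_before (T : eqType) (e h l : T) p q : e != l -> h != e -> h != l ->
  only [:: e; h] p = [:: e] -> only [:: e; h] q = [:: h] ->
  only [:: l; e] (p ++ e :: h :: q) = [:: e; l; e] ->
  [/\ only [:: l; e] p = [:: e; l], e \notin q, l \notin q & h \notin p].
Proof.
move=> nel nhe nhl ep eq; have eq0 : e \notin q.
  by apply/count_memPn; rewrite -(@count_only _ [:: e; h]) ?mem_head // eq /= (negPf nhe).
have hp0 : h \notin p.
  by apply/count_memPn; rewrite -(@count_only _ [:: e; h]) ?mem_second // ep /= eq_sym (negPf nhe).
rewrite only_cat !only_cons !inE eqxx orbT (negPf nhe) (negPf nhl) /= (only_run l eq0).
case E: (count_mem l q) => [|m] el.
  split=> //; last by apply/count_memPn.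
  by move: el; rewrite /= cats1 -[RHS]/(rcons [:: e; l] e) => /rcons_inj[].
move: el => /(congr1 (last e)); rewrite last_cat /=.
have -> : last l (nseq m l) = l by elim: (m).
by move=> le; rewrite le eqxx in nel.
Qed.

Lemma only_split_after (T : eqType) (e h l : T) p q : h != l -> h != e -> e != l ->
  only [:: e; h] p = [:: e] -> only [:: e; h] q = [:: h] ->
  only [:: l; h] (p ++ e :: h :: q) = [:: h; l; h] ->
  [/\ only [:: l; h] q = [:: l; h], h \notin p, l \notin p & e \notin q].
Proof.
move=> nhl nhe nel ep eq; have eq0 : e \notin q.
  by apply/count_memPn; rewrite -(@count_only _ [:: e; h]) ?mem_head // eq /= (negPf nhe).
have hp0 : h \notin p.
  by apply/count_memPn; rewrite -(@count_only _ [:: e; h]) ?mem_second // ep /= eq_sym (negPf nhe).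
rewrite only_cat !only_cons !inE eqxx orbT [e == h]eq_sym (negPf nhe) (negPf nel) /= (only_run l hp0).
case E: (count_mem l p) => [|m] /=; last by case=> lh; rewrite lh eqxx in nhl.
by case=> el; split=> //; apply/count_memPn.
Qed.

(** By [eq_from_adjacent] only consecutive letters c, d of u matter. They are consecutive in U_n, so
    [alternating] gives their pattern. The uncovered letters z and p split x and y, and every other
    repeated letter is split by a t of its own. *)
Lemma U3_isolated k n w' a b theta u v : k < n -> contracted S k (U3 n) w' a b theta u v ->
  w' = U3 n.
Proof.
have [iso01 iso010 iso1020 iso0201] := linear_patterns3.
move=> kn ctr; have n0 : 0 < n by lia.
have lin1 c : count_mem c (U3 n) <= 1 -> inl c \notin u by apply: (linear_notin ctr).
have tu i : 0 < i <= n -> [/\ inl (ts (2 * i - 1)) \notin u, inl (ts (2 * i)) \notin u,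
    inl (ts (2 * n + 2 * i - 1)) \notin u & inl (ts (2 * n + 2 * i)) \notin u].
  by move=> hi; have [] := U3_count hi; split; apply: lin1.
have [i j i0 hj|iz hiz zu] := few_indexed ctr kn (vr_inj (a := 2) isT).
  have hi : 0 < i <= n by lia.
  apply: (@nonrep_separated _ _ (ts (2 * i - 1))); rewrite ?vr_eq //.
  - by have [] := U3_count hi.
  - by rewrite onlyC U3_zt.
  - exact: U3_tz.
have [i j i0 hj|ip hip pu] := few_indexed ctr kn (vr_inj (a := 6) isT).
  have hi : 0 < i <= n by lia.
  apply: (@nonrep_separated _ _ (ts (2 * i))); rewrite ?vr_eq //.
  - by have [] := U3_count hi.
  - by rewrite onlyC U3_pt.
  - exact: U3_tp.
have c2 (E r : word) c : c \in E -> only E (U3 n) = r -> count_mem c r = 2 -> count_mem c (U3 n) = 2.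
  by move=> cE er <-; apply: count_only2 er.
have split_u c : inl c \in u -> count_mem c (U3 n) = 2 /\
    exists d r1 r2, [/\ inl d \notin u, only [:: d; c] (U3 n) = r1 ++ d :: r2,
      only [:: c] r1 = [:: c] & only [:: c] r2 = [:: c]].
  move=> cu; have := mem_inl ctr cu; have ed (d : nat) : only [:: d] [:: d] = [:: d] by rewrite only_cons mem_head.
  case/mem_U3=> [->|->|/lin1|[i hi]]; last 2 first.
  - by rewrite cu.
  - have [t1 t2 t3 t4] := tu i hi.
    case=> ->; (split; first by [apply: (c2 _ _ _ (mem_second _ _ _) (U3_zt hi)); rewrite /= ?eqxx !vr_eq
      | apply: (c2 _ _ _ (mem_second _ _ _) (U3_pt hi)); rewrite /= ?eqxx !vr_eq
      | apply: (c2 _ _ _ (mem_second _ _ _) (U3_qt hi)); rewrite /= ?eqxx !vr_eq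
      | apply: (c2 _ _ _ (mem_second _ _ _) (U3_rt hi)); rewrite /= ?eqxx !vr_eq]).
    + by exists (ts (2 * i - 1)), [:: zs i], [:: zs i]; rewrite U3_zt.
    + by exists (ts (2 * i)), [:: ps i], [:: ps i]; rewrite U3_pt.
    + by exists (ts (2 * n + 2 * i - 1)), [:: qs i], [:: qs i]; rewrite U3_qt.
    + by exists (ts (2 * n + 2 * i)), [:: rs i], [:: rs i]; rewrite U3_rt.
  - split; first by apply: (c2 _ _ _ (mem_head _ _) (U3_xy n)); rewrite /= ?eqxx !vr_eq.
    exists (zs iz), [:: zs iz; x], [:: x]; rewrite U3_zx //; split=> //.
    by rewrite !only_cons !inE !vr_eq.
  - split; first by apply: (c2 _ _ _ (mem_second _ _ _) (U3_xy n)); rewrite /= ?eqxx !vr_eq.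
    exists (ps ip), [:: ps ip; y], [:: y]; rewrite U3_py //; split=> //.
    by rewrite !only_cons !inE !vr_eq.
have fE E : {in E, forall c, inl c \in u} -> full (U3 n) u E.
  by move=> Eu; apply: (full_pairs ctr) => c /Eu cu; have [-> _] := split_u c cu.
have split_l c : inl c \in u -> exists l, only [:: inr l; inl c] u = [:: inl c; inr l; inl c].
  move=> cu; have [_ [d [r1 [r2 [du ed e1 e2]]]]] := split_u c cu.
  have fc : full (U3 n) u [:: c] by apply: fE => e; rewrite inE => /eqP->.
  by have [||l] := marker ctr fc du ed; rewrite ?e1 ?e2 //; exists l.
have lin : exchange_linear u v.
  apply: (exchange_linear_split ctr) => // c cu; have [-> _] := split_u c cu.
  by split=> //; exact: split_l.
suff evu : u = v by rewrite (ctr_tgt ctr) -evu -(ctr_src ctr).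
apply: eq_from_adjacent => [|p e h q eu neh]; first exact: exchange_perm.
case: h => [d|l] in eu neh *; last by rewrite lin.
case: e => [c|l] in eu neh *; last by rewrite onlyC [RHS]onlyC lin.
have ncd : c != d by apply: contra neh => /eqP->.
have cu : inl c \in u by rewrite eu mem_cat mem_head orbT.
have du : inl d \in u by rewrite eu mem_cat mem_second orbT.
have [[cc _] [cd _]] := (split_u c cu, split_u d du).
have fcd : full (U3 n) u [:: c; d] by apply: fE => e; rewrite !inE => /orP[]/eqP->.
have ew : U3 n = (a ++ expand (spell theta) p) ++ c :: d :: (expand (spell theta) q ++ b).
  by rewrite [LHS](ctr_src ctr) eu expand_cat !expand_cons /= -!catA.
have := path_adjacent (U3_alternating n0) ew; rewrite /alternating cc cd /=.
have ec : only [:: inl c; inl d] u = map inl (only [:: c; d] (U3 n)) := full_word ctr fcd.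
have [[l el] [l' el']] := (split_l c cu, split_l d du).
have eu2 : only [:: inl c; inl d] u =
    only [:: inl c; inl d] p ++ [:: inl c, inl d & only [:: inl c; inl d] q].
  by rewrite eu only_cat !only_cons mem_head mem_second.
have ncd' : (inl c : symb) != inl d by [].
have ndc' : (inl d : symb) != inl c by rewrite eq_sym.
case/orP=> /eqP ecd; rewrite ecd eu2 /= in ec.
(* Pattern c c d d: with the splitting letters, u restricts to the isoterm c l c d l' d. *)
- have [ep eq] : only [:: inl c; inl d] p = [:: inl c] /\ only [:: inl c; inl d] q = [:: inl d].
    move: ec; case: (only _ p) => [|e1 [|e2 [|e3 p']]] /=.
    + by case=> dc _; rewrite dc eqxx in ncd.
    + by case=> -> ->.
    + by case=> _ _ dc; rewrite dc eqxx in ncd.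
    + by move/(congr1 size); rewrite /= size_cat /=; lia.
  rewrite eu in el el'.
  have [p1 q1 q2 p2] := only_split_before (isT : inl c != inr l) ndc' (isT : inl d != inr l) ep eq el.
  have [q3 p3 p4 q4] := only_split_after (isT : inl d != inr l') ndc' (isT : inl c != inr l') ep eq el'.
  have nll' : l' != l.
    apply/eqP => ell'; suff : inr l \in p by rewrite -ell' (negPf p4).
    by have := mem_only [:: inr l; inl c] (inr l) p; rewrite p1 mem_second mem_head.
  have e4 : only [:: inr l'; inl d; inr l; inl c] u =
      [:: inl c; inr l; inl c; inl d; inr l'; inl d].
    rewrite eu only_cat !only_cons !inE !eqxx !orbT.
    rewrite (only_fresh _ p4) (only_fresh _ p3) p1.
    rewrite (@eq_only _ [:: inr l'; inl d; inr l; inl c] [:: inr l; inl c; inr l'; inl d]).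
      by rewrite (only_fresh _ q2) (only_fresh _ q1) q3.
    by move=> f; rewrite !inE; do !case: eqP.
  apply/esym/(exchange_stable ctr (E := [:: inr l'; inl d; inr l; inl c])).
    by move=> f; rewrite !inE => /orP[]->; rewrite ?orbT.
  rewrite e4; apply: (@isoT_pattern _ _ _ [:: inl c; inl d; inr l; inr l'] (inl c) iso) => //.
  rewrite /= !inE //= orbF andbT (inj_eq (@inl_inj _ _)) ncd /=.
  by apply: contra nll' => /eqP[->].
(* Pattern d c d c: u restricts to d l' c d l c, not one of the known isoterms. But exchanging c and
   d would turn v into d l' d c l c, which is an isoterm, and u would have to share it. *)
- have [ep eq] : only [:: inl d; inl c] p = [:: inl d] /\ only [:: inl d; inl c] q = [:: inl c].
    rewrite ![only [:: inl d; _] _]onlyC.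
    move: ec; case: (only _ p) => [|e1 [|e2 [|e3 p']]] /=.
    + by case=> dc _; rewrite dc eqxx in ncd.
    + by case=> -> ->.
    + by case=> _ _ dc; rewrite dc eqxx in ncd.
    + by move/(congr1 size); rewrite /= size_cat /=; lia.
  (* Transposing the adjacent c and d is invisible to a restriction containing just one of them, so
     the two splitting lemmas apply with the roles of c and d interchanged. *)
  have swap m f : (f == c) != (f == d) -> only [:: inr m; inl f] u =
      only [:: inr m; inl f] (p ++ inl d :: inl c :: q).
    rewrite eu !only_cat !only_cons !inE !(inj_eq (@inl_inj _ _)) /= ![_ == f]eq_sym.
    by case: (f == c); case: (f == d).
  have eld := el'; have elc := el.
  rewrite swap ?eqxx ?(negPf ncd) 1?eq_sym ?(negPf ncd) // in el.
  rewrite swap ?eqxx 1?[d == c]eq_sym ?(negPf ncd) // in el'.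
  have [p1 q1 q2 p2] := only_split_before (isT : inl d != inr l') ncd' (isT : inl c != inr l') ep eq el'.
  have [q3 p3 p4 q4] := only_split_after (isT : inl c != inr l) ncd' (isT : inl d != inr l) ep eq el.
  have nll' : l != l'.
    apply/eqP => ell'; suff : inr l' \in p by rewrite -ell' (negPf p4).
    by have := mem_only [:: inr l'; inl d] (inr l') p; rewrite p1 mem_second mem_head.
  set E4 := [:: inr l; inl c; inr l'; inl d].
  have e4 : only E4 u = [:: inl d; inr l'; inl c; inl d; inr l; inl c].
    rewrite /E4 eu only_cat !only_cons !inE !eqxx !orbT.
    rewrite (only_fresh _ p4) (only_fresh _ p3) p1.
    rewrite (@eq_only _ [:: inr l; inl c; inr l'; inl d] [:: inr l'; inl d; inr l; inl c]).
      by rewrite (only_fresh _ q2) (only_fresh _ q1) q3.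
    by move=> f; rewrite !inE; do !case: eqP.
  have u4 : uniq E4.
    rewrite /E4 /= !inE //= orbF andbT (inj_eq (@inl_inj _ _)) ncd /= andbT.
    by apply: contra nll' => /eqP[->].
  have sub4 F : all (mem E4) F -> only F u = only F [:: inl d; inr l'; inl c; inl d; inr l; inl c].
    by move/allP => sF; rewrite -e4 only_sub.
  have ndc : d != c by rewrite eq_sym.
  have pv f m : f \in E4 -> inr m \in E4 ->
      only [:: f; inr m] v = only [:: f; inr m] [:: inl d; inr l'; inl c; inl d; inr l; inl c].
    by move=> fE4 mE4; rewrite lin sub4 //= fE4 mE4.
  have lE4 : inr l \in E4 by rewrite mem_head.
  have l'E4 : inr l' \in E4 by rewrite !inE eqxx !orbT.
  have cE4 : inl c \in E4 by rewrite !inE eqxx !orbT.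
  have dE4 : inl d \in E4 by rewrite !inE eqxx !orbT.
  have nrll' : (inr l : symb) != inr l' by apply: contra nll' => /eqP[->].
  have nrl'l : (inr l' : symb) != inr l by rewrite eq_sym.
  have v_cl : only [:: inl c; inr l] v = [:: inl c; inr l; inl c].
    by rewrite pv // !only_cons !inE /= ?eqxx /= ?(negPf ndc') ?(negPf nrl'l) /=.
  have v_dl' : only [:: inl d; inr l'] v = [:: inl d; inr l'; inl d].
    by rewrite pv // !only_cons !inE /= ?eqxx /= ?(negPf ncd') ?(negPf nrll') /=.
  have v_dl : only [:: inl d; inr l] v = [:: inl d; inl d; inr l].
    by rewrite pv // !only_cons !inE /= ?eqxx /= ?(negPf ncd') ?(negPf nrl'l) /=.
  have v_cl' : only [:: inl c; inr l'] v = [:: inr l'; inl c; inl c].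
    by rewrite pv // !only_cons !inE /= ?eqxx /= ?(negPf ndc') ?(negPf nrll') /=.
  have v_ll' : only [:: inr l; inr l'] v = [:: inr l'; inr l].
    by rewrite pv // !only_cons !inE /= ?eqxx /= ?(negPf nrll') /= ?(negPf nrl'l) /=.
  have vmem e : count_mem e v = count_mem e u := exchange_count lin e.
  have cv : count_mem (inl c) v = 2 by rewrite (count_only2 (mem_head _ _) v_cl) /= eqxx.
  have dv : count_mem (inl d) v = 2 by rewrite (count_only2 (mem_head _ _) v_dl) /= eqxx.
  have l'v : inr l' \in v.
    by have := mem_only [:: inl d; inr l'] (inr l') v; rewrite v_dl' mem_second !inE eqxx orbT.
  have lv : inr l \in v.
    by have := mem_only [:: inl c; inr l] (inr l) v; rewrite v_cl mem_second !inE eqxx orbT.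
  have cvv : inl c \in v by rewrite -has_pred1 has_count cv.
  have dvv : inl d \in v by rewrite -has_pred1 has_count dv.
  (* The linear letters force v to begin with d and to end with c, among these two; only d c d c and
     d d c c remain. *)
  have hd : head (inl 0) (only [:: inl d; inl c] v) = inl d.
    by apply: (@head_only_trans _ _ (inr l')); rewrite ?v_dl' // onlyC v_cl'.
  have ld : last (inl 0) (only [:: inl c; inl d] v) = inl c.
    by apply: (@last_only_trans _ _ (inr l)); rewrite ?v_cl // onlyC v_dl.
  have := words_count22 ncd' (all_only [:: inl c; inl d] v).
  rewrite !count_only ?mem_head ?mem_second // => /(_ cv dv).
  rewrite !inE => /or4P[/eqP E|/eqP E|/eqP E|/or3P[] /eqP E]; rewrite [RHS]E.
  - by move: ld; rewrite E /= => -[dc]; rewrite dc eqxx in ncd.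
  - by move: ld; rewrite E /= => -[dc]; rewrite dc eqxx in ncd.
  - by move: hd; rewrite onlyC E /= => -[dc]; rewrite dc eqxx in ncd.
  - by move: ld; rewrite E /= => -[dc]; rewrite dc eqxx in ncd.
  - by rewrite eu2 ec.
  - have e4v : only E4 v = [:: inl d; inr l'; inl d; inl c; inr l; inl c].
      apply: only_from_pairs => //; first by rewrite /= lE4 l'E4 cE4 dE4.
      rewrite /E4 /= [only [:: inr l; inl c] v]onlyC [only [:: inr l; inl d] v]onlyC.
      rewrite [only [:: inr l'; inl d] v]onlyC v_cl v_dl' v_dl v_cl' v_ll' E.
      rewrite !only_cons !inE /= ?eqxx /= ?(negPf ndc') ?(negPf ncd') ?(negPf nrl'l) /= ?(negPf nrll') /=.
      by rewrite ?eqxx.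
    have i4 : isoT S (only E4 v).
      rewrite e4v; apply: (@isoT_pattern _ _ _ [:: inl d; inl c; inr l'; inr l] (inl d) iso) => //.
      rewrite /= !inE /= (negPf ndc') (negPf nrl'l) //.
    have sE : {subset [:: inl c; inl d] <= E4}.
      by move=> f; rewrite !inE => /orP[]->; rewrite ?orbT.
    by rewrite -(only_sub u sE) (isoT_only (eqsat_sym (ctr_eqsat ctr)) i4) only_sub // E.
Qed.

Lemma V3_xy n : only [:: x; y] (V3 n) = [:: x; y; x; y].
Proof.
rewrite /V3 /A3 /B3 /C3 /D3 !only_cat !only_blocks0;
  try (by move=> j ?; absent); by rewrite !only_cons !inE !vr_eq.
Qed.

Lemma case3 : (forall n, 1 < n -> satisfies S (U3 n) (V3 n)) -> ~ finitely_based S.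
Proof.
move=> UV; apply: (nfb_of_invariant UV) => [n|k].
  by rewrite /U3 /V3 /is_word -!size_eq0 !size_cat /=; lia.
exists k.+2, (eq (U3 k.+2)); split=> //.
  move=> /(congr1 (only [:: x; y])); rewrite U3_xy.
  by rewrite V3_xy => -[/eqP]; rewrite vr_eq.
move=> w w' a b theta u v _ _ ctr ew; rewrite -ew in ctr.
by rewrite (U3_isolated (ltnW (ltnSn k.+1)) ctr).
Qed.
End Case3.

(** * Case 8 *)

Lemma expand_rev theta u :
  expand (spell (fun h => rev (theta h))) (rev u) = rev (expand (spell theta) u).
Proof.
elim: u => // e u IHu; rewrite rev_cons -cats1 expand_cat IHu !expand_cons rev_cat.
by congr (_ ++ _); rewrite cats0; case: e.
Qed.

Lemma mem_spell theta e u d : e \in u -> d \in spell theta e -> d \in expand (spell theta) u.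
Proof.
by move=> /split_first[p [q [-> _]]] de; rewrite expand_cat expand_cons !mem_cat de orbT.
Qed.

(** Meant for the target of a step in case 8, with y, x, t1 for c, e, s. The occurrence of s between
    the two c is covered by a linear l of v. As all e follow both c, a linear l0 that comes after
    the first e of v lies beyond them too, and differs from l. *)
Lemma only_double (c e s : nat) a b theta (v : seq symb) m :
  c != e -> s != c ->
  count_mem c (a ++ expand (spell theta) v ++ b) = 2 -> count_mem (inl c) v = 2 ->
  (forall h, count_mem (inr h) v <= 1) -> inl s \notin v ->
  only [:: e; c] (a ++ expand (spell theta) v ++ b) = [:: c, c & nseq m e] ->
  only [:: s; c] (a ++ expand (spell theta) v ++ b) = [:: c; s; c] ->
  exists l, only [:: inr l; inl c; inl e] v = [:: inl c; inr l; inl c] ++ nseq (count_mem (inl e) v) (inl e) /\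
    forall l0 r, only [:: inl e; inr l0] v = inl e :: r -> 
      l0 != l /\ only [:: inr l; inl c; inl e; inr l0] v = [:: inl c, inr l, inl c, inl e & r].
Proof.
move=> nce nsc cw cv lin sv.
have nec : e != c by rewrite eq_sym.
have ncs : c != s by rewrite eq_sym.
have cv2 : 1 < count_mem (inl c) v by rewrite cv.
have [d1 [d2 [d3 ev]]] := count_gt1_split cv2.
have [cd1 cd2 cd3] : [/\ inl c \notin d1, inl c \notin d2 & inl c \notin d3].
  move: cv; rewrite ev !count_cat /= !count_cat /= eqxx => cv.
  by split; apply/count_memPn; slia.
have ew : a ++ expand (spell theta) v ++ b = (a ++ expand (spell theta) d1) ++ c ::
    expand (spell theta) d2 ++ c :: (expand (spell theta) d3 ++ b).
  by rewrite ev expand_cat expand_cons expand_cat expand_cons /= -!catA /= -!catA.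
move: cw; rewrite ew {ew}; move eqA: (a ++ _) => A; move eqB: (expand _ d2) => B.
move eqC: (_ ++ b) => C.
rewrite count_cat /= count_cat /= eqxx => cw.
have [cA cB cC] : [/\ c \notin A, c \notin B & c \notin C] by split; apply/count_memPn; slia.
rewrite !only_cat !only_cons !only_cat !only_cons mem_second !inE eqxx orbT.
rewrite !(only_run _ cA) !(only_run _ cB) !(only_run _ cC).
case eA : (count_mem e A) => [|k] /=; last by case=> ec; rewrite ec eqxx in nec.
case eB : (count_mem e B) => [|k] /=; last by case=> ec; rewrite ec eqxx in nec.
move=> _; case: (count_mem s A) => [|k] /=; last by case=> ec; rewrite ec eqxx in nsc.
case sB : (count_mem s B) => [|k] /=; first by case=> ec; rewrite ec eqxx in nsc.
move=> _; have /mem_expand[d4 [f [d5 [ed2 sf]]]] : s \in expand (spell theta) d2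
  by rewrite eqB -has_pred1 has_count sB.
have vd2 g : g \in d2 -> g \in v by move=> gd; rewrite ev mem_cat inE mem_cat gd !orbT.
case: f => [s'|l] in sf ed2.
  by move: sf; rewrite inE => /eqP es; rewrite es vd2 // ed2 mem_cat mem_head orbT in sv.
have ed1 : inl e \notin d1.
  apply/negP => /(mem_spell (theta := theta)) /(_ (mem_head _ _)) ein.
  by move/count_memPn/negP: eA; apply; rewrite -eqA mem_cat ein orbT.
have ed2' : inl e \notin d2.
  apply/negP => /(mem_spell (theta := theta)) /(_ (mem_head _ _)) ein.
  by move/count_memPn/negP: eB; apply; rewrite -eqB.
have := lin l; rewrite ev ed2 count_cat /= count_cat /= count_cat /= eqxx => cl.
have [ld1 ld4 ld5 ld3] : [/\ inr l \notin d1, inr l \notin d4, inr l \notin d5 & inr l \notin d3].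
  by clear -cl; split; apply/count_memPn; slia.
move: cd2 ed2'; rewrite ed2 !mem_cat !inE /= !negb_or => /andP[cd4 cd5] /andP[ed4 ed5].
exists l; split.
  have nil d : inr l \notin d -> inl c \notin d -> inl e \notin d -> only [:: inr l; inl c; inl e] d = [::].
    by move=> *; apply/only0 => g; rewrite !inE => /or3P[]/eqP->.
  rewrite !only_cat !only_cons !only_cat !only_cons !inE !eqxx !orbT.
  rewrite (nil d1) // (nil d4) // (nil d5) //= (only_fresh _ ld3) onlyC only_run //.
  congr [:: _, _, _ & nseq _ _].
  rewrite !count_cat /= !count_cat /= (count_memPn ed1) (count_memPn ed4) (count_memPn ed5).
  by rewrite (inj_eq (@inl_inj _ _)) (negPf nce).
move=> l0 r; rewrite !only_cat !only_cons !only_cat !only_cons !inE eqxx /=.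
have run d : inl e \notin d -> only [:: inl e; inr l0] d = nseq (count_mem (inr l0) d) (inr l0).
  by move=> ed; rewrite onlyC only_run.
rewrite (inj_eq (@inl_inj _ _)) (negPf nce) (run d1) // (run d4) // (run d5) //=.
case c1: (count_mem _ d1) => [|?] /=; last by case.
case c4: (count_mem _ d4) => [|?] /=; last by case.
case: eqP => /= [_ [] //|nl]; case c5: (count_mem _ d5) => [|?] /=; first last; first by case.
move=> el0.
have nl0 : l0 != l by apply/eqP => ell; apply: nl; rewrite ell.
split=> //; have nil d : inr l \notin d -> inl c \notin d -> inl e \notin d -> inr l0 \notin d ->
    only [:: inr l; inl c; inl e; inr l0] d = [::].
  by move=> *; apply/only0 => g; rewrite !inE => /or4P[]/eqP->.
rewrite eqxx (nil d1) ?(nil d4) ?(nil d5) //; try exact/count_memPn.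
by rewrite /= (only_fresh _ ld3) (only_fresh _ cd3) -el0.
Qed.

Lemma only_double_rev (c e s : nat) a b theta (v : seq symb) m :
  c != e -> s != c ->
  count_mem c (a ++ expand (spell theta) v ++ b) = 2 -> count_mem (inl c) v = 2 ->
  (forall h, count_mem (inr h) v <= 1) -> inl s \notin v ->
  only [:: e; c] (a ++ expand (spell theta) v ++ b) = nseq m e ++ [:: c; c] ->
  only [:: s; c] (a ++ expand (spell theta) v ++ b) = [:: c; s; c] ->
  exists l, only [:: inr l; inl c; inl e] v =
      nseq (count_mem (inl e) v) (inl e) ++ [:: inl c; inr l; inl c] /\
    forall l0 r, only [:: inl e; inr l0] v = rcons r (inl e) ->
      l0 != l /\ only [:: inr l; inl c; inl e; inr l0] v = rcons r (inl e) ++ [:: inl c; inr l; inl c].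
Proof.
move=> nce nsc; set w := a ++ _ => cw cv lin sv ece esc.
have ew : rev w = rev b ++ expand (spell (fun h => rev (theta h))) (rev v) ++ rev a.
  by rewrite expand_rev /w !rev_cat catA.
have [||||||l [el el0]] := @only_double c e s (rev b) (rev a) (fun h => rev (theta h)) (rev v) m nce nsc;
  rewrite -?ew ?count_rev ?mem_rev //.
- by move=> h; rewrite count_rev.
- by rewrite only_rev ece rev_cat rev_nseq.
- by rewrite only_rev esc.
exists l; split.
  by rewrite -[v in LHS]revK only_rev el rev_cat rev_nseq count_rev.
move=> l0 r er; have [|nl0 e4] := el0 l0 (rev r); first by rewrite only_rev er rev_rcons.
by split=> //; rewrite -[v]revK only_rev e4 !rev_cons revK -!cats1 -!catA.
Qed.

Lemma addn_edge i j k : i + j = k -> ~~ ((i < k) && (j < k)) ->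
  i = 0 /\ j = k \/ i = k /\ j = 0.
Proof. lia. Qed.

Section Case8.
Variables (S : monoid) (m : nat).
Hypothesis m2 : 2 < m.
Hypothesis iso1 : isoT S [:: 0; 0; 1; 1].
Hypothesis isoL : forall d, 0 < d < m -> isoT S ([:: 0; 1; 0] ++ nseq d 2 ++ 3 :: nseq (m - d) 2).
Hypothesis isoR : forall d, 0 < d < m -> isoT S (nseq (m - d) 2 ++ 1 :: nseq d 2 ++ [:: 0; 3; 0]).

Lemma linear_patterns8 : [/\ isoT S [:: 0; 1], isoT S [:: 0; 0; 1], isoT S [:: 0; 1; 0] &
  isoT S [:: 1; 0; 0]].
Proof.
have h1 : 0 < 1 < m by lia.
have i010 : isoT S [:: 0; 1; 0] by apply: (@isoT_factor _ _ [::] _ [:: 0; 1; 0] (isoL h1)).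
split=> //.
- exact: (@isoT_factor _ _ [::] [:: 0] [:: 0; 1]).
- exact: (@isoT_factor _ _ [::] [:: 1] [:: 0; 0; 1]).
- apply: (@isoT_relabel _ [:: 0; 1; 1] _ [:: 1; 0]) => //.
  exact: (@isoT_factor _ _ [:: 0] [::] [:: 0; 1; 1]).
Qed.

Lemma power_linear (T : eqType) (c l : T) i j : c != l -> i < m -> j < m -> i + j <= m ->
  isoT S (nseq i c ++ l :: nseq j c).
Proof.
(* The isoterms are given for positive d only, so i = 0 borrows the one for d = 1; the word is a
   factor of it. *)
move=> ncl im jm ijm; pose d := maxn i 1.
have hd : 0 < d < m by rewrite /d; lia.
have ed : nseq d 2 = nseq (d - i) 2 ++ nseq i 2 by rewrite -nseqD; congr nseq; rewrite /d; lia.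
have emd : nseq (m - d) 2 = nseq j 2 ++ nseq (m - d - j) 2.
  by rewrite -nseqD; congr nseq; rewrite /d; lia.
have iso : isoT S (nseq i 2 ++ 3 :: nseq j 2).
  apply: (@isoT_factor _ _ ([:: 0; 1; 0] ++ nseq (d - i) 2) (nseq (m - d - j) 2)).
  by have := isoL hd; rewrite ed emd -!catA.
have iso' : isoT S (nseq i 0 ++ 1 :: nseq j 0).
  apply: (isoT_relabel (E := [:: 2; 3; 0; 1]) iso) => //.
    by rewrite all_cat /= !all_nseq /= !orbT.
  by rewrite map_cat /= !map_nseq.
have := @isoT_pattern _ _ _ [:: c; l] c iso'; rewrite map_cat /= !map_nseq; apply.
  by rewrite inE ncl.
by rewrite all_cat /= !all_nseq /= !orbT.
Qed.

Lemma power_isoterm (T : eqType) (c : T) j : j < m -> isoT S (nseq j c).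
Proof.
move=> jm; have h : isoT S (nseq j 0 ++ 1 :: nseq 0 0) by apply: power_linear => //; lia.
have := @isoT_pattern _ _ _ [:: c] c (@isoT_factor _ _ [::] [:: 1] (nseq j 0) h).
by rewrite map_nseq; apply=> //; rewrite all_nseq orbT.
Qed.

(** For a linear letter l1 standing before or after all m occurrences of c: the words l1 c^m and c^m
    l1 need not be isoterms, but they become part of one once a letter l2 splits the power. *)
Lemma linear_power_split (T : eqType) (c l1 l2 : T) d : uniq [:: c; l1; l2] -> 0 < d < m ->
  isoT S (l1 :: nseq d c ++ l2 :: nseq (m - d) c) /\
  isoT S (nseq d c ++ l2 :: nseq (m - d) c ++ [:: l1]).
Proof.
move=> u3 hd.
have u4 : uniq [:: l1; c; l2] by apply: etrans u3; apply: perm_uniq; rewrite (perm_catCA [:: l1] [:: c] [:: l2]).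
split.
  have := @isoT_factor S _ [:: 0; 1] [::] (0 :: nseq d 2 ++ 3 :: nseq (m - d) 2).
  rewrite cats0 => /(_ (isoL hd)) iso.
  have iso' := @isoT_relabel _ _ (0 :: nseq d 1 ++ 2 :: nseq (m - d) 1) [:: 0; 3; 1; 2] iso.
  have {iso'} : isoT S (0 :: nseq d 1 ++ 2 :: nseq (m - d) 1).
    apply: iso' => //=; rewrite ?all_cat ?map_cat /= ?all_nseq ?map_nseq /= ?orbT //.
  move/(@isoT_pattern _ _ _ [:: l1; c; l2] c); rewrite /= map_cat /= !map_nseq; apply=> //.
  by rewrite all_cat /= !all_nseq /= !orbT.
have hd' : 0 < m - d < m by lia.
have := @isoT_factor S _ [::] [:: 3; 0] (nseq d 2 ++ 1 :: nseq (m - d) 2 ++ [:: 0]).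
have -> : [::] ++ (nseq d 2 ++ 1 :: nseq (m - d) 2 ++ [:: 0]) ++ [:: 3; 0] =
    nseq (m - (m - d)) 2 ++ 1 :: nseq (m - d) 2 ++ [:: 0; 3; 0].
  by rewrite -!catA /= -catA; congr (nseq _ _ ++ _); lia.
move=> /(_ (isoR hd')) iso.
have iso' := @isoT_relabel _ _ (nseq d 1 ++ 2 :: nseq (m - d) 1 ++ [:: 0]) [:: 0; 2; 1; 3] iso.
have {iso'} : isoT S (nseq d 1 ++ 2 :: nseq (m - d) 1 ++ [:: 0]).
  apply: iso' => //=; rewrite ?(all_cat, map_cat) /= ?(all_cat, map_cat) /= ?all_nseq ?map_nseq /= ?orbT //.
move/(@isoT_pattern _ _ _ [:: l1; c; l2] c); rewrite /= !map_cat /= !map_cat /= !map_nseq; apply=> //.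
by rewrite all_cat /= all_cat /= !all_nseq /= !orbT.
Qed.

Lemma double_power (T : eqType) (c l e l0 : T) : uniq [:: c; l; e; l0] ->
  (forall j, 0 < j < m -> isoT S ([:: c; l; c] ++ nseq j e)) /\
  (forall d, 0 < d < m -> isoT S ([:: c; l; c] ++ nseq d e ++ l0 :: nseq (m - d) e)).
Proof.
move=> u4; have iso d : 0 < d < m -> isoT S ([:: c; l; c] ++ nseq d e ++ l0 :: nseq (m - d) e).
  move=> hd; have := @isoT_pattern _ _ _ [:: c; l; e; l0] c (isoL hd) u4.
  rewrite all_cat /= all_cat /= !all_nseq /= !orbT => /(_ isT).
  by rewrite map_cat /= !map_nseq.
split=> // j hj; apply: (@isoT_factor _ _ [::] (l0 :: nseq (m - j) e)).
by have := iso j hj; rewrite -catA.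
Qed.

Lemma power_double (T : eqType) (c l e l0 : T) : uniq [:: c; l; e; l0] ->
  (forall j, 0 < j < m -> isoT S (nseq j e ++ [:: c; l; c])) /\
  (forall d, 0 < d < m -> isoT S (nseq d e ++ l0 :: nseq (m - d) e ++ [:: c; l; c])).
Proof.
move=> u4; have iso d : 0 < d < m -> isoT S (nseq d e ++ l0 :: nseq (m - d) e ++ [:: c; l; c]).
  move=> hd; have hd' : 0 < m - d < m by lia.
  have u4' : uniq [:: c; l0; e; l].
    move: u4; rewrite /= !inE !negb_or !andbT => /andP[/and3P[-> -> ->] /andP[/andP[nle nll0] nel0]].
    by rewrite /= eq_sym nel0 [l0 == l]eq_sym nll0 eq_sym nle.
  have := @isoT_pattern _ _ _ [:: c; l0; e; l] c (isoR hd') u4'.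
  rewrite all_cat /= all_cat /= !all_nseq /= !orbT => /(_ isT).
  rewrite map_cat /= map_cat /= !map_nseq /=.
  by have -> : m - (m - d) = d by lia.
split=> // j hj; apply: (@isoT_factor _ _ (nseq (m - j) e ++ [:: l0]) [::]).
have hj' : 0 < m - j < m by lia.
have := iso _ hj'; have -> : m - (m - j) = j by lia.
by rewrite cats0 -!catA.
Qed.

Lemma only_U8 n E : only E (U8 m n) = only E [:: y; t1] ++ nseq ((x \in E) * (m - 1)) x ++
  only E [:: y] ++ only E (blocks (fun i => [:: ps i; ps i]) n) ++ only E [:: z; x; t2; z].
Proof. by rewrite /U8 !only_cat /only filter_nseq. Qed.

Lemma U8_frame n E : all (fun c => c \in [:: x; y; z; t1; t2]) E ->
  only E (blocks (fun i => [:: ps i; ps i]) n) = [::].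
Proof.
move=> /allP fE; rewrite only_blocks0 // => i _; apply/only0 => c /fE.
by rewrite !inE => /or4P[|||/orP[]] /eqP->; rewrite !vr_eq.
Qed.

Lemma U8_yt n : only [:: t1; y] (U8 m n) = [:: y; t1; y].
Proof. by rewrite only_U8 U8_frame // !only_cons !inE !vr_eq. Qed.
Lemma U8_zt n : only [:: t2; z] (U8 m n) = [:: z; t2; z].
Proof. by rewrite only_U8 U8_frame // !only_cons !inE !vr_eq. Qed.
Lemma nseq_pred_cat (T : Type) (c : T) r : nseq (m - 1) c ++ c :: r = nseq m c ++ r.
Proof.
rewrite -[c :: r]/(nseq 1 c ++ r) catA -nseqD; congr (nseq _ _ ++ _); lia.
Qed.

Lemma U8_xt1 n : only [:: x; t1] (U8 m n) = t1 :: nseq m x.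
Proof.
rewrite only_U8 U8_frame // !only_cons !inE !vr_eq //= mul1n.
by rewrite nseq_pred_cat cats0.
Qed.
Lemma U8_xt2 n : only [:: x; t2] (U8 m n) = nseq m x ++ [:: t2].
Proof.
by rewrite only_U8 U8_frame // !only_cons !inE !vr_eq //= mul1n nseq_pred_cat.
Qed.
Lemma U8_xy n : only [:: x; y] (U8 m n) <> [:: y, y & nseq m x].
Proof.
rewrite only_U8 U8_frame // !only_cons !inE !vr_eq //= mul1n => -[].
by have -> : m - 1 = (m - 2).+1 by lia; move=> [/eqP]; rewrite vr_eq.
Qed.
Lemma U8_xz n : only [:: x; z] (U8 m n) <> nseq m x ++ [:: z; z].
Proof.
rewrite only_U8 U8_frame // !only_cons !inE !vr_eq //= mul1n -nseq_pred_cat => /eqP.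
by rewrite eqseq_cat // eqxx /= !eqseq_cons vr_eq.
Qed.
Lemma V8_xz n : only [:: x; z] (V8 m n) = nseq m x ++ [:: z; z].
Proof.
rewrite /V8 !only_cat U8_frame // !only_cons !inE !vr_eq //=.
by rewrite /only filter_nseq mem_head mul1n.
Qed.
Lemma U8_yp n i : 0 < i <= n -> only [:: y; ps i] (U8 m n) = [:: y; y; ps i; ps i].
Proof.
move=> hi; rewrite only_U8 (only_blocks1 hi).
  by rewrite !only_cons !inE !vr_eq //= eqxx.
by move=> j _ nj; rewrite !only_cons !inE !vr_eq //= (negPf nj).
Qed.
Lemma U8_pz n i : 0 < i <= n -> only [:: ps i; z] (U8 m n) = [:: ps i; ps i; z; z].
Proof.
move=> hi; rewrite only_U8 (only_blocks1 hi).
  by rewrite !only_cons !inE !vr_eq //= eqxx.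
by move=> j _ nj; rewrite !only_cons !inE !vr_eq //= (negPf nj).
Qed.
Lemma U8_pp n i j : 0 < i -> i < j <= n ->
  only [:: ps i; ps j] (U8 m n) = [:: ps i; ps i; ps j; ps j].
Proof.
move=> i0 hj; rewrite only_U8 (only_blocks2 i0 hj).
  have [nij nji] : i != j /\ j != i by lia.
  by rewrite !only_cons !inE !vr_eq //= !eqxx (negPf nji) orbT.
by move=> l _ nli nlj; rewrite !only_cons !inE !vr_eq //= ?(negPf nli) ?(negPf nlj).
Qed.

Lemma mem_U8 n c : c \in U8 m n ->
  c \in [:: x; y; z; t1; t2] \/ exists2 i, 0 < i <= n & c = ps i.
Proof.
rewrite /U8 !mem_cat => /or4P[|/nseqP[-> _]||/orP[/mem_blocks[i hi]|]].
- by rewrite !inE => /orP[]/eqP->; left; rewrite ?eqxx ?orbT.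
- by left.
- by rewrite !inE => /eqP->; left; rewrite eqxx ?orbT.
- by rewrite !inE orbb => /eqP->; right; exists i.
- by rewrite !inE => /or4P[]/eqP->; left; rewrite ?eqxx ?orbT.
Qed.

(** The last two conditions force an x on either side of the first p_i. As x^m need not be an
    isoterm, the number of its letters has to be carried along by the invariant itself. *)
Definition x_spread w := [/\ only [:: x; t1] w = t1 :: nseq m x,
  only [:: x; t2] w = nseq m x ++ [:: t2], only [:: x; y] w <> [:: y, y & nseq m x] &
  only [:: x; z] w <> nseq m x ++ [:: z; z]].

Lemma case8_step k n w w' a b theta u v : k < n -> satisfies S (U8 m n) w ->
  satisfies S (U8 m n) w' -> contracted S k w w' a b theta u v -> x_spread w -> x_spread w'.
Proof.
have [iso01 iso001 iso010 iso100] := linear_patterns8.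
have iso00 : isoT S [:: 0; 0] by apply: (@isoT_factor _ _ [::] [:: 1; 1] [:: 0; 0]).
move=> kn Uw Uw' ctr [xt1 xt2 xy xz]; have n1 : 0 < 1 <= n by lia.
have U2 q c E r : satisfies S (U8 m n) q -> c \in E -> only E (U8 m n) = r ->
    0 < count_mem c r <= 2 -> count_mem c q = count_mem c r by move=> Uq; apply: (class_count iso00 Uq).
have cy q : satisfies S (U8 m n) q -> count_mem y q = 2.
  by move=> Uq; rewrite (U2 _ _ _ _ Uq _ (U8_yt n)) ?mem_second //= !vr_eq.
have cz q : satisfies S (U8 m n) q -> count_mem z q = 2.
  by move=> Uq; rewrite (U2 _ _ _ _ Uq _ (U8_zt n)) ?mem_second //= !vr_eq.
have ct1 : count_mem t1 w = 1 by rewrite (U2 _ _ _ _ Uw _ (U8_yt n)) ?mem_head //= !vr_eq.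
have ct2 : count_mem t2 w = 1 by rewrite (U2 _ _ _ _ Uw _ (U8_zt n)) ?mem_head //= !vr_eq.
have cp i : 0 < i <= n -> count_mem (ps i) w = 2.
  by move=> hi; rewrite (U2 _ _ _ _ Uw _ (U8_pz hi)) ?mem_head //= ?eqxx !vr_eq.
have count_nseq_x r : count_mem x (nseq m x ++ r) = m + count_mem x r.
  by rewrite count_cat count_nseq /= eqxx mul1n.
have cx : count_mem x w = m.
  by rewrite (count_only2 _ xt2) ?mem_head // count_nseq_x /= vr_eq ?addn0.
have yp i : 0 < i <= n -> only [:: y; ps i] w = [:: y; y; ps i; ps i].
  by move=> hi; apply: (class_only Uw iso1 (U8_yp hi)); letters.
have pz i : 0 < i <= n -> only [:: ps i; z] w = [:: ps i; ps i; z; z].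
  by move=> hi; apply: (class_only Uw iso1 (U8_pz hi)); letters.
have yt : only [:: t1; y] w' = [:: y; t1; y].
  by apply: (class_only Uw' (isoT_relabel (E := [:: 1; 0]) iso010 _ _ erefl) (U8_yt n)); letters.
have zt : only [:: t2; z] w' = [:: z; t2; z].
  by apply: (class_only Uw' (isoT_relabel (E := [:: 1; 0]) iso010 _ _ erefl) (U8_zt n)); letters.
have tu1 : inl t1 \notin u by apply: (linear_notin ctr); rewrite ct1.
have tu2 : inl t2 \notin u by apply: (linear_notin ctr); rewrite ct2.
have [i j i0 hj|i hi pu] := few_indexed ctr kn (vr_inj (a := 6) isT).
  have e4 : only [:: ps i; ps j] w = [:: ps i; ps i; ps j; ps j].
    have [nij nji] : i != j /\ j != i by lia.
    by apply: (class_only Uw iso1 (U8_pp i0 hj)); letters; rewrite ?(negPf nij) ?(negPf nji).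
  by apply: (nonrep_nonsquare _ e4); rewrite vr_eq //=; lia.
(* Before the first p_i there are both y and no z. Without an x there, x and y would form y y x^m;
   without an x after it, x and z would form x^m z z. *)
have [p [q [ew xp xq]]] : exists p q, [/\ w = p ++ ps i :: q, x \in p & x \in q].
  have pw : ps i \in w by rewrite -has_pred1 has_count cp.
  have [p [q [ew pp]]] := split_first pw; exists p, q.
  have zp : z \notin p.
    have := pz i hi; rewrite ew only_cat only_cons mem_head [only _ p]onlyC (only_run z pp).
    case E: (count_mem z p) => [|?] /=; first by move=> _; apply/count_memPn.
    by case=> /eqP; rewrite vr_eq.
  have cyp : count_mem y p = 2.
    have := yp i hi; rewrite ew only_cat only_cons mem_second (only_run y pp).
    by case: (count_mem y p) => [|[|[|?]]] //= [] /eqP; rewrite vr_eq.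
  have [cyq czq] : count_mem y q = 0 /\ count_mem z q = 2.
    have := cy w Uw; have := cz w Uw; rewrite ew !count_cat /= cyp (count_memPn zp) !vr_eq //=.
    by split; lia.
  have yq : y \notin q by apply/count_memPn.
  split=> //; apply/negPn/negP => nx.
  - apply: xy; rewrite ew only_cat only_cons !inE !vr_eq //= onlyC only_run // cyp only_run //.
    have := cx; rewrite ew count_cat /= (count_memPn nx) vr_eq //= => <-.
    by rewrite add0n.
  - apply: xz; rewrite ew only_cat only_cons !inE !vr_eq //= (only_run x zp).
    rewrite [only _ q]onlyC only_run // czq.
    have := cx; rewrite ew count_cat /= (count_memPn nx) vr_eq //= => <-.
    by rewrite !addn0.
(* If all m occurrences of x are letters of u, the linear variable covering the first p_i splits
   them. *)
have splitx : count_mem (inl x) u = m -> exists l d, 0 < d < m /\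
    only [:: inl x; inr l] u = nseq d (inl x) ++ inr l :: nseq (m - d) (inl x).
  move=> cxu; have fx : full w u [:: x] by move=> c; rewrite inE => /eqP->; rewrite cx cxu.
  have cpq : count_mem x p + count_mem x q = m.
    by rewrite -cx ew count_cat /= vr_eq.
  have [xp0 xq0] : 0 < count_mem x p /\ 0 < count_mem x q by rewrite -!has_count !has_pred1.
  have [||l el] := marker_at ctr fx pu ew; rewrite ?only1.
  - by case: (count_mem x p) xp0.
  - by case: (count_mem x q) xq0.
  exists l, (count_mem x p); split; first by lia.
  by rewrite onlyC el !only1 !map_nseq; congr (_ ++ _ :: nseq _ _); lia.
have count_x_le : count_mem (inl x) u <= m by rewrite -cx; apply: (count_inl ctr).
(* For x against a linear l, a word x^i l x^j with both exponents below m is an isoterm. If one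
   exponent is m, the splitting letter l0 has to be added. *)
have lin : exchange_linear u v.
  apply: (exchange_linear_intro ctr) => // c l cu.
  have [ecx|ncx] := eqVneq c x; last first.
    apply: (exchange_double ctr) => //; have := mem_inl ctr cu.
    rewrite (satisfies_mem iso01 Uw) => /mem_U8[|[h hh ->]]; last by rewrite cp.
    by rewrite !inE (negPf ncx) /= => /or4P[] /eqP->; rewrite ?cy ?cz ?ct1 ?ct2.
  rewrite ecx in cu *; set j := count_mem (inl x) u in count_x_le splitx.
  have ncl : (inl x : symb) != inr l by [].
  have run r : inr l \notin r -> only [:: inl x; inr l] r = nseq (count_mem (inl x) r) (inl x).
    by move=> lr; rewrite only_run.
  have := ctr_linear ctr l; case: (boolP (inr l \in u)) => lu _; last first.
    have [jm|jm] := ltnP j m.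
      by apply: (isoT_only (ctr_eqsat ctr)); rewrite run //; apply: power_isoterm.
    have jm' : j = m by apply/eqP; rewrite eqn_leq count_x_le.
    have [l0 [d [hd el0]]] := splitx jm'; have [d0 dm] := andP hd.
    have md : m - d < m by rewrite ltn_subrL d0 (leq_trans _ dm).
    apply: (exchange_stable ctr (E := [:: inr l; inl x; inr l0])).
      by move=> f; rewrite !inE => /orP[]->; rewrite ?orbT.
    by rewrite (only_fresh _ lu) el0; apply: (power_linear _ dm md); rewrite // subnKC // ltnW.
  have [r1 [r2 [eu lr1]]] := split_first lu.
  have lr2 : inr l \notin r2.
    apply/count_memPn; have := ctr_linear ctr l; rewrite eu count_cat /= eqxx => cl.
    by clear -cl; slia.
  have ej : j = count_mem (inl x) r1 + count_mem (inl x) r2 by rewrite /j eu count_cat.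
  have el : only [:: inl x; inr l] u =
      nseq (count_mem (inl x) r1) (inl x) ++ inr l :: nseq (count_mem (inl x) r2) (inl x).
    by rewrite eu only_cat only_cons mem_second !run.
  move: el ej; set j1 := count_mem _ r1; set j2 := count_mem _ r2 => el ej.
  have [inside|edge] := boolP ((j1 < m) && (j2 < m)).
    apply: (isoT_only (ctr_eqsat ctr)); rewrite el; have [j1m j2m] := andP inside.
    by apply: (power_linear _ j1m j2m); rewrite // -ej.
  have jm : j = m.
    apply/eqP; rewrite eqn_leq count_x_le /= ej; move: edge; rewrite negb_and -!leqNgt.
    by case/orP=> /leq_trans; apply; rewrite ?leq_addr ?leq_addl.
  have [l0 [d [hd el0]]] := splitx jm.
  have [d0 dm] := andP hd; have md : m - d < m by rewrite ltn_subrL d0 (leq_trans _ dm).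
  have [ell0|nll0] := eqVneq l l0.
    apply: (isoT_only (ctr_eqsat ctr)); rewrite ell0 el0.
    by apply: (power_linear _ dm md); rewrite // subnKC // ltnW.
  have u3 : uniq [:: inl x; inr l; inr l0 : symb].
    by rewrite /= !inE /= andbT; apply: contra nll0 => /eqP[->].
  have [iso3 iso3'] := linear_power_split u3 hd.
  have [d' [md' [ed emd]]] : exists d' md', d = d'.+1 /\ m - d = md'.+1.
    by exists d.-1, (m - d).-1; rewrite !prednK // subn_gt0.
  apply: (exchange_stable ctr (E := [:: inr l; inl x; inr l0])).
    by move=> f; rewrite !inE => /orP[]->; rewrite ?orbT.
  have {edge} [[j10 j2m]|[j1m j20]] : j1 = 0 /\ j2 = m \/ j1 = m /\ j2 = 0.
    by apply: addn_edge edge; rewrite -jm ej.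
    rewrite j10 j2m in el; have el0' := el0; rewrite ed in el0'.
    by rewrite (only_before u3 el el0') -cat_cons -[_ :: nseq d' _]/(nseq d'.+1 _) -ed.
  rewrite j1m j20 /= cats1 in el; have el0' := el0; rewrite emd in el0'.
  have er : nseq d (inl x) ++ inr l0 :: nseq md'.+1 (inl x) =
      rcons (nseq d (inl x) ++ inr l0 :: nseq md' (inl x)) (inl x : symb).
    by rewrite -[md'.+1]addn1 nseqD -cats1 -catA.
  rewrite er in el0'; rewrite (only_after u3 el el0') -er -emd -cats1 -catA /=.
  exact: iso3'.
have cvu e : count_mem e v = count_mem e u by apply: exchange_count.
have vlin h : count_mem (inr h) v <= 1 by rewrite cvu (ctr_linear ctr).
have full_double c : inl c \in u -> count_mem c w = 2 -> count_mem (inl c) v = 2.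
  move=> cu cw; rewrite cvu; have := count_inl ctr c; have := ctr_repeated ctr cu; rewrite cw; slia.
have x_pos : inl x \in u -> 0 < count_mem (inl x) u by rewrite -has_count has_pred1.
split.
- rewrite -xt1; apply/eqP/negPn/negP => /eqP /(exchange_transfer ctr lin)[_ tu _].
  by rewrite tu in tu1.
- rewrite -xt2; apply/eqP/negPn/negP => /eqP /(exchange_transfer ctr lin)[_ tu _].
  by rewrite tu in tu2.
(* Suppose all x end up after both y. Since t1 still separates the y, v restricts to y l y x^j with
   j < m or to y l y x^d l0 x^(m-d). Both are isoterms, so u would agree with v on x and y. *)
- move=> exy; have neq : only [:: x; y] w' <> only [:: x; y] w by rewrite exy; apply: nesym.
  have [xu yu unst] := exchange_transfer ctr lin neq.
  have sv : inl t1 \notin v by rewrite (exchange_mem lin).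
  have cyw' := cy w' Uw'; rewrite (ctr_tgt ctr) in exy yt cyw'.
  have [||l [el el0]] := only_double _ _ cyw' (full_double y yu (cy w Uw)) vlin sv exy yt.
  + by rewrite vr_eq.
  + by rewrite vr_eq.
  have iso_unst F : {subset [:: inl x; inl y] <= F} -> isoT S (only F v) -> False.
    move=> sF iF; apply: unst; rewrite -(only_sub v sF) -(only_sub u sF).
    by rewrite (isoT_only (eqsat_sym (ctr_eqsat ctr)) iF).
  have [jm|jm] := ltnP (count_mem (inl x) u) m.
    apply: (iso_unst [:: inr l; inl y; inl x]); first by move=> f; rewrite !inE => /orP[]->; rewrite ?orbT.
    (* The index l + 1 provides a fourth distinct letter. *)
    rewrite el cvu; have u4 : uniq [:: inl y; inr l; inl x; inr l.+1 : symb].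
      by rewrite /= !inE /= andbT (inj_eq (@inr_inj _ _)) neq_ltn ltnSn.
    by apply: (double_power u4).1; rewrite x_pos.
  have jm' : count_mem (inl x) u = m by apply/eqP; rewrite eqn_leq count_x_le.
  have [l0 [d [hd ed]]] := splitx jm'; have [d0 dm] := andP hd.
  have [d' edd] : exists d', d = d'.+1 by exists d.-1; rewrite prednK.
  have edv : only [:: inl x; inr l0] v = nseq d (inl x) ++ inr l0 :: nseq (m - d) (inl x).
    by rewrite lin.
  have [|nl0 e4] := el0 l0 (nseq d' (inl x) ++ inr l0 :: nseq (m - d) (inl x)); first by rewrite edv edd.
  apply: (iso_unst [:: inr l; inl y; inl x; inr l0]); first by move=> f; rewrite !inE => /orP[]->; rewrite ?orbT.
  have u4 : uniq [:: inl y; inr l; inl x; inr l0 : symb].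
    by rewrite /= !inE //= andbT; apply: contra nl0 => /eqP[->].
  by have := (double_power u4).2 d hd; rewrite e4 edd.
(* The mirror image, with z and t2 instead of y and t1. *)
- move=> exz; have neq : only [:: x; z] w' <> only [:: x; z] w by rewrite exz; apply: nesym.
  have [xu zu unst] := exchange_transfer ctr lin neq.
  have sv : inl t2 \notin v by rewrite (exchange_mem lin).
  have czw' := cz w' Uw'; rewrite (ctr_tgt ctr) in exz zt czw'.
  have [||l [el el0]] := only_double_rev _ _ czw' (full_double z zu (cz w Uw)) vlin sv exz zt.
  + by rewrite vr_eq.
  + by rewrite vr_eq.
  have iso_unst F : {subset [:: inl x; inl z] <= F} -> isoT S (only F v) -> False.
    move=> sF iF; apply: unst; rewrite -(only_sub v sF) -(only_sub u sF).
    by rewrite (isoT_only (eqsat_sym (ctr_eqsat ctr)) iF).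
  have [jm|jm] := ltnP (count_mem (inl x) u) m.
    apply: (iso_unst [:: inr l; inl z; inl x]); first by move=> f; rewrite !inE => /orP[]->; rewrite ?orbT.
    rewrite el cvu; have u4 : uniq [:: inl z; inr l; inl x; inr l.+1 : symb].
      by rewrite /= !inE /= andbT (inj_eq (@inr_inj _ _)) neq_ltn ltnSn.
    by apply: (power_double u4).1; rewrite x_pos.
  have jm' : count_mem (inl x) u = m by apply/eqP; rewrite eqn_leq count_x_le.
  have [l0 [d [hd ed]]] := splitx jm'; have [d0 dm] := andP hd.
  have [d' edd] : exists d', m - d = d' + 1 by exists (m - d).-1; rewrite addn1 prednK // subn_gt0.
  have edv : only [:: inl x; inr l0] v = rcons (nseq d (inl x) ++ inr l0 :: nseq d' (inl x)) (inl x).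
    by rewrite lin ed edd nseqD -cats1 -catA.
  have [nl0 e4] := el0 l0 _ edv.
  apply: (iso_unst [:: inr l; inl z; inl x; inr l0]); first by move=> f; rewrite !inE => /orP[]->; rewrite ?orbT.
  have u4 : uniq [:: inl z; inr l; inl x; inr l0 : symb].
    by rewrite /= !inE //= andbT; apply: contra nl0 => /eqP[->].
  by have := (power_double u4).2 d hd; rewrite e4 edd nseqD -cats1 -!catA.
Qed.

Lemma case8 : (forall n, 1 < n -> satisfies S (U8 m n) (V8 m n)) -> ~ finitely_based S.
Proof.
move=> UV; apply: (nfb_of_invariant UV) => [//|k].
exists k.+2, x_spread; split=> //.
- by split; [exact: U8_xt1|exact: U8_xt2|exact: U8_xy|exact: U8_xz].
- by case=> _ _ _; apply; exact: V8_xz.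
- by move=> w w' a b theta u v; apply: case8_step; apply: ltnW.
Qed.

End Case8.

(** * Case 7 and the theorem *)

Lemma subst_cat theta u v : subst theta (u ++ v) = subst theta u ++ subst theta v.
Proof. by rewrite /subst map_cat flatten_cat. Qed.

Lemma subst_id theta w : {in w, forall c, theta c = [:: c]} -> subst theta w = w.
Proof.
elim: w => // c w IHw H; rewrite -cat1s subst_cat IHw => [|d dw].
  by rewrite /subst /= cats0 H ?mem_head.
by apply: H; rewrite inE dw orbT.
Qed.

(* Erasing x_2, ..., x_n and renaming x_1 to x reduces case 7 to case 1. *)
Lemma U7_V7_U1_V1 S n : 0 < n -> satisfies S (U7 n) (V7 n) -> satisfies S (U1 n) (V1 n).
Proof.
move=> n0 /satisfies_subst H.
pose theta c := if c == xs 1 then [:: x] else if c \in up xs n then [::] else [:: c].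
have ys_id : {in up ys n, forall c, theta c = [:: c]}.
  move=> _ /mem_up[i _ ->]; rewrite /theta vr_eq //= ifN //.
  by apply/negP => /mem_up[j _] /eqP; rewrite vr_eq.
have up_x : subst theta (up xs n) = [:: x] /\ subst theta (down xs n) = [:: x].
  have e1 : up xs n = xs 1 :: map xs (iota 2 n.-1) by rewrite /up -{1}(prednK n0).
  have e2 : {in map xs (iota 2 n.-1), forall c, theta c = [::]}.
    move=> c cin; have cu : c \in up xs n by rewrite e1 inE cin orbT.
    move: cin; rewrite /theta cu => /mapP[i]; rewrite mem_iota => hi ->.
    by rewrite vr_eq //= ifN //; lia.
  have t1x : theta (xs 1) = [:: x] by rewrite /theta eqxx.
  rewrite /down e1 rev_cons -cats1 subst_cat /subst /= t1x !flatten_nil // => c.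
  by rewrite mem_rev => /e2.
have up_y : subst theta (up ys n) = up ys n by apply: subst_id.
have down_y : subst theta (down ys n) = down ys n.
  by apply: subst_id => c; rewrite mem_rev => /ys_id.
have := H theta; rewrite /U7 /V7 !subst_cat up_y down_y.
by have [-> ->] := up_x.
Qed.

Local Transparent vr.

Theorem theorem4p4 (S : monoid) :
  nfb_criterion S W1 U1 V1 /\
  nfb_criterion S W2 U2 V2 /\
  nfb_criterion S W3 U3 V3 /\
  nfb_criterion S W4 U4 V4 /\
  nfb_criterion S W56 U5 V5 /\
  nfb_criterion S W56 U6 V6 /\
  nfb_criterion S W7 U7 V7 /\
  (forall m : nat, 2 < m -> nfb_criterion S (W8 m) (U8 m) (V8 m)).
Proof.
(* [ls] lists the letters in the order of their numbers in the pattern. *)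
have pattern (W : seq word) w ls (pat : word) : (forall w, w \in W -> isoterm S w) -> w \in W ->
    [&& is_word w, uniq ls, all (mem ls) w & map (index^~ ls) w == pat] -> isoT S pat.
  by move=> iso wW; apply: isoterm_pattern; apply: iso.
split; [|split; [|split; [|split; [|split; [|split; [|split]]]]]].
- by move=> iso; apply: case1; apply: (pattern _ _ [:: x; y] _ iso (mem_head _ _)).
- move=> iso; apply: case2; first by apply: (pattern _ _ [:: y; x; t] _ iso (mem_head _ _)).
  by apply: (pattern _ _ [:: y; x; t] _ iso (mem_second _ _ _)).
- by move=> iso; apply: case3; apply: (pattern _ _ [:: x; y; t1; t2] _ iso (mem_head _ _)).
- move=> iso; apply: case4; first by apply: (pattern _ _ [:: x; y] _ iso (mem_head _ _)).
  by apply: (pattern _ _ [:: x; y; t1; t2] _ iso (mem_second _ _ _)).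
- move=> iso; apply: case5.
  + by apply: (pattern _ _ [:: x; t1; y; t2] _ iso (mem_head _ _)).
  + by apply: (pattern _ _ [:: x; y; t] _ iso (mem_second _ _ _)).
  + by apply: (pattern _ [:: x; y; t; y; x] [:: x; y; t] _ iso).
- move=> iso; apply: case6.
  + by apply: (pattern _ _ [:: x; t1; y; t2] _ iso (mem_head _ _)).
  + by apply: (pattern _ _ [:: x; y; t] _ iso (mem_second _ _ _)).
  + by apply: (pattern _ [:: x; y; t; y; x] [:: x; y; t] _ iso).
- move=> iso UV; apply: case1; first by apply: (pattern _ _ [:: x; y] _ iso (mem_second _ _ _)).
  by move=> n n1; apply: U7_V7_U1_V1; [apply: ltnW|apply: UV].
move=> m m2 iso; apply: (case8 m2).
- by apply: (pattern _ _ [:: x; y] _ iso (mem_head _ _)).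
- move=> d hd; apply: (pattern _ ([:: y; t1; y] ++ nseq d x ++ [:: t2] ++ nseq (m - d) x)
    [:: y; t1; x; t2] _ iso).
    rewrite !mem_cat; apply/orP; right; apply/orP; left; apply/mapP; exists d => //.
    by rewrite mem_iota; lia.
  by rewrite /= !all_cat /= !all_nseq !map_cat /= !map_nseq /= !orbT eqxx.
- move=> d hd; apply: (pattern _ (nseq (m - d) x ++ [:: t1] ++ nseq d x ++ [:: y; t2; y])
    [:: y; t1; x; t2] _ iso).
    rewrite !mem_cat; apply/orP; right; apply/orP; right; apply/mapP; exists d => //.
    by rewrite mem_iota; lia.
  rewrite /is_word -size_eq0 size_cat size_nseq !all_cat /= !all_nseq.
  by rewrite addnS !orbT ?(map_cat, map_nseq) /= ?(map_cat, map_nseq) /=.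
Qed.
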